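(* Assume the setting below, fix $\lambda>0$, and suppose $\varpi_{H-qB}+q\,\varpi_B>0$. Then for every $\bm x\in\mathbb{R}^d$ the stochastic integral $$X_\lambda(\bm x)=\int_{\mathbb{R}^d}\Big[e^{-\lambda\varphi(\bm x-\bm y)}\varphi(\bm x-\bm y)^{H-qB}-e^{-\lambda\varphi(-\bm y)}\varphi(-\bm y)^{H-qB}\Big]M(d\bm y)$$ exists.
   Context: Notation: for a square complex matrix $A$, $\varpi_A$ and $\Upsilon_A$ denote the minimum and maximum of the real parts of the eigenvalues of $A$; $A^*$ is the conjugate transpose; for $c>0$, $c^A:=\exp((\log c)A)=\sum_{k\ge0}((\log c)A)^k/k!$. Let $E\in\mathcal M(d,\mathbb{R})$ have all eigenvalues with positive real part and put $q:=\mathrm{tr}(E)>0$. A function $\varphi:\mathbb{R}^d\to[0,\infty)$ is called $E$-homogeneous if $\varphi(c^E\bm x)=c\,\varphi(\bm x)$ for all $\bm x\neq 0$, $c>0$; here $\varphi$ is continuous, $E$-homogeneous, and $\varphi(\bm x)>0$ for $\bm x\ne0$. Let $H\in\mathcal M(n,\mathbb{R})$ with $\varpi_H>0$. Let $\mu$ be a full (support not contained in any affine hyperplane) strictly operator-stable probability measure on $\mathbb{R}^n$ with exponent $B\in\mathcal M(n,\mathbb{R})$, i.e. $\mu$ is infinitely divisible and its characteristic function satisfies $\hat\mu(\mathbf u)^s=\hat\mu(s^B\mathbf u)$ for all $s>0$, $\mathbf u\in\mathbb{R}^n$; let $\hat\psi$ be its log-characteristic function (the unique continuous function with $\hat\psi(0)=0$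 and $\hat\mu=e^{\hat\psi}$). Let $M(d\bm y)$ be the $\mathbb{R}^n$-valued independently scattered random measure on $\mathbb{R}^d$ generated by $\mu$ and Lebesgue measure: for Borel $A$ of finite Lebesgue measure, $M(A)$ is infinitely divisible with Lévy triplet equal to $\mathrm{Leb}(A)$ times the triplet of $\mu$, values on disjoint sets are independent, and $M$ is a.s. $\sigma$-additive. For measurable $f:\mathbb{R}^d\to\mathcal M(n,\mathbb{R})$, the stochastic integral $\int f\,dM$ (in the sense of Kremer–Scheffler, i.e. as the limit of integrals of simple functions) exists iff this construction converges, and then $\mathbb{E}\exp\{i\mathbf u^t\int f\,dM\}=\exp\{\int_{\mathbb{R}^d}\hat\psi(f(\bm x)^*\mathbf u)\,d\bm x\}$. *)

(* Defs.v *)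
From HB Require Import structures.
From mathcomp Require Import all_boot all_order all_algebra.
From mathcomp Require Import all_classical all_reals all_analysis.
From mathcomp.real_closed Require Import complex.
Set Implicit Arguments.
Unset Strict Implicit.
Unset Printing Implicit Defensive.
Import Order.TTheory GRing.Theory Num.Theory.
Import numFieldNormedType.Exports.
Local Open Scope classical_set_scope.
Local Open Scope ring_scope.

Notation Rvec R k := (g_sigma_algebraType (@open (matrix R k 1))).

Section Defs.
Variable R : realType.

Definition mxexp n (A : 'M[R]_n) : 'M[R]_n :=
  \matrix_(i, j) limn (series (fun k : nat => (k`!%:R)^-1 * (A ^+ k) i j)).

Definition mxpow n (c : R) (A : 'M[R]_n) : 'M[R]_n := mxexp (ln c *: A).

Definition eig_re n (A : 'M[R]_n) : set R :=
  [set complex.Re z | z in [set z : R[i] |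
     eigenvalue (map_mx (fun x : R => (x%:C)%C) A) z]].

Definition varpi n (A : 'M[R]_n) : R := inf (eig_re A).
Definition Upsilon n (A : 'M[R]_n) : R := sup (eig_re A).

Definition E_homogeneous d (E : 'M[R]_d) (phi : 'cV[R]_d -> R) :=
  forall x : 'cV[R]_d, x != 0 -> forall c : R, 0 < c ->
    phi (mxpow c E *m x) = c * phi x.

Definition dotv k (u x : 'cV[R]_k) : R := \sum_(i < k) u i 0 * x i 0.
Definition enorm k (x : 'cV[R]_k) : R := Num.sqrt (dotv x x).

Definition cexp (z : R[i]) : R[i] :=
  ((expR (complex.Re z) * cos (complex.Im z)) +i* (expR (complex.Re z) * sin (complex.Im z)))%C.

Definition charfun k (mu : {measure set (Rvec R k) -> \bar R}) (u : 'cV[R]_k)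
  : R[i] :=
  ((Rintegral mu setT (fun x : Rvec R k => cos (dotv u x)))
   +i* (Rintegral mu setT (fun x : Rvec R k => sin (dotv u x))))%C.

Definition charfun_rv dT (T : measurableType dT) (P : probability T R) k
  (X : T -> 'cV[R]_k) (u : 'cV[R]_k) : R[i] :=
  ((Rintegral P setT (fun w => cos (dotv u (X w))))
   +i* (Rintegral P setT (fun w => sin (dotv u (X w)))))%C.

(* the law with characteristic function phi is infinitely divisible:
   it has an m-th convolution root for every m >= 1 *)
Definition inf_div_cf k (phi : 'cV[R]_k -> R[i]) :=
  forall m : nat, (0 < m)%N ->
    exists nu : probability (Rvec R k) R, forall u, charfun nu u ^+ m = phi u.

Definition levy_measure k (nu : {measure set (Rvec R k) -> \bar R}) :=
  nu [set (0 : 'cV[R]_k)] = 0%E /\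
  (\int[nu]_x (Num.min 1 (dotv (x : 'cV[R]_k) x))%:E < +oo)%E.

(* Levy-Khintchine exponent of the triplet (a, Q, nu):
   i<a,u> - <u,Qu>/2 + int (e^{i<u,x>} - 1 - i<u,x> 1_{|x|<=1}) nu(dx) *)
Definition lk_exponent k (a : 'cV[R]_k) (Q : 'M[R]_k)
  (nu : {measure set (Rvec R k) -> \bar R}) (u : 'cV[R]_k) : R[i] :=
  ((- (dotv u (Q *m u)) / 2
      + Rintegral nu setT (fun x : Rvec R k => cos (dotv u x) - 1))
   +i* (dotv a u
      + Rintegral nu setT (fun x : Rvec R k =>
           sin (dotv u x) - dotv u x * ((enorm (x : 'cV[R]_k) <= 1)%R)%:R)))%C.

Definition has_levy_triplet k (phi : 'cV[R]_k -> R[i]) (a : 'cV[R]_k)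
  (Q : 'M[R]_k) (nu : {measure set (Rvec R k) -> \bar R}) :=
  [/\ levy_measure nu, Q^T = Q, (forall u, 0 <= dotv u (Q *m u)) &
      forall u, phi u = cexp (lk_exponent a Q nu u)].

Definition is_log_charfun k (mu : probability (Rvec R k) R)
  (psi : 'cV[R]_k -> R[i]) :=
  [/\ continuous (fun u => complex.Re (psi u)), continuous (fun u => complex.Im (psi u)),
      psi 0 = 0 & forall u, charfun mu u = cexp (psi u)].

(* strictly operator-stable with exponent B:
   infinitely divisible and  mu^(u)^s = mu^(s^B u)  for s > 0,
   where mu^(u)^s := exp(s psi(u)) *)
Definition strictly_operator_stable k (mu : probability (Rvec R k) R)
  (B : 'M[R]_k) :=
  inf_div_cf (charfun mu) /\
  exists psi, is_log_charfun mu psi /\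
    forall s : R, 0 < s -> forall u : 'cV[R]_k,
      cexp ((s%:C)%C * psi u) = charfun mu (mxpow s B *m u).

Definition msupport k (mu : {measure set (Rvec R k) -> \bar R})
  : set 'cV[R]_k :=
  [set x | forall U : set 'cV[R]_k, open U -> U x -> (0 < mu U)%E].

Definition full k (mu : {measure set (Rvec R k) -> \bar R}) :=
  forall (w : 'cV[R]_k) (c : R), w != 0 ->
    ~ (msupport mu `<=` [set x | dotv w x = c]).

Definition box d (a b : 'cV[R]_d) : set 'cV[R]_d :=
  [set x | forall i, a i 0 <= x i 0 < b i 0].

(* leb is Lebesgue measure on the Borel sets of R^d (it is the unique measure
   giving boxes their volume) *)
Definition is_lebesgue d (leb : {measure set (Rvec R d) -> \bar R}) :=
  forall a b : 'cV[R]_d, (forall i, a i 0 <= b i 0) ->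
    leb (box a b) = (\prod_(i < d) (b i 0 - a i 0))%:E.

Definition fin_borel d (leb : {measure set (Rvec R d) -> \bar R})
  (A : set (Rvec R d)) := measurable A /\ (leb A < +oo)%E.

Definition indep_rvecs dT (T : measurableType dT) (P : probability T R) k m
  (X : 'I_m -> T -> 'cV[R]_k) :=
  forall Bs : 'I_m -> set (Rvec R k), (forall i, measurable (Bs i)) ->
    P (\bigcap_(i in [set: 'I_m]) (X i @^-1` Bs i))
    = (\prod_(i < m) P (X i @^-1` Bs i))%E.

Definition random_measure_gen d k dT (T : measurableType dT)
  (P : probability T R) (leb : {measure set (Rvec R d) -> \bar R})
  (mu : probability (Rvec R k) R) (M : set (Rvec R d) -> T -> 'cV[R]_k) :=
  [/\ (exists a Q nu, has_levy_triplet (charfun mu) a Q nu /\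
        forall A, fin_borel leb A ->
        [/\ measurable_fun setT (M A : T -> Rvec R k),
            inf_div_cf (charfun_rv P (M A)) &
            exists nuA : {measure set (Rvec R k) -> \bar R},
              (forall S, nuA S = ((fine (leb A))%:E * nu S)%E) /\
              has_levy_triplet (charfun_rv P (M A))
                (fine (leb A) *: a) (fine (leb A) *: Q) nuA]),
      (forall m (As : 'I_m -> set (Rvec R d)),
         (forall i, fin_borel leb (As i)) ->
         (forall i j, i != j -> As i `&` As j = set0) ->
         indep_rvecs P (fun i => M (As i))) &
      (forall As : nat -> set (Rvec R d),
         (forall i, fin_borel leb (As i)) -> trivIset setT As ->
         fin_borel leb (\bigcup_i As i) ->
         {ae P, forall w, series (fun i => M (As i) w) @ \oo
                          --> M (\bigcup_i As i) w})].

Definition simple_fun d k m (As : 'I_m -> set (Rvec R d))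
  (Qs : 'I_m -> 'M[R]_k) (x : 'cV[R]_d) : 'M[R]_k :=
  \sum_(i < m) (if `[< As i x >] then Qs i else 0).

Definition simple_int d k dT (T : measurableType dT)
  (M : set (Rvec R d) -> T -> 'cV[R]_k) m (As : 'I_m -> set (Rvec R d))
  (Qs : 'I_m -> 'M[R]_k) (B : set (Rvec R d)) (w : T) : 'cV[R]_k :=
  \sum_(i < m) Qs i *m M (B `&` As i) w.

Definition KS_integrable d k dT (T : measurableType dT) (P : probability T R)
  (leb : {measure set (Rvec R d) -> \bar R})
  (M : set (Rvec R d) -> T -> 'cV[R]_k) (f : 'cV[R]_d -> 'M[R]_k) :=
  exists (ms : nat -> nat) (As : forall j, 'I_(ms j) -> set (Rvec R d))
         (Qs : forall j, 'I_(ms j) -> 'M[R]_k),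
    [/\ (forall j i, fin_borel leb (As j i)),
        (forall j i i', i != i' -> As j i `&` As j i' = set0),
        {ae leb, forall x, simple_fun (As j) (Qs j) x @[j --> \oo] --> f x} &
        forall B : set (Rvec R d), measurable B ->
          exists Y : T -> 'cV[R]_k, measurable_fun setT (Y : T -> Rvec R k) /\
            forall eps : R, 0 < eps ->
              P [set w | eps < `| simple_int M (As j) (Qs j) B w - Y w |]
                @[j --> \oo] --> 0%E].

End Defs.

(* Main.v *)
Require Import Defs.
From HB Require Import structures.
From mathcomp Require Import all_boot all_order all_algebra.
From mathcomp Require Import all_classical all_reals all_analysis.
From mathcomp.real_closed Require Import complex.
From mathcomp Require Import measurable_realfun ring lra.
Import Order.TTheory GRing.Theory Num.Theory.
Import numFieldNormedType.Exports.
Local Open Scope classical_set_scope.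
Local Open Scope ring_scope.
Set Implicit Arguments.
Unset Strict Implicit.
Unset Printing Implicit Defensive.

(* The exponent [psi] of [mu] satisfies [psi (s^B u) = s psi u], and fullness forces the
   eigenvalues of [B] to have positive real part; hence [|psi u| <= G |u|] with
   [G r = L (r^p + r^(1/r1))] for every [r1 < varpi B]. Cutting a simple function [F] along the
   atoms of its sets shows that [log E exp (i <u, int F dM>) = int psi (F^T u)], so the truncation
   inequality for characteristic functions bounds [P (|int_B F dM| > eps)] by a multiple of
   [int G (c |F|)] with [c] of order [1/eps], uniformly in [B]. If [int G (c |f|)] is finite for
   every [c], dominated convergence along dyadic truncations of [f] yields simple functions whose
   integrals converge in probability at a geometric rate.

   For the kernel, [|phi^A| <= K phi^al] near the origin whenever [al < varpi A], with exponential
   decay at infinity. Since [c^E] multiplies Lebesgue measure by [c^q], integrating over the shells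
   [e^k <= phi < e^(k+1)] gives geometric series, which converge as soon as [al / r1 > - q]; such
   [al] and [r1] exist precisely because [varpi A + q varpi B > 0]. *)

(** * The matrix exponential *)

(** The notion of integral asks for one sequence of simple functions whose integrals over every
    measurable set [B] converge in probability. Hence the probability bound is made to depend only
    on a quantity that decreases when [F] is restricted to [B], and the convergence is made
    geometric, so that the limit can be taken pathwise and is measurable. [G] has two powers because
    the flow of [B] contracts and expands at different rates: [1/r1], with [r1] just below
    [varpi B], controls large [u] and thus the singularity of the kernel at the origin; [p = 1/r2],
    with [r2] above the spectrum, controls small [u]. Only [r1] has to be sharp, since the
    exponential factor beats every power at infinity; for the same reason the two terms of the
    kernel are integrable separately and their difference is simply bounded by their sum. Growth
    bounds for [exp (tA)] rest on the factored characteristic polynomial: real and imaginary parts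
    of its partial products at [A], suitably weighted, form a Lyapunov function. This takes the
    place of a Jordan form. *)

Lemma cvg_sum_ord (R : realType) T (F : set_system T) {FF : Filter F} n (f : 'I_n -> T -> R) (l : 'I_n -> R) :
  (forall i, f i x @[x --> F] --> l i) ->
  (\sum_(i < n) f i x) @[x --> F] --> \sum_(i < n) l i.
Proof.
move=> fl; apply: (@cvg_big R 'I_n +%R 0 predT (@add_continuous R) _ F _ f l) => //.
Qed.

Lemma mx_entry_le (R : realType) m n (M : 'M[R]_(m, n)) i j : `|M i j| <= `|M|.
Proof. by rewrite [leRHS]mx_normrE; exact: (le_bigmax _ _ (i, j)). Qed.

Lemma mx_norm_le (R : realType) m n (M : 'M[R]_(m, n)) c :
  0 <= c -> (forall i j, `|M i j| <= c) -> `|M| <= c.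
Proof.
by move=> c0 Mc; rewrite [leLHS]mx_normrE; apply/bigmax_leP; split=> // -[].
Qed.

(** The norm of a matrix is its largest absolute entry, which is submultiplicative only up to the
    inner dimension. This is the source of the factors [n%:R] and [d%:R] throughout. *)
Lemma mulmx_norm (R : realType) m n p (A : 'M[R]_(m, n)) (B : 'M[R]_(n, p)) :
  `|A *m B| <= n%:R * `|A| * `|B|.
Proof.
apply: mx_norm_le => [|i j]; first by rewrite !mulr_ge0.
rewrite mxE (le_trans (ler_norm_sum _ _ _))//.
rewrite -mulrA mulr_natl -[leRHS](_ : \sum_(k < n) `|A| * `|B| = _); last first.
  by rewrite sumr_const card_ord.
by apply: ler_sum => k _; rewrite normrM ler_pM// mx_entry_le.
Qed.

Section mxexp.
Variables (R : realType) (n : nat).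
Implicit Types (A C : 'M[R]_n) (t : R).

Lemma expmxZ t A k : (t *: A) ^+ k = t ^+ k *: A ^+ k.
Proof.
elim: k => [|k IH]; first by rewrite !expr0 scale1r.
by rewrite !exprS IH /GRing.mul /= -scalemxAl -scalemxAr scalerA.
Qed.

Lemma expmx_norm C A k i j : `|(C *m A ^+ k) i j| <= n%:R * `|C| * (n%:R * `|A|) ^+ k.
Proof.
elim: k C i j => [|k IH] C i j.
  rewrite expr0 mulmx1 mulr1; apply: le_trans (mx_entry_le _ _ _) _.
  case: n C i {A j} => [|n'] C i; first by case: i.
  by rewrite ler_peMl// ler1n.
rewrite exprS mulmxA (le_trans (IH _ _ _))// [in leRHS]exprS.
rewrite mulrA ler_wpM2r// ?exprn_ge0 ?mulr_ge0// -mulrA ler_wpM2l//.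
by rewrite (le_trans (mulmx_norm _ _))//= [in leRHS]mulrC -!mulrA ler_wpM2l// mulrC.
Qed.

(** Coefficients of the power series in [t] of the entry [(i, j)] of [C exp (tA)]. The left factor
    [C] makes the family stable under termwise differentiation, which turns [C] into [C A]. *)
Definition ecoef C A i j k : R := (k`!%:R)^-1 * (C *m A ^+ k) i j.

Lemma is_cvg_ecoef C A i j t : cvgn (pseries (ecoef C A i j) t).
Proof.
apply: normed_cvg => /=.
apply: (@series_le_cvg _ _
  (fun k => n%:R * `|C| * exp_coeff (n%:R * `|A| * `|t|) k)) => //= [k|k|].
- by rewrite /exp_coeff/= !mulr_ge0// exprn_ge0// !mulr_ge0.
- rewrite /ecoef /exp_coeff /= !normrM normfV normr_nat normrX.
  rewrite -mulrA mulrCA !exprMn -!mulrA [leRHS]mulrCA.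
  have := expmx_norm C A k i j => /(ler_wpM2r (exprn_ge0 k (normr_ge0 t))).
  have k0 : 0 <= (k`!%:R : R)^-1 by rewrite invr_ge0.
  move=> /(ler_wpM2l k0); rewrite !exprMn => h; apply: le_trans (le_trans _ h) _; last first.
    by rewrite le_eqVlt; apply/orP; left; apply/eqP; ring.
  by rewrite le_eqVlt; apply/orP; left; apply/eqP; ring.
- rewrite (_ : (fun _ => _) = (n%:R * `|C|) *: exp_coeff (n%:R * `|A| * `|t|)) //.
  by apply: is_cvg_seriesZ; exact: is_cvg_series_exp_coeff.
Qed.

Lemma ecoef_diffs C A i j :
  pseries_diffs (ecoef C A i j) = ecoef (C *m A) A i j.
Proof.
apply/funext => k; rewrite /pseries_diffs /ecoef factS natrM invfM mulrA mulrA.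
by rewrite divff ?pnatr_eq0// mul1r exprS mulmxA.
Qed.

Lemma is_derive_ecoef C A i j t :
  is_derive t (1 : R) (fun s => limn (pseries (ecoef C A i j) s))
    (limn (pseries (ecoef (C *m A) A i j) t)).
Proof.
rewrite -ecoef_diffs; apply: (@pseries_snd_diffs _ _ (`|t| + 1)).
- exact: is_cvg_ecoef.
- by rewrite ecoef_diffs; exact: is_cvg_ecoef.
- by rewrite !ecoef_diffs; exact: is_cvg_ecoef.
- by rewrite [ltRHS]ger0_norm ?addr_ge0// ltrDl.
Qed.

Lemma mxexpZE A t i j : mxexp (t *: A) i j = limn (pseries (ecoef 1%:M A i j) t).
Proof.
rewrite mxE; congr (limn (series _)); apply/funext => k.
by rewrite /= /ecoef expmxZ mul1mx mxE mulrCA mulrC.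
Qed.

Lemma mul_mxexp_lim C A t i j :
  (C *m mxexp (t *: A)) i j = limn (pseries (ecoef C A i j) t).
Proof.
apply/esym/cvg_lim => //; rewrite mxE.
rewrite (_ : pseries _ _ = (fun N => \sum_(l < n) (C i l * pseries (ecoef 1%:M A l j) t N))).
  apply: cvg_sum_ord => l; rewrite mxexpZE.
  by apply: cvgMr; exact: is_cvg_ecoef.
apply/funext => N; rewrite /pseries /series /=.
rewrite (eq_bigr (fun l : 'I_n => \sum_(0 <= k < N) C i l * (ecoef 1%:M A l j k * t ^+ k))).
  rewrite exchange_big /=; apply: eq_bigr => k _.
  rewrite /ecoef mxE mulr_sumr mulr_suml; apply: eq_bigr => l _.
  by rewrite mul1mx; ring.
by move=> l _; rewrite mulr_sumr.
Qed.

Lemma mxexp_mul_lim C A t i j : C *m A = A *m C ->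
  (mxexp (t *: A) *m C) i j = limn (pseries (ecoef C A i j) t).
Proof.
move=> CA; apply/esym/cvg_lim => //; rewrite mxE.
rewrite (_ : pseries _ _ = (fun N => \sum_(l < n) (C l j * pseries (ecoef 1%:M A i l) t N))).
  apply: cvg_sum_ord => l; rewrite mxexpZE mulrC.
  by apply: cvgMr; exact: is_cvg_ecoef.
apply/funext => N; rewrite /pseries /series /=.
rewrite (eq_bigr (fun l : 'I_n => \sum_(0 <= k < N) C l j * (ecoef 1%:M A i l k * t ^+ k))).
  rewrite exchange_big /=; apply: eq_bigr => k _.
  rewrite /ecoef; have -> : C *m A ^+ k = A ^+ k *m C.
    elim: k => [|k IH]; first by rewrite !expr0 mul1mx mulmx1.
    by rewrite !exprS mulmxA CA -[LHS]mulmxA IH mulmxA.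
  rewrite mxE mulr_sumr mulr_suml; apply: eq_bigr => l _.
  by rewrite mul1mx; ring.
by move=> l _; rewrite mulr_sumr.
Qed.

Lemma mxexp_comm C A t : C *m A = A *m C ->
  C *m mxexp (t *: A) = mxexp (t *: A) *m C.
Proof. by move=> CA; apply/matrixP => i j; rewrite mxexp_mul_lim// mul_mxexp_lim. Qed.

Lemma is_derive_mxexp A t i j :
  is_derive t (1 : R) (fun s => mxexp (s *: A) i j) ((A *m mxexp (t *: A)) i j).
Proof.
rewrite (_ : (fun _ => _) = (fun s => limn (pseries (ecoef 1%:M A i j) s))).
  by rewrite mul_mxexp_lim; have := is_derive_ecoef 1%:M A i j t; rewrite mul1mx.
by apply/funext => s; rewrite mxexpZE.
Qed.

End mxexp.

Lemma is_derive_sum_ord (R : realType) n (h : 'I_n -> R -> R) (x : R) (dh : 'I_n -> R) :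
  (forall i, is_derive x (1 : R) (h i) (dh i)) ->
  is_derive x (1 : R) (fun s => \sum_(i < n) h i s) (\sum_(i < n) dh i).
Proof. by move=> H; have := is_derive_sum H; rewrite fct_sumE. Qed.

Lemma is_derive_mulfun (R : realType) (f g : R -> R) (x df dg : R) :
  is_derive x (1 : R) f df -> is_derive x (1 : R) g dg ->
  is_derive x (1 : R) (fun s => f s * g s) (df * g x + f x * dg).
Proof.
move=> hf hg; have h := is_deriveM hf hg; apply: is_derive_eq.
by rewrite /GRing.scale /= addrC mulrC.
Qed.

Lemma is_derive_mulmx (R : realType) m n p (A : R -> 'M[R]_(m, n)) (B : R -> 'M[R]_(n, p))
  (dA : 'M[R]_(m, n)) (dB : 'M[R]_(n, p)) (t : R) :
  (forall i j, is_derive t (1 : R) (fun s => A s i j) (dA i j)) ->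
  (forall i j, is_derive t (1 : R) (fun s => B s i j) (dB i j)) ->
  forall i j, is_derive t (1 : R) (fun s => (A s *m B s) i j)
    ((dA *m B t + A t *m dB) i j).
Proof.
move=> hA hB i j.
rewrite (_ : (fun s => _) = (fun s => \sum_(k < n) A s i k * B s k j)); last first.
  by apply/funext => s; rewrite mxE.
rewrite [X in is_derive _ _ _ X]mxE [X in X + _]mxE [X in _ + X]mxE -big_split /=.
by apply: is_derive_sum_ord => k; exact: is_derive_mulfun.
Qed.

Section mxexp_group.
Variables (R : realType) (n : nat).
Implicit Types (A C : 'M[R]_n) (t s : R).

Lemma mxexp0 : mxexp (0 : 'M[R]_n) = 1%:M.
Proof.
rewrite -(scale0r (0 : 'M[R]_n)); apply/matrixP => i j; rewrite mxexpZE.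
rewrite (_ : 1%:M i j = ecoef 1%:M (0 : 'M[R]_n) i j 0); last first.
  by rewrite /ecoef fact0 invr1 mul1r expr0 mulmx1.
apply: lim_near_cst => //; near=> N.
rewrite /pseries /series /= big_ltn; last by near: N; exact: nbhs_infty_gt.
rewrite expr0 mulr1 big_nat_cond big1 ?addr0// => k /andP[/andP[k0 _] _].
by rewrite expr0n eqn0Ngt k0 mulr0.
Unshelve. all: by end_near. Qed.

(** The product has derivative [0] in [t], because [A] commutes with its exponential, and it equals
    [1] at [t = 0]. *)
Lemma mxexpN_mul A t : mxexp (- t *: A) *m mxexp (t *: A) = 1%:M.
Proof.
apply/matrixP => i j.
have -> : (mxexp (- t *: A) *m mxexp (t *: A)) i j =
          (mxexp (t *: - A) *m mxexp (t *: A)) i j by rewrite scalerN scaleNr.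
rewrite -(_ : (fun u => (mxexp (u *: - A) *m mxexp (u *: A)) i j) 0 = 1%:M i j); last first.
  by rewrite !scale0r mxexp0 mulmx1.
apply: (@is_derive_0_is_cst _ (fun u => (mxexp (u *: - A) *m mxexp (u *: A)) i j)) => u.
apply: is_derive_eq.
  by apply: is_derive_mulmx => k l; exact: is_derive_mxexp.
have -> : - A *m mxexp (u *: - A) = mxexp (u *: - A) *m (- A) by apply: mxexp_comm.
by rewrite -mulmxA mulNmx mulmxN addNr mxE.
Qed.

Lemma is_derive_mxexp_shift A s t i j :
  is_derive t (1 : R) (fun u => mxexp ((u + s) *: A) i j)
    ((A *m mxexp ((t + s) *: A)) i j).
Proof.
have h1 := is_derive_mxexp A (t + s) i j.
have h2 : is_derive t (1 : R) (fun u : R => u + s) 1.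
  by apply: is_derive_eq; rewrite addr0.
by have := is_derive1_comp (g := fun u : R => u + s) h1 h2; rewrite mulr1.
Qed.

(** The function [exp (-uA) exp ((u + s)A)] of [u] has derivative [0], so it keeps its value
    [exp (sA)] at [u = 0]. *)
Lemma mxexpD A s t : mxexp ((t + s) *: A) = mxexp (t *: A) *m mxexp (s *: A).
Proof.
have key : mxexp (- t *: A) *m mxexp ((t + s) *: A) = mxexp (s *: A).
  apply/matrixP => i j.
  have -> : (mxexp (- t *: A) *m mxexp ((t + s) *: A)) i j =
            (mxexp (t *: - A) *m mxexp ((t + s) *: A)) i j by rewrite scalerN scaleNr.
  rewrite -[RHS](_ : (fun u => (mxexp (u *: - A) *m mxexp ((u + s) *: A)) i j) 0 = _); last first.
    by rewrite scale0r mxexp0 mul1mx add0r.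
  apply: (@is_derive_0_is_cst _ (fun u => (mxexp (u *: - A) *m mxexp ((u + s) *: A)) i j)) => u.
  apply: is_derive_eq.
    apply: is_derive_mulmx => k l; first exact: is_derive_mxexp.
    exact: is_derive_mxexp_shift.
  have -> : - A *m mxexp (u *: - A) = mxexp (u *: - A) *m (- A) by apply: mxexp_comm.
  by rewrite -mulmxA mulNmx mulmxN addNr mxE.
have := mxexpN_mul A (- t); rewrite opprK => e.
by rewrite -key mulmxA e mul1mx.
Qed.

Lemma mxexp_mulN A t : mxexp (t *: A) *m mxexp (- t *: A) = 1%:M.
Proof. by rewrite -mxexpD subrr scale0r mxexp0. Qed.

Lemma mxexp_unit A t : mxexp (t *: A) \in unitmx.
Proof. by have [] := mulmx1_unit (mxexp_mulN A t). Qed.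

Lemma is_derive_mxexp_mul C A m (x : 'M[R]_(n, m)) t i j :
  is_derive t (1 : R) (fun s => (C *m (mxexp (s *: A) *m x)) i j)
    ((C *m A *m (mxexp (t *: A) *m x)) i j).
Proof.
have cst p q (D : 'M[R]_(p, q)) k l : is_derive t (1 : R) (fun=> D k l) ((0 : 'M[R]_(p, q)) k l).
  by rewrite mxE; exact: is_derive_cst.
apply: is_derive_eq.
  apply: (is_derive_mulmx (dA := 0) (dB := A *m mxexp (t *: A) *m x)) => //.
  move=> k l; apply: is_derive_eq.
    by apply: is_derive_mulmx => // p q; exact: is_derive_mxexp.
  by rewrite mulmx0 addr0.
by rewrite mul0mx add0r !mulmxA.
Qed.

End mxexp_group.

(** [N t] times [exp (-r t)] has a non-positive derivative. *)
Lemma gronwall (R : realType) (N dN : R -> R) (r : R) :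
  (forall t, is_derive t (1 : R) N (dN t)) -> (forall t, dN t <= r * N t) ->
  forall t, 0 <= t -> N t <= expR (r * t) * N 0.
Proof.
move=> hN hle t t0.
pose g s := N s * expR (- r * s).
have hg s : is_derive s (1 : R) g (dN s * expR (- r * s) + N s * (- r * expR (- r * s))).
  apply: is_derive_mulfun => //.
  have h2 : is_derive s (1 : R) (fun u : R => - r * u) (- r).
    by apply: is_derive_eq; rewrite /GRing.scale /= mulr1.
  by have := is_derive1_comp (is_derive_expR (- r * s)) h2; rewrite mulrC.
have gle : g t <= g 0.
  apply: (@ler0_derive1_le_cc _ g 0 t) => //.
  - move=> x _; rewrite derive1E derive_val.
    rewrite mulrA -mulrDl pmulr_lle0 ?expR_gt0//.
    by rewrite mulrN mulrC subr_le0 mulrC [N x * r]mulrC.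
  - apply: continuous_subspaceT => x; apply: differentiable_continuous.
    by apply/derivable1_diffP; have [] := hg x.
  - by rewrite in_itv/= lexx t0.
  - by rewrite in_itv/= t0 lexx.
move: gle; rewrite /g mulr0 expR0 mulr1 mulNr expRN.
by rewrite ler_pdivrMr ?expR_gt0// mulrC.
Qed.

(** * Growth of matrix exponentials from the eigenvalues *)

Section lyapunov.
Variables (R : realType) (n m : nat) (A : 'M[R]_n) (P Q : nat -> 'M[R]_n)
  (a b : nat -> R) (r : R).
Hypothesis P0 : P 0%N = 1%:M.
Hypothesis Q0 : Q 0%N = 0.
Hypothesis Pm : P m.+1 = 0.
Hypothesis Qm : Q m.+1 = 0.
Hypothesis PA : forall k, (k <= m)%N -> P k *m A = a k *: P k - b k *: Q k + P k.+1.
Hypothesis QA : forall k, (k <= m)%N -> Q k *m A = a k *: Q k + b k *: P k + Q k.+1.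
Hypothesis ar : forall k, (k <= m)%N -> a k < r.

Let exists_gap : exists2 e : R, 0 < e & forall k, (k <= m)%N -> a k + 2 * e <= r.
Proof.
elim: m ar => [|m' IH] h.
  exists ((r - a 0) / 2); first by rewrite divr_gt0// subr_gt0 h.
  by move=> k; rewrite leqn0 => /eqP ->; lra.
have [e e0 he] := IH (fun k km => h k (leqW km)).
have h' := h _ (leqnn _).
exists (Num.min e ((r - a m'.+1) / 2)).
  by rewrite lt_min e0 divr_gt0// subr_gt0.
move=> k; rewrite leq_eqVlt => /orP[/eqP ->|km].
  have : Num.min e ((r - a m'.+1) / 2) <= (r - a m'.+1) / 2 by rewrite ge_min lexx orbT.
  lra.
have := he _ km; have : Num.min e ((r - a m'.+1) / 2) <= e by rewrite ge_min lexx.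
lra.
Qed.

(** With [Z k = P k + i Q k] and [z k = a k + i b k], the hypotheses say [Z k (A - z k) = Z k.+1].
    [W k y] is the squared Euclidean norm of [Z k y], and [dW k y] its derivative along the flow
    [y' = A y]. *)
Let W k (y : 'cV[R]_n) : R := \sum_(i < n) ((P k *m y) i 0 ^+ 2 + (Q k *m y) i 0 ^+ 2).

Let dW k (y : 'cV[R]_n) : R := \sum_(i < n)
  (2 * ((P k *m y) i 0 * (P k *m A *m y) i 0 + (Q k *m y) i 0 * (Q k *m A *m y) i 0)).

Let W_ge0 k y : 0 <= W k y.
Proof. by apply: sumr_ge0 => i _; rewrite addr_ge0// sqr_ge0. Qed.

(** The terms in [b k] are a rotation and cancel. The coupling with level [k.+1] is split by Young's
    inequality, [2 p p' <= 2 e p^2 + p'^2 / (2 e)]. *)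
Let dW_le k e y : 0 < e -> (k <= m)%N ->
  dW k y <= (2 * a k + 2 * e) * W k y + (2 * e)^-1 * W k.+1 y.
Proof.
move=> e0 km; rewrite /dW /W !mulr_sumr -big_split /=; apply: ler_sum => i _.
rewrite PA// QA// !mulmxDl mulNmx -!scalemxAl !mxE.
move: (\sum_j P k i j * y j 0) (\sum_j Q k i j * y j 0)
  (\sum_j P k.+1 i j * y j 0) (\sum_j Q k.+1 i j * y j 0) => p q p' q'.
have -> : (2 * e)^-1 * (p' ^+ 2 + q' ^+ 2) =
   2 * e * ((p' / (2 * e)) ^+ 2 + (q' / (2 * e)) ^+ 2).
  by field; rewrite gt_eqF.
have h1 : p' = 2 * e * (p' / (2 * e)) by field; rewrite gt_eqF.
have h2 : q' = 2 * e * (q' / (2 * e)) by field; rewrite gt_eqF.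
move: (p' / (2 * e)) (q' / (2 * e)) h1 h2 => p1 q1 -> ->.
rewrite -subr_ge0.
rewrite (_ : _ - _ = 2 * e * ((p - p1) ^+ 2 + (q - q1) ^+ 2)); last by ring.
by rewrite mulr_ge0 ?mulr_ge0 ?addr_ge0 ?sqr_ge0// ltW.
Qed.

(** The weighted sum [N] of the [W k] is a Lyapunov function: its growth rate along the flow is at
    most [2 r], it dominates the squared norm through level [0], where [Z 0 = 1], and it is
    dominated by a multiple of it. *)
Lemma mxexp_chain_bound : exists2 K : R, 0 <= K &
  forall t, 0 <= t -> forall x : 'cV[R]_n,
    `|mxexp (t *: A) *m x| <= K * expR (r * t) * `|x|.
Proof.
have [e e0 he] := exists_gap.
(* With this [q], [q^k / (2 e) = 2 e q^(k+1)]: the Young remainder of level [k] costs only [2 e]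
   times the term of level [k.+1]. The rate at each level is then [2 (a k + 2 e)], which is why the
   gap is taken to be [2 e]. *)
pose q := (4 * e ^+ 2)^-1.
have q0 : 0 < q by rewrite invr_gt0 mulr_gt0// exprn_gt0.
have qk k : 0 <= q ^+ k by rewrite exprn_ge0// ltW.
pose N (y : 'cV[R]_n) := \sum_(k < m.+1) q ^+ k * W k y.
pose C2 := \sum_(k < m.+1) q ^+ k * \sum_(i < n)
   ((n%:R * `|P k|) ^+ 2 + (n%:R * `|Q k|) ^+ 2).
have C20 : 0 <= C2.
  apply: sumr_ge0 => k _; apply: mulr_ge0 => //.
  apply: sumr_ge0 => i _.
  by rewrite addr_ge0// sqr_ge0.
have NC y : N y <= C2 * `|y| ^+ 2.
  rewrite /N /C2 mulr_suml; apply: ler_sum => k _.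
  rewrite -mulrA; apply: ler_wpM2l => //; rewrite mulr_suml; apply: ler_sum => i _.
  rewrite mulrDl -!exprMn.
  have sq (z w : R) : `|z| <= w -> z ^+ 2 <= w ^+ 2.
    by move=> zw; rewrite -(real_normK (num_real z)) ler_sqr// nnegrE (le_trans _ zw).
  by apply: lerD; apply: sq; apply: le_trans (mx_entry_le _ _ _) (mulmx_norm _ _).
have Nge y : `|y| ^+ 2 <= N y.
  have : W 0%N y <= N y.
    by rewrite /N big_ord_recl expr0 mul1r lerDl sumr_ge0// => k _;
      rewrite mulr_ge0.
  apply: le_trans.
  have -> : W 0%N y = \sum_(i < n) y i 0 ^+ 2.
    by apply: eq_bigr => i _; rewrite P0 Q0 mul1mx mul0mx [in X in _ + X]mxE expr0n addr0.
  have S0 : 0 <= \sum_(i < n) y i 0 ^+ 2 by apply: sumr_ge0 => i _; exact: sqr_ge0.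
  rewrite -[leRHS]sqr_sqrtr// ler_sqr ?nnegrE ?sqrtr_ge0//.
  apply: mx_norm_le; first exact: sqrtr_ge0.
  move=> i j; rewrite ord1 -sqrtr_sqr ler_sqrt// (bigD1 i)//= lerDl sumr_ge0// => l _.
  exact: sqr_ge0.
exists (Num.sqrt C2); first exact: sqrtr_ge0.
move=> t t0 x.
pose y s := mxexp (s *: A) *m x.
have dN s : is_derive s (1 : R) (fun s => N (y s)) (\sum_(k < m.+1) q ^+ k * dW k (y s)).
  apply: is_derive_sum_ord => k; apply: is_derive_eq.
    apply: (is_derive_mulfun (is_derive_cst (q ^+ k) s 1)).
    apply: is_derive_sum_ord => i.
    have sqd (f : R -> R) df : is_derive s (1 : R) f df ->
        is_derive s (1 : R) (fun u => f u ^+ 2) (2 * (f s * df)).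
      move=> h; rewrite (_ : 2 * _ = df * f s + f s * df); last by ring.
      exact: (is_derive_mulfun h h).
    apply: is_derive_eq.
      by apply: is_deriveD; apply: sqd; exact: is_derive_mxexp_mul.
    by rewrite -mulrDr.
  by rewrite mul0r add0r.
have key s : \sum_(k < m.+1) q ^+ k * dW k (y s) <= (2 * r) * N (y s).
  apply: (@le_trans _ _ (\sum_(k < m.+1) q ^+ k * (2 * a k + 2 * e) * W k (y s)
     + \sum_(k < m.+1) 2 * e * (q ^+ k.+1 * W k.+1 (y s)))).
    rewrite -big_split /=; apply: ler_sum => k _.
    have km : (k <= m)%N by rewrite -ltnS.
    apply: le_trans (ler_wpM2l (qk k) (dW_le (y s) e0 km)) _.
    rewrite mulrDr mulrA lerD2l le_eqVlt; apply/orP; left; apply/eqP.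
    rewrite exprS /q; field.
    by rewrite gt_eqF.
  have -> : \sum_(k < m.+1) 2 * e * (q ^+ k.+1 * W k.+1 (y s)) =
            2 * e * N (y s) - 2 * e * W 0%N (y s).
    rewrite -mulr_sumr /N big_ord_recr [in RHS]big_ord_recl /=.
    have -> : W m.+1 (y s) = 0.
      by rewrite /W big1// => i _; rewrite Pm Qm mul0mx mxE expr0n addr0.
    by rewrite expr0; ring.
  apply: (@le_trans _ _ (\sum_(k < m.+1) q ^+ k * (2 * a k + 2 * e) * W k (y s)
    + 2 * e * N (y s))).
    by rewrite lerD2l gerBl !mulr_ge0// ltW.
  rewrite /N !mulr_sumr -big_split /=; apply: ler_sum => k _.
  have km : (k <= m)%N by rewrite -ltnS.
  have h : 0 <= r - (a k + 2 * e) by rewrite subr_ge0 he.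
  rewrite -subr_ge0 (_ : _ - _ = 2 * (q ^+ k * W k (y s)) * (r - (a k + 2 * e))); last by ring.
  by rewrite !mulr_ge0.
have := gronwall dN key t0; rewrite {2}/y scale0r mxexp0 mul1mx => h.
have {}h := le_trans (Nge _) (le_trans h (ler_wpM2l (expR_ge0 _) (NC x))).
have x1 : 0 <= expR (r * t) by exact: expR_ge0.
rewrite -(ler_sqr (x := `|_|)) ?nnegrE ?mulr_ge0 ?sqrtr_ge0//.
apply: le_trans h _; rewrite !exprMn sqr_sqrtr//.
rewrite (_ : 2 * r * t = r * t + r * t); last by ring.
by rewrite expRD le_eqVlt; apply/orP; left; apply/eqP; ring.
Qed.

End lyapunov.

Section mxexp_growth.
Variables (R : realType).

Lemma eig_re_opp n (A : 'M[R]_n) e : eig_re (- A) e -> eig_re A (- e).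
Proof.
move=> [z /= /eigenvalueP[v vA v0] <-]; exists (- z); last by case: z {vA}.
apply/eigenvalueP; exists v => //.
rewrite scaleNr -vA map_mxN mulmxN opprK //.
Qed.

(** [P k] and [Q k] are the real and imaginary parts of the product of [A - z] over the first [k]
    complex roots [z] of the characteristic polynomial. The full product vanishes by
    Cayley-Hamilton, so the chain stops. *)
Lemma char_poly_chain n (A : 'M[R]_n.+1) : exists (P Q : nat -> 'M[R]_n.+1) (a b : nat -> R),
 [/\ [/\ P 0%N = 1%:M, Q 0%N = 0, P n.+1 = 0 & Q n.+1 = 0],
   forall k, (k <= n)%N -> P k *m A = a k *: P k - b k *: Q k + P k.+1,
   forall k, (k <= n)%N -> Q k *m A = a k *: Q k + b k *: P k + Q k.+1 &
   forall k, (k <= n)%N -> eig_re A (a k)].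
Proof.
pose Ac : 'M[R[i]]_n.+1 := map_mx (fun x : R => (x%:C)%C) A.
have [rs] := closed_field_poly_normal (char_poly Ac).
rewrite (monicP (char_poly_monic Ac)) scale1r => rsE.
have szrs : size rs = n.+1.
  by have := size_char_poly Ac; rewrite rsE size_prod_XsubC => -[].
pose V k := horner_mx Ac (\prod_(z <- take k rs) ('X - z%:P)).
have V0 : V 0%N = 1%:M by rewrite /V take0 big_nil rmorph1.
have Vn : V n.+1 = 0 by rewrite /V -szrs take_size -rsE Cayley_Hamilton.
have VS k : (k <= n)%N -> V k *m Ac = rs`_k *: V k + V k.+1.
  move=> kn; rewrite /V (take_nth 0) ?szrs// -cats1 big_cat big_seq1 rmorphM rmorphB /=.
  rewrite horner_mx_X horner_mx_C.
  by rewrite mulrBr [X in X - _]/GRing.mul/= -[X in _ - X]/(_ *m _) mul_mx_scalar addrC subrK.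
pose P k := map_mx (@complex.Re R) (V k).
pose Q k := map_mx (@complex.Im R) (V k).
exists P, Q, (fun k => complex.Re rs`_k), (fun k => complex.Im rs`_k).
have ReD (x y : R[i]) : complex.Re (x + y) = complex.Re x + complex.Re y by case: x; case: y.
have ImD (x y : R[i]) : complex.Im (x + y) = complex.Im x + complex.Im y by case: x; case: y.
have ReA k i j : complex.Re ((V k *m Ac) i j) = (P k *m A) i j.
  rewrite !mxE (big_morph (@complex.Re R) ReD (erefl _)); apply: eq_bigr => l _.
  by rewrite !mxE; case: (V k i l) => x y /=; rewrite mulr0 subr0.
have ImA k i j : complex.Im ((V k *m Ac) i j) = (Q k *m A) i j.
  rewrite !mxE (big_morph (@complex.Im R) ImD (erefl _)); apply: eq_bigr => l _.
  by rewrite !mxE; case: (V k i l) => x y /=; rewrite mulr0 add0r.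
split.
- split; apply/matrixP => i j; rewrite ?mxE ?V0 ?Vn ?mxE//; by case: (i == j).
- move=> k kn; apply/matrixP => i j; rewrite -ReA VS// !mxE.
  by case: (V k i j) => x y; case: (V k.+1 i j) => x' y'; case: (rs`_k).
- move=> k kn; apply/matrixP => i j; rewrite -ImA VS// !mxE.
  by case: (V k i j) => x y; case: (V k.+1 i j) => x' y'; case: (rs`_k).
- move=> k kn; exists rs`_k => //=; rewrite eigenvalue_root_char -/Ac rsE.
  by rewrite root_prod_XsubC mem_nth// szrs.
Qed.

Lemma mxexp_bound n (A : 'M[R]_n) r : (0 < n)%N -> (forall e, eig_re A e -> e < r) ->
  exists2 K : R, 0 <= K & forall t, 0 <= t -> forall x : 'cV[R]_n,
    `|mxexp (t *: A) *m x| <= K * expR (r * t) * `|x|.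
Proof.
case: n A => // n A _ Ar.
have [P [Q [a [b [[P0 Q0 Pm Qm] PA QA aE]]]]] := char_poly_chain A.
by apply: (mxexp_chain_bound P0 Q0 Pm Qm PA QA) => k kn; exact/Ar/aE.
Qed.

Lemma mxexp_bound_neg n (A : 'M[R]_n) r : (0 < n)%N -> (forall e, eig_re A e -> r < e) ->
  exists2 K : R, 0 <= K & forall t, t <= 0 -> forall x : 'cV[R]_n,
    `|mxexp (t *: A) *m x| <= K * expR (r * t) * `|x|.
Proof.
move=> n0 rA; have [|K K0 hK] := @mxexp_bound n (- A) (- r) n0.
  by move=> e /eig_re_opp/rA; rewrite ltrNr.
exists K => // t t0 x; have := hK (- t); rewrite oppr_ge0 => /(_ t0 x).
by rewrite scalerN scaleNr opprK mulrNN.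
Qed.

Lemma eig_re_finite n (A : 'M[R]_n) : exists s : seq R, forall e, eig_re A e <-> e \in s.
Proof.
pose Ac : 'M[R[i]]_n := map_mx (fun x : R => (x%:C)%C) A.
have [rs] := closed_field_poly_normal (char_poly Ac).
rewrite (monicP (char_poly_monic Ac)) scale1r => rsE.
exists (map (@complex.Re R) rs) => e; split.
  move=> [z /=]; rewrite eigenvalue_root_char -/Ac rsE root_prod_XsubC => zr <-.
  exact: map_f.
move=> /mapP[z zr ->]; exists z => //=.
by rewrite eigenvalue_root_char -/Ac rsE root_prod_XsubC.
Qed.

(** [varpi] is an infimum, and only finiteness of the spectrum makes it a lower bound of it. *)
Lemma varpi_le n (A : 'M[R]_n) e : eig_re A e -> varpi A <= e.
Proof.
move=> Ae; apply: ge_inf => //; have [s sE] := eig_re_finite A.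
(* Minus the sum of absolute values lies below every element of a finite list. *)
exists (\sum_(x <- s) - `|x|) => y /sE; elim: s {sE} => // x s IH.
rewrite inE big_cons => /orP[/eqP ->|/IH h].
  rewrite -[leRHS]addr0 lerD//; last by apply: sumr_le0 => *; rewrite oppr_le0.
  by rewrite lerNl -normrN ler_norm.
by rewrite -[leRHS]add0r lerD// oppr_le0.
Qed.

Lemma eig_re_nonempty n (A : 'M[R]_n) : (0 < n)%N -> eig_re A !=set0.
Proof.
case: n A => // n A _; have [P [Q [a [b [_ _ _ h]]]]] := char_poly_chain A.
by exists (a 0%N); exact: h.
Qed.

Lemma varpi_gt n (A : 'M[R]_n) r : (0 < n)%N -> (forall e, eig_re A e -> r < e) -> r < varpi A.
Proof.
move=> n0 h; have [e0 Ae0] := eig_re_nonempty A n0.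
have [s sE] := eig_re_finite A.
have [m ms mle] : exists2 m, m \in s & forall e, e \in s -> m <= e.
  have : e0 \in s by apply/sE.
  elim: s e0 {Ae0 sE} => // x s IH e0 _.
  case: s IH => [|y s] IH; first by exists x; [rewrite inE|move=> e; rewrite inE => /eqP ->].
  have [m ms mle] := IH y (mem_head _ _).
  have [xm|mx] := leP x m.
    exists x; first exact: mem_head.
    move=> e; rewrite inE => /orP[/eqP -> //|/mle]; exact: le_trans.
  exists m; first by rewrite inE ms orbT.
  move=> e; rewrite inE => /orP[/eqP ->|/mle //]; exact: ltW.
apply: (@lt_le_trans _ _ m); first by apply/h/sE.
by apply: lb_le_inf; [exists e0|move=> e /sE/mle].
Qed.

Lemma eig_re_ub n (A : 'M[R]_n) : exists2 r : R, 0 < r & forall e, eig_re A e -> e < r.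
Proof.
have [s sE] := eig_re_finite A.
exists (\sum_(x <- s) `|x| + 1); first by rewrite ltr_wpDl// sumr_ge0.
move=> e /sE es; rewrite ltr_pwDr// (le_trans (ler_norm e))//.
elim: s es {sE} => // x s IH; rewrite inE big_cons => /orP[/eqP ->|/IH h].
  by rewrite lerDl sumr_ge0.
by rewrite (le_trans h)// lerDr.
Qed.

(** [eigenvalue] speaks of row vectors, so a column eigenvector is obtained from the transpose,
    which has the same characteristic polynomial. Its real and imaginary parts [u], [v] span a real
    subspace invariant under [A]. *)
Lemma eig_re_vec n (A : 'M[R]_n) e : eig_re A e -> exists (u v : 'cV[R]_n) (b : R),
  [/\ (u != 0) || (v != 0), A *m u = e *: u - b *: v & A *m v = e *: v + b *: u].
Proof.
pose Ac : 'M[R[i]]_n := map_mx (fun x : R => (x%:C)%C) A.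
move=> [z /=]; rewrite eigenvalue_root_char -/Ac => zr <-.
have : eigenvalue Ac^T z.
  rewrite eigenvalue_root_char; suff -> : char_poly Ac^T = char_poly Ac by [].
  rewrite /char_poly -det_tr; congr (\det _).
  by rewrite /char_poly_mx raddfB/= tr_scalar_mx map_trmx trmxK.
move=> /eigenvalueP[w wA w0].
have {}wA : Ac *m w^T = z *: w^T by rewrite -[LHS]trmxK trmx_mul trmxK wA linearZ.
pose u := map_mx (@complex.Re R) w^T; pose v := map_mx (@complex.Im R) w^T.
have ReD (x y : R[i]) : complex.Re (x + y) = complex.Re x + complex.Re y by case: x; case: y.
have ImD (x y : R[i]) : complex.Im (x + y) = complex.Im x + complex.Im y by case: x; case: y.
exists u, v, (complex.Im z); split.
- apply: contraNT w0; rewrite negb_or !negbK => /andP[/eqP u0 /eqP v0].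
  apply/eqP/rowP => j; rewrite mxE.
  have : u j 0 = 0 by rewrite u0 mxE.
  have : v j 0 = 0 by rewrite v0 mxE.
  by rewrite !mxE; case: (w 0 j) => x y /= -> ->.
- apply/matrixP => i j; rewrite ord1.
  transitivity (complex.Re ((Ac *m w^T) i 0)).
    rewrite !mxE (big_morph (@complex.Re R) ReD (erefl _)); apply: eq_bigr => l _.
    by rewrite !mxE; case: (w 0 l) => x y /=; rewrite mul0r subr0.
  by rewrite wA !mxE; case: (w 0 i) => x y; case: (z).
- apply/matrixP => i j; rewrite ord1.
  transitivity (complex.Im ((Ac *m w^T) i 0)).
    rewrite !mxE (big_morph (@complex.Im R) ImD (erefl _)); apply: eq_bigr => l _.
    by rewrite !mxE; case: (w 0 l) => x y /=; rewrite mul0r addr0.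
  by rewrite wA !mxE; case: (w 0 i) => x y; case: (z).
Qed.

End mxexp_growth.

(** * Lebesgue measure and linear maps *)

Lemma measurable_forall_fin d (T : measurableType d) (I : finType) (F : I -> set T) :
  (forall i, measurable (F i)) -> measurable [set x | forall i, F i x].
Proof.
move=> mF; rewrite (_ : mkset _ = \bigcap_(i in [set: I]) F i).
  by apply: fin_bigcap_measurable => // i _.
by apply/seteqP; split=> x h i; [move=> _; exact: h|exact: h].
Qed.

(** * Borel sets of R^k through dyadic cubes *)

Section borel_rvec.
Variables (R : realType) (k : nat).
Local Notation V := (Rvec R k).

Lemma open_measurable_rvec (U : set 'cV[R]_k) : open U -> measurable (U : set V).
Proof. exact: sub_sigma_algebra. Qed.

Lemma continuous_measurable_rvec (f : 'cV[R]_k -> R) :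
  continuous f -> measurable_fun [set: V] (f : V -> R).
Proof.
move=> /continuousP cf; apply: (measurability _ (measurable_realfun.RGenOpens.measurableE R)).
move=> _ [_ [a [b ->] <-]]; rewrite setTI; apply: open_measurable_rvec.
exact/cf/interval_open.
Qed.

Lemma measurable_coord i : measurable_fun [set: V] (fun x : V => (x : 'cV[R]_k) i 0).
Proof. by apply: continuous_measurable_rvec; exact: coord_continuous. Qed.

(** The floor makes the half-open cubes of each level a partition of the space, and turns inclusion
    between levels into integer arithmetic. *)
Definition dyadic_cube j (z : {ffun 'I_k -> int}) : set 'cV[R]_k :=
  [set x | forall i, Num.floor (2 ^+ j * x i 0) = z i].

Lemma dyadic_cubeE j z : dyadic_cube j z =
  box (\col_i ((z i)%:~R / 2 ^+ j)) (\col_i (((z i) + 1)%:~R / 2 ^+ j)).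
Proof.
have j0 : 0 < 2 ^+ j :> R by rewrite exprn_gt0.
apply/seteqP; split=> [x h i|x h i].
  rewrite !mxE ler_pdivrMr// ltr_pdivlMr// mulrC -(h i).
  by rewrite floor_le_tmp floorD1_gt.
have := h i; rewrite !mxE ler_pdivrMr// ltr_pdivlMr// mulrC => /floor_def; exact.
Qed.

Lemma measurable_box (a b : 'cV[R]_k) : measurable (box a b : set V).
Proof.
rewrite (_ : box a b = [set x | forall i : 'I_k,
  ((fun x : V => (x : 'cV[R]_k) i 0) @^-1` `[a i 0, b i 0[)%classic x]).
  apply: measurable_forall_fin => i; rewrite -[X in measurable X]setTI.
  exact: measurable_coord.
by apply/seteqP; split=> x h i; have := h i; rewrite /= in_itv.
Qed.

Lemma measurable_dyadic_cube j z : measurable (dyadic_cube j z : set V).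
Proof. by rewrite dyadic_cubeE; exact: measurable_box. Qed.

(** Around each point of [U] some cube of small side stays in [U], and there are countably many
    cubes. So the cubes generate the Borel sets, and both measurability and equality of measures
    reduce to them. *)
Lemma open_bigcup_dyadic (U : set 'cV[R]_k) : open U ->
  U = \bigcup_(p in [set: (nat * {ffun 'I_k -> int})%type])
    (if `[< dyadic_cube p.1 p.2 `<=` U >] then dyadic_cube p.1 p.2 else set0).
Proof.
move=> oU; apply/seteqP; split=> [x Ux|x [p _]]; last first.
  by case: asboolP => // h /h.
have /nbhs_ballP[e /= e0 eU] : nbhs x U by exact: open_nbhs_nbhs.
have [N Ne] : exists N, (2 ^+ N)^-1 < e :> R.
  by have [N _ h] := near_infty_natSinv_expn_lt (PosNum e0); exists N; have := h N (leqnn N); rewrite /= div1r.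
have N0 : 0 < 2 ^+ N :> R by rewrite exprn_gt0.
pose z := [ffun i : 'I_k => Num.floor (2 ^+ N * x i 0)].
exists (N, z) => //=; rewrite asboolT; first by move=> i; rewrite ffunE.
move=> y yz; apply: eU; split => // i j; rewrite ord1 /ball/=.
apply: le_lt_trans Ne; rewrite -(ler_pM2l N0) divff ?gt_eqF//.
rewrite -{1}(gtr0_norm N0) -normrM mulrBr.
have := yz i; rewrite ffunE => yx.
have h1 := floor_le_tmp (2 ^+ N * x i 0); have h2 := floorD1_gt (2 ^+ N * x i 0).
have h3 := floor_le_tmp (2 ^+ N * y i 0); have h4 := floorD1_gt (2 ^+ N * y i 0).
move: h1 h2 h3 h4; rewrite yx rmorphD /= => h1 h2 h3 h4.
by rewrite ler_norml; apply/andP; split; lra.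
Qed.

Lemma measurable_fun_rvec d (T : measurableType d) (X : T -> 'cV[R]_k) :
  (forall i, measurable_fun setT (fun w => X w i 0)) ->
  measurable_fun setT (X : T -> V).
Proof.
move=> mX; apply: (@measurability _ _ _ V _ _ (@open 'cV[R]_k)) => // _ [U oU <-].
rewrite setTI (open_bigcup_dyadic oU) preimage_bigcup.
apply: countable_bigcupT_measurable => // -[j z] /=.
case: asboolP => _; last by rewrite preimage_set0.
rewrite (_ : _ @^-1` _ = [set w | forall i : 'I_k,
  ((fun w => X w i 0) @^-1` `[(z i)%:~R / 2 ^+ j, (z i + 1)%:~R / 2 ^+ j[)%classic w]).
  apply: measurable_forall_fin => i; rewrite -[X in measurable X]setTI.
  exact: mX.
by rewrite dyadic_cubeE; apply/seteqP; split=> x h i; have := h i; rewrite /= in_itv/= ?mxE.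
Qed.

Lemma measurable_rvec_coord d (T : measurableType d) (X : T -> V) i :
  measurable_fun setT X -> measurable_fun setT (fun w => (X w : 'cV[R]_k) i 0).
Proof. by move=> mX; exact: (measurableT_comp (measurable_coord i)). Qed.

(** For [N] a power of two: the cube of a finer level determines the cube of a coarser one, so two
    dyadic cubes are nested or disjoint. *)
Lemma floor_mul_inj (a b : R) N : (0 < N)%N ->
  Num.floor (a * N%:R) = Num.floor (b * N%:R) -> Num.floor a = Num.floor b.
Proof.
move=> N0.
have key (c : R) (m : int) : (m <= Num.floor c) = (m * N%:Z <= Num.floor (c * N%:R)).
  by rewrite !floor_ge_int_tmp rmorphM /= ler_pM2r// ltr0n.
move=> h; apply/eqP; rewrite eq_le [X in X && _]key [X in _ && X]key.
by rewrite -h -key lexx h -key lexx.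
Qed.

(** Being nested or disjoint, the cubes together with the empty set are stable under intersection,
    and the unit cubes are a countable cover of finite measure. *)
Lemma rvec_measure_unique (m1 m2 : {measure set V -> \bar R}) :
  (forall j z, m1 (dyadic_cube j z) = m2 (dyadic_cube j z)) ->
  (forall z, m1 (dyadic_cube 0 z) < +oo)%E ->
  forall A, measurable A -> m1 A = m2 A.
Proof.
move=> m12 m1oo.
pose G : set (set V) := [set A | A = set0 \/ exists j z, A = dyadic_cube j z].
pose g (i : nat) : set V := if unpickle i is Some z then dyadic_cube 0 z else set0.
apply: (measure_unique G g).
- apply/seteqP; split; apply: smallest_sub.
  + exact: smallest_sigma_algebra.
  + move=> U oU; rewrite (open_bigcup_dyadic oU).
    apply: (@countable_bigcupT_measurable _ (g_sigma_algebraType G)) => // -[j z] /=.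
    case: asboolP => _; last exact: measurable0.
    by apply: sub_sigma_algebra; right; exists j, z.
  + exact: sigma_algebra_measurable.
  + move=> A [->|[j [z ->]]]; first exact: measurable0.
    exact: measurable_dyadic_cube.
- move=> A B [->|[j [z ->]]]; first by move=> _; left; rewrite set0I.
  move=> [->|[j' [z' ->]]]; first by left; rewrite setI0.
  have [/eqP ->|/set0P[x [xz xz']]] := boolP (dyadic_cube j z `&` dyadic_cube j' z' == set0).
    by left.
  wlog jj' : j j' z z' xz xz' / (j <= j')%N.
    move=> h; case/orP : (leq_total j j') => jj; first exact: (h _ _ _ _ xz xz').
    by rewrite setIC; exact: (h _ _ _ _ xz' xz).
  right; exists j', z'; apply/setIidr => y yz' i.
  rewrite -(xz i); have := yz' i; rewrite -(xz' i).
  rewrite -(subnKC jj') exprD -natrX !natrX => h.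
  apply: (@floor_mul_inj _ _ (2 ^ (j' - j))); first by rewrite expn_gt0.
  by rewrite !natrX mulrAC h mulrAC.
- by move=> i; rewrite /g; case: unpickle => [z|]; [right; exists 0%N, z|left].
- rewrite -subTset => x _; exists (pickle [ffun i : 'I_k => Num.floor (2 ^+ 0 * x i 0)]) => //.
  by rewrite /g pickleK => i; rewrite ffunE.
- by move=> A [->|[j [z ->]]]; rewrite ?measure0.
- by move=> i; rewrite /g; case: unpickle => // ; rewrite measure0.
Qed.

End borel_rvec.

Lemma prod_ord_const (R : realType) d (c : R) : \prod_(i < d) c = c ^+ d.
Proof. by rewrite prodr_const card_ord. Qed.

Section lebesgue_linear.
Variables (R : realType) (d : nat).
Variable leb : {measure set (Rvec R d) -> \bar R}.
Hypothesis hleb : is_lebesgue leb.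
Local Notation V := (Rvec R d).

Lemma leb_dyadic j z : leb (dyadic_cube j z) = ((2 ^- j) ^+ d)%:E.
Proof.
rewrite dyadic_cubeE hleb.
  by rewrite -(prod_ord_const d); congr EFin; apply: eq_bigr => i _;
    rewrite !mxE rmorphD /= mulrDl addrAC subrr add0r mul1r.
by move=> i; rewrite !mxE ler_pM2r ?invr_gt0 ?exprn_gt0// ler_int lerDl.
Qed.

Lemma leb_scale_unique (m : {measure set V -> \bar R}) (c : R) : 0 <= c ->
  (forall j z, m (dyadic_cube j z) = (c * (2 ^- j) ^+ d)%:E) ->
  forall A, measurable A -> m A = (c%:E * leb A)%E.
Proof.
move=> c0 hm A mA.
rewrite (@rvec_measure_unique _ _ m (mscale (NngNum c0) leb))//.
- by move=> j z; rewrite hm EFinM -(leb_dyadic j z).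
- by move=> z; rewrite hm ltry.
Qed.

Lemma measurable_affine (F : 'M[R]_d) (v : 'cV[R]_d) :
  measurable_fun [set: V] (fun x : V => (F *m x + v : V)).
Proof.
apply: measurable_fun_rvec => i.
rewrite (_ : (fun _ => _) = (fun x : V => \sum_(j < d) F i j * (x : 'cV[R]_d) j 0 + v i 0)).
  apply: measurable_funD => //; apply: measurable_sum => j.
  by apply: measurable_funM => //; exact: measurable_coord.
by apply/funext => x; rewrite !mxE.
Qed.

Lemma measurable_affine_preimage (F : 'M[R]_d) (v : 'cV[R]_d) (A : set V) :
  measurable A -> measurable [set x : V | A (F *m x + v)].
Proof. by move=> mA; have := measurable_affine F v measurableT mA; rewrite setTI. Qed.

Lemma leb_affine_unique (F : 'M[R]_d) (v : 'cV[R]_d) (c : R) : 0 <= c ->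
  (forall j z, leb [set x : V | dyadic_cube j z (F *m x + v)] = (c * (2 ^- j) ^+ d)%:E) ->
  forall A : set V, measurable A -> leb [set x : V | A (F *m x + v)] = (c%:E * leb A)%E.
Proof.
move=> c0 hc A mA.
pose m : {measure set V -> \bar R} :=
  measure_function_pushforward__canonical__measure_function_Measure leb (measurable_affine F v).
exact: (@leb_scale_unique m).
Qed.

Lemma leb_box_le (a b : 'cV[R]_d) c : (forall i, b i 0 - a i 0 <= c) -> 0 <= c ->
  (leb (box a b) <= (c ^+ d)%:E)%E.
Proof.
move=> abc c0; have [ab|/existsNP[i /negP]] := pselect (forall i, a i 0 <= b i 0).
  rewrite hleb// lee_fin -prod_ord_const; apply: ler_prod => i _.
  by rewrite subr_ge0 ab abc.
rewrite -ltNge => ba; rewrite (_ : box a b = set0) ?measure0 ?lee_fin ?exprn_ge0//.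
rewrite -subset0 => x /(_ i) /andP[h1 h2].
by have := lt_trans (le_lt_trans h1 h2) ba; rewrite ltxx.
Qed.

Lemma leb_translate (v : 'cV[R]_d) (A : set V) : measurable A ->
  leb [set x : V | A (x + v)] = leb A.
Proof.
move=> mA.
have := @leb_affine_unique 1%:M v 1 ler01 _ A mA.
under eq_set do rewrite mul1mx.
rewrite mul1e; apply => j z; under eq_set do rewrite mul1mx.
rewrite dyadic_cubeE.
set a := \col_i _; set b := \col_i _.
rewrite (_ : [set x | _] = box (a - v) (b - v)); last first.
  by apply/seteqP; split=> x /= h i; have := h i; rewrite !mxE lerBlDr ltrBrDr.
have ab i : a i 0 <= b i 0.
  by rewrite !mxE ler_pM2r ?invr_gt0 ?exprn_gt0// ler_int lerDl.
rewrite hleb; last by move=> i; rewrite [X in X <= _]mxE [X in _ <= X]mxE lerD2r ab.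
have := leb_dyadic j z; rewrite mul1r => <-; rewrite dyadic_cubeE hleb//.
congr EFin; apply: eq_bigr => i _.
by rewrite ![(_ - v) _ _]mxE; ring.
Qed.

Lemma leb_diag (D : 'rV[R]_d) (A : set V) : (forall i, 0 < D 0 i) -> measurable A ->
  leb [set x : V | A (diag_mx D *m x)] = ((\prod_i (D 0 i)^-1)%:E * leb A)%E.
Proof.
move=> D0 mA.
have := @leb_affine_unique (diag_mx D) 0 (\prod_i (D 0 i)^-1) _ _ A mA.
under eq_set do rewrite addr0.
apply; first by apply: prodr_ge0 => i _; rewrite invr_ge0 ltW.
move=> j z; under eq_set do rewrite addr0.
have j0 : 0 < (2 : R) ^+ j by rewrite exprn_gt0.
rewrite (_ : [set x | _] = box (\col_i ((z i)%:~R / 2 ^+ j / D 0 i)) (\col_i ((z i + 1)%:~R / 2 ^+ j / D 0 i))).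
  rewrite hleb => [|i]; last first.
    by rewrite !mxE !ler_pM2r ?invr_gt0// ler_int lerDl.
  congr EFin; rewrite -(prod_ord_const d) -big_split /=.
  apply: eq_bigr => i _; rewrite !mxE rmorphD /=; field.
  by rewrite !gt_eqF.
rewrite dyadic_cubeE; apply/seteqP; split=> x h i; have := h i; rewrite mul_diag_mx !mxE;
  by rewrite (ler_pdivrMr _ _ (D0 i)) (ltr_pdivlMr _ _ (D0 i)) [D 0 i * _]mulrC.
Qed.

(** The factor by which the preimage under [F] changes volume, that is [1 / |det F|] for invertible
    [F]. It is handled through multiplicativity and estimates near the identity. *)
Definition kappa (F : 'M[R]_d) : R := fine (leb [set x : V | dyadic_cube 0 [ffun=> 0] (F *m x)]).

Lemma cube0E (x : 'cV[R]_d) : dyadic_cube 0 [ffun=> 0] x <-> forall i, 0 <= x i 0 < 1.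
Proof.
by rewrite dyadic_cubeE; split=> h i; have := h i; rewrite !mxE ffunE expr0 !divr1 add0r.
Qed.

Lemma measurable_cube0 (F : 'M[R]_d) : measurable [set x : V | dyadic_cube 0 [ffun=> 0] (F *m x)].
Proof.
have := @measurable_affine_preimage F 0 _ (@measurable_dyadic_cube R d 0 [ffun=> 0]).
by under eq_set do rewrite addr0.
Qed.

Lemma cube0_norm (x : 'cV[R]_d) : dyadic_cube 0 [ffun=> 0] x -> `|x| <= 1.
Proof.
move=> /cube0E h; apply: mx_norm_le => // i j; rewrite ord1.
by have /andP[h0 h1] := h i; rewrite ger0_norm// ltW.
Qed.

(** The preimage of the unit cube lies in a box of half-side [d |F^-1| + 1], hence has finite
    measure. *)
Lemma kappaE F : F \in unitmx ->
  leb [set x : V | dyadic_cube 0 [ffun=> 0] (F *m x)] = (kappa F)%:E.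
Proof.
move=> uF; rewrite /kappa fineK// ge0_fin_numE//.
pose c : R := d%:R * `|invmx F| + 1.
have c0 : 0 <= c by rewrite addr_ge0// mulr_ge0.
apply: (@le_lt_trans _ _ (leb (box (const_mx (- c)) (const_mx c)))); last first.
  by rewrite hleb ?ltry// => i; rewrite !mxE lerNl (le_trans _ c0)// oppr_le0.
apply: le_measure; rewrite ?inE; [exact: measurable_cube0|exact: measurable_box|].
move=> x /= /cube0_norm x1 i.
have : `|x i 0| < c.
  rewrite /c -(mulKmx uF x); apply: le_lt_trans (mx_entry_le _ _ _) _.
  apply: le_lt_trans (mulmx_norm _ _) _.
  by rewrite (@le_lt_trans _ _ (d%:R * `|invmx F|)) ?ltrDl// ler_piMr// mulr_ge0.
by rewrite !mxE ltr_norml => /andP[/ltW -> ->].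
Qed.

Lemma kappa_ge0 F : 0 <= kappa F.
Proof. exact: fine_ge0. Qed.

Lemma leb_linear F (A : set V) : F \in unitmx -> measurable A ->
  leb [set x : V | A (F *m x)] = ((kappa F)%:E * leb A)%E.
Proof.
move=> uF mA; have := @leb_affine_unique F 0 (kappa F) (kappa_ge0 F) _ A mA.
under eq_set do rewrite addr0.
apply => j z; under eq_set do rewrite addr0.
have j0 : 0 < (2 : R) ^+ j by rewrite exprn_gt0.
pose zv : 'cV[R]_d := \col_i (z i)%:~R.
pose K := [set x : V | dyadic_cube 0 [ffun=> 0] (F *m x)].
(* [F x] lies in the cube [z] of level [j] exactly when [F (2^j x - F^-1 z)] lies in the unit cube.
   So the preimage is [K] translated and dilated, and has measure [2^(-jd) kappa F]. *)
pose K' := [set x : V | K (x + invmx F *m (- zv))].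
have mK' : measurable K'.
  have := @measurable_affine_preimage 1%:M (invmx F *m (- zv)) K (measurable_cube0 F).
  by under eq_set do rewrite mul1mx.
rewrite (_ : [set x | _] = [set x : V | K' (diag_mx (const_mx (2 ^+ j)) *m x)]).
  rewrite leb_diag => [|i|//]; last by rewrite mxE.
  rewrite leb_translate; last exact: measurable_cube0.
  rewrite kappaE// -EFinM mulrC; congr (_ * _)%:E.
  rewrite -(prod_ord_const d); apply: eq_bigr => i _.
  by rewrite mxE.
rewrite diag_const_mx dyadic_cubeE; apply/seteqP.
have e x i : (F *m ((2 ^+ j)%:M *m x + invmx F *m - zv)) i 0 = 2 ^+ j * (F *m x) i 0 - (z i)%:~R.
  by rewrite mulmxDr mulKVmx// mul_scalar_mx -scalemxAr !mxE.
split=> x; rewrite /K' /K /=.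
  move=> h; apply/cube0E => i; rewrite mul_scalar_mx -mul_scalar_mx e.
  have := h i; rewrite !mxE rmorphD /= ler_pdivrMr// ltr_pdivlMr// mulrC.
  by rewrite subr_ge0 ltrBlDr addrC.
move=> /cube0E h i; have := h i; rewrite e !mxE rmorphD /= ler_pdivrMr// ltr_pdivlMr//.
by rewrite subr_ge0 ltrBlDr addrC mulrC.
Qed.

Lemma kappaM F G : F \in unitmx -> G \in unitmx -> kappa (F *m G) = kappa F * kappa G.
Proof.
move=> uF uG; apply: EFin_inj; rewrite -kappaE ?unitmx_mul ?uF// EFinM -(kappaE uF) muleC.
rewrite -leb_linear//; last exact: measurable_cube0.
by congr (leb _); apply/seteqP; split=> x /=; rewrite mulmxA.
Qed.

Lemma kappa1 : kappa 1%:M = 1.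
Proof.
apply: EFin_inj; rewrite -kappaE ?unitmx1//; under eq_set do rewrite mul1mx.
by rewrite leb_dyadic expr0 invr1 expr1n.
Qed.

Lemma kappa_diag (D : 'rV[R]_d) : (forall i, 0 < D 0 i) -> kappa (diag_mx D) = \prod_i (D 0 i)^-1.
Proof.
move=> D0; rewrite /kappa leb_diag//; last exact: measurable_dyadic_cube.
by rewrite leb_dyadic expr0 invr1 expr1n mule1.
Qed.

(** A row vector in the kernel satisfies [v = - v X], hence [|v| <= |v| / 2]. *)
Lemma unitmx_near1 (X : 'M[R]_d) e : d%:R * `|X| <= e -> e <= 1 / 2 -> 1%:M + X \in unitmx.
Proof.
move=> Xe e2; rewrite -row_free_unit -kermx_eq0; apply/eqP/row_matrixP => i; rewrite row0.
set v := row i _.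
have : v *m (1%:M + X) = 0 by rewrite /v -row_mul mulmx_ker row0.
rewrite mulmxDr mulmx1 => /eqP; rewrite addr_eq0 => /eqP vE.
apply/eqP; rewrite -normr_le0.
have : `|v| <= `|v| / 2.
  rewrite {1}vE normrN; apply: le_trans (mulmx_norm _ _) _.
  rewrite mulrAC mulrC ler_wpM2l//; lra.
lra.
Qed.

(** As [|X x| <= e |x|], the preimage of the unit cube under [1 + X] contains the box with sides
    [[e, 1 - e)] and is contained in the one with sides [[-2e, 1 + 2e)]. *)
Lemma kappa_near1 (X : 'M[R]_d) e : d%:R * `|X| <= e -> e <= 1 / 2 ->
  (1 - 2 * e) ^+ d <= kappa (1%:M + X) <= (1 + 4 * e) ^+ d.
Proof.
move=> Xe e2; have uX := unitmx_near1 Xe e2.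
have e0 : 0 <= e by apply: le_trans Xe; rewrite mulr_ge0.
have X_le (x : 'cV[R]_d) : `|X *m x| <= e * `|x|.
  by apply: le_trans (mulmx_norm _ _) _; rewrite ler_wpM2r.
apply/andP; split; rewrite -lee_fin -kappaE//.
  apply: (@le_trans _ _ (leb (box (const_mx e) (const_mx (1 - e))))).
    rewrite hleb; last by move=> i; rewrite !mxE; lra.
    rewrite -(prod_ord_const d) lee_fin le_eqVlt; apply/orP; left.
    by apply/eqP/eq_bigr => i _; rewrite !mxE; ring.
  apply: le_measure; rewrite ?inE; [exact: measurable_box|exact: measurable_cube0|].
  move=> x h; apply/cube0E => i; rewrite mulmxDl mul1mx.
  have x1 : `|x| <= 1.
    apply: mx_norm_le => // k l; rewrite ord1; have := h k; rewrite !mxE => /andP[h1 h2].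
    rewrite ger0_norm; lra.
  have : `|(X *m x) i 0| <= e.
    apply: le_trans (mx_entry_le _ _ _) _; apply: le_trans (X_le x) _.
    by rewrite ler_piMr.
  rewrite ler_norml => /andP[h1 h2].
  have /andP[h3 h4] : e <= x i 0 < 1 - e by have := h i; rewrite !mxE.
  by apply/andP; split; rewrite mxE; lra.
apply: (@le_trans _ _ (leb (box (const_mx (- (2 * e))) (const_mx (1 + 2 * e))))); last first.
  by apply: leb_box_le => [i|]; rewrite ?mxE; lra.
apply: le_measure; rewrite ?inE; [exact: measurable_cube0|exact: measurable_box|].
move=> x /=; rewrite mulmxDl mul1mx => h i.
have y1 := cube0_norm h.
have x2 : `|x| <= 2.
  have : `|x| <= 1 + `|x| / 2.
    have {1}-> : x = (x + X *m x) - X *m x by rewrite addrK.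
    apply: le_trans (ler_normB _ _) _; apply: lerD => //.
    apply: le_trans (X_le x) _; rewrite mulrC ler_wpM2l//; lra.
  lra.
have : `|(X *m x) i 0| <= 2 * e.
  apply: le_trans (mx_entry_le _ _ _) _; apply: le_trans (X_le x) _.
  by rewrite mulrC ler_wpM2r.
rewrite ler_norml => /andP[h1 h2].
have /cube0E/(_ i) := h; rewrite mxE => /andP[h3 h4].
by apply/andP; split; rewrite !mxE; lra.
Qed.

End lebesgue_linear.

(** * Change of volume under the flow of a matrix *)

Section lebesgue_exp.
Variables (R : realType) (d : nat).
Variable leb : {measure set (Rvec R d) -> \bar R}.
Hypothesis hleb : is_lebesgue leb.
Hypothesis hd : (0 < d)%N.
Local Notation V := (Rvec R d).
Local Notation kappa := (kappa leb).

(* Conjugation by [diag (rho ^ w i)] multiplies the entries of [L] by powers of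
   [rho]; letting [rho] tend to [0] moves [1 + L] to [1] without changing [kappa]. *)
Lemma kappa_unipotent (L : 'M[R]_d) (w : 'I_d -> nat) :
  (forall i j, L i j != 0 -> (w j < w i)%N) ->
  1%:M + L \in unitmx /\ 1 <= kappa (1%:M + L).
Proof.
move=> Lw.
have conj (rho : R) : 0 < rho -> rho <= 1 -> exists Dl Dr : 'M[R]_d,
   [/\ Dl \in unitmx, Dr \in unitmx, Dl *m Dr = 1%:M &
      `|Dl *m L *m Dr| <= rho * `|L|].
  move=> r0 r1.
  pose Dl : 'M[R]_d := diag_mx (\row_i rho ^+ w i).
  pose Dr : 'M[R]_d := diag_mx (\row_i (rho ^+ w i)^-1).
  have DD : Dl *m Dr = 1%:M.
    apply/matrixP => i j; rewrite mul_diag_mx !mxE; case: eqP => [->|_]; last by rewrite mulr0n mulr0.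
    by rewrite mulr1n divff// gt_eqF// exprn_gt0.
  have [ul ur] := mulmx1_unit DD.
  exists Dl, Dr; split => //.
  apply: mx_norm_le => [|i j]; first by rewrite mulr_ge0// ltW.
  rewrite mul_mx_diag mul_diag_mx !mxE.
  have [->|Lij] := eqVneq (L i j) 0; first by rewrite mulr0 mul0r normr0 mulr_ge0// ltW.
  rewrite mulrAC normrM ler_pM ?mx_entry_le//.
  (* Conjugation multiplies this entry by [rho^(w i - w j)], whose exponent is at least [1]. *)
  have wij := Lw _ _ Lij.
  rewrite ger0_norm; last by rewrite divr_ge0// exprn_ge0// ltW.
  rewrite ler_pdivrMr ?exprn_gt0// -exprS.
  by rewrite ler_wiXn2l// ltW.
have near e : 0 < e -> e <= 1 / 2 -> exists Dl Dr : 'M[R]_d,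
   [/\ Dl \in unitmx, Dr \in unitmx, Dl *m Dr = 1%:M &
      d%:R * `|Dl *m L *m Dr| <= e].
  move=> e0 e1.
  pose c := d%:R * `|L| + 1.
  have c0 : 0 < c by rewrite ltr_wpDl// mulr_ge0.
  have [||Dl [Dr [h1 h2 h3 h4]]] := conj (Num.min 1 (e / c)).
  - by rewrite lt_min ltr01 divr_gt0.
  - by rewrite ge_min lexx.
  exists Dl, Dr; split => //.
  apply: le_trans (ler_wpM2l (ler0n _ d) h4) _.
  apply: (@le_trans _ _ (e / c * (d%:R * `|L|))).
    by rewrite mulrCA ler_wpM2r ?mulr_ge0// ge_min lexx orbT.
  rewrite mulrAC ler_pdivrMr//; apply: ler_wpM2l; first exact: ltW.
  by rewrite /c lerDl.
have cE Dl Dr : Dl *m Dr = 1%:M -> 1%:M + Dl *m L *m Dr = Dl *m (1%:M + L) *m Dr.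
  by move=> DD; rewrite mulmxDr mulmxDl mulmx1 DD.
have uL : 1%:M + L \in unitmx.
  have [||Dl [Dr [h1 h2 h3 h4]]] := near (1/2); [lra|lra|].
  have := unitmx_near1 h4 (lexx _).
  by rewrite cE// !unitmx_mul h1 h2 andbT.
split => //; apply/ler_addgt0Pl => e e0.
pose c : R := 2 * d%:R + 1.
have c0 : 0 < c by rewrite ltr_wpDl// mulr_ge0.
pose e1 := Num.min (1/2) (e / c).
have e10 : 0 < e1 by rewrite lt_min; apply/andP; split; [lra|exact: divr_gt0].
have e12 : e1 <= 1/2 by rewrite ge_min lexx.
have [||Dl [Dr [h1 h2 h3 h4]]] := near e1 => //.
have /andP[h5 _] := kappa_near1 hleb h4 e12.
move: h5; rewrite cE// !(kappaM hleb) ?unitmx_mul ?h1//.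
have -> : kappa Dl * kappa (1%:M + L) * kappa Dr = kappa (1%:M + L).
  by rewrite mulrAC -(kappaM hleb)// h3 (kappa1 hleb) mul1r.
(* Bernoulli's inequality turns [(1 - 2 e1)^d <= kappa (1 + L)] into [1 - e <= kappa (1 + L)]: the
   constant [c = 2d + 1] ensures [2 d e1 <= e]. *)
have bern : forall k, 1 - k%:R * (2 * e1) <= (1 - 2 * e1) ^+ k.
  elim=> [|k IH]; first by rewrite mul0r subr0 expr0.
  rewrite exprS; apply: (@le_trans _ _ ((1 - 2 * e1) * (1 - k%:R * (2 * e1)))); last first.
    by rewrite ler_wpM2l//; lra.
  rewrite -natr1 -subr_ge0 (_ : _ - _ = k%:R * (2 * e1) ^+ 2); last by ring.
  by rewrite mulr_ge0// sqr_ge0.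
move=> h5; have := le_trans (bern d) h5.
have h6 : d%:R * (2 * e1) <= e.
  apply: (@le_trans _ _ (d%:R * (2 * (e / c)))).
    by rewrite !ler_wpM2l// ge_min lexx orbT.
  rewrite mulrA mulrA ler_pdivrMr// mulrC [d%:R * 2]mulrC.
  apply: ler_wpM2l; [exact: ltW|by rewrite /c lerDl].
lra.
Qed.

(* [(1 - hD)(1 - hU)(1 - hL) exp(hE) = 1 + o(h)] when [E = D + U + L]. *)
Lemma kappa_mxexp_small (E : 'M[R]_d) e : 0 < e ->
  exists2 del, 0 < del & forall h, `|h| <= del ->
    kappa (mxexp (h *: E)) <= expR (- h * \tr E + e * `|h|).
Proof.
move=> e0.
pose D : 'M[R]_d := diag_mx (\row_i E i i).
pose L : 'M[R]_d := \matrix_(i, j) (if (j < i)%N then E i j else 0).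
pose U : 'M[R]_d := \matrix_(i, j) (if (i < j)%N then E i j else 0).
have EDUL : D + U + L = E.
  apply/matrixP => i j; rewrite !mxE.
  have [ij|ij|/val_inj ->] := ltngtP i j.
  - rewrite (_ : (i == j) = false) ?mulr0n ?add0r ?addr0//.
    by apply/eqP => h; rewrite h ltnn in ij.
  - rewrite (_ : (i == j) = false) ?mulr0n ?add0r ?addr0//.
    by apply/eqP => h; rewrite h ltnn in ij.
  - by rewrite eqxx !addr0.
pose G h := (1%:M + (- h) *: D) *m (1%:M + (- h) *: U) *m (1%:M + (- h) *: L) *m mxexp (h *: E).
have dlin (C : 'M[R]_d) t i j : is_derive t (1 : R) (fun h => (1%:M + (- h) *: C) i j) ((- C) i j).
  rewrite (_ : (fun h => _) = (fun h => (1%:M : 'M[R]_d) i j + (- C i j) * h)); last first.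
    by apply/funext => h; rewrite !mxE mulNr mulrC mulNr mulrC.
  rewrite [X in is_derive _ _ _ X]mxE; apply: is_derive_eq.
  by rewrite add0r mul1r /GRing.scale /= mulr1.
have dG i j : is_derive (0 : R) (1 : R) (fun h => G h i j) 0.
  apply: is_derive_eq.
    apply: (is_derive_mulmx (B := fun h => mxexp (h *: E)) (dB := E *m mxexp (0 *: E))); last first.
      by move=> k l; exact: is_derive_mxexp.
    apply: is_derive_mulmx => //; apply: is_derive_mulmx => //.
  rewrite /= !oppr0 !scale0r !addr0 !mulmx1 !mul1mx mxexp0 !mulmx1.
  by rewrite -!opprD EDUL addNr mxE.
have G0 : G 0 = 1%:M by rewrite /G !oppr0 !scale0r !addr0 !mulmx1 ?mul1mx mxexp0.
have d0 : 0 < d%:R :> R by rewrite ltr0n.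
(* Chosen so that [(1 + 4 d c |h|)^d <= exp (4 d^2 c |h|) = exp (e |h|)]. *)
pose c : R := e / (4 * d%:R * d%:R).
have c0 : 0 < c by rewrite divr_gt0 ?mulr_gt0.
have Gnear : \forall h \near (0 : R), forall i j, `|G h i j - (1%:M : 'M[R]_d) i j| <= c * `|h|.
  have key i j : \forall h \near (0 : R), `|G h i j - (1%:M : 'M[R]_d) i j| <= c * `|h|.
    have [df dv] := dG i j.
    have := df; rewrite /derivable => /cvg_ex[l hl].
    have l0 : l = 0 by move: dv; rewrite /derive (cvg_lim _ hl).
    move: hl; rewrite l0 => /cvgrPdist_le/(_ _ c0).
    rewrite /dnbhs near_withinE; apply: filterS => h hh.
    have [->|h0] := eqVneq h 0; first by rewrite G0 subrr normr0 mulr0.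
    have := hh h0; rewrite sub0r normrN /= addr0 scaler1 G0.
    rewrite normrM normfV ler_pdivrMl ?normr_gt0// mulrC //.
  have FF : Filter (nbhs (0 : R)) by exact: nbhs_filter.
  apply: (@filter_forall R 'I_d (fun i h => forall j, `|G h i j - 1%:M i j| <= c * `|h|) _ FF) => i.
  by apply: (@filter_forall R 'I_d (fun j h => `|G h i j - 1%:M i j| <= c * `|h|) _ FF) => j; exact: key.
pose M := `|E| + 1.
have M0 : 0 < M by rewrite ltr_wpDl.
have dc : 0 < d%:R * c by rewrite mulr_gt0.
have /nbhs_ballP[del1 /= del10 hdel] := Gnear.
(* The three bounds on [h] give, in this order, the estimate of [G h - 1], the positivity of the
   diagonal entries [1 - h E i i], and the smallness required by [kappa_near1]. *)
exists (Num.min (del1 / 2) (Num.min (2 * M)^-1 (2 * (d%:R * c))^-1)).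
  rewrite !lt_min; apply/and3P; split; first exact: divr_gt0.
    by rewrite invr_gt0; exact: mulr_gt0.
  by rewrite invr_gt0; exact: mulr_gt0.
move=> h; rewrite !le_min => /and3P[hle1 hle2 hle3].
have h1 : forall i j, `|G h i j - (1%:M : 'M[R]_d) i j| <= c * `|h|.
  by apply: hdel; rewrite /ball/= sub0r normrN; apply: le_lt_trans hle1 _; lra.
have h2 i : 0 < 1 - h * E i i.
  have : `|h * E i i| < 1.
    apply: (@le_lt_trans _ _ ((2 * M)^-1 * M)).
      rewrite normrM ler_pM//.
      by apply: le_trans (mx_entry_le _ _ _) _; rewrite lerDl.
    by rewrite invfM mulfVK ?gt_eqF// invf_lt1// ltr1n.
  by rewrite ltr_norml subr_gt0 => /andP[].
have h3 : d%:R * c * `|h| <= 1 / 2.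
  apply: le_trans (ler_wpM2l (ltW dc) hle3) _.
  by rewrite invfM mulrCA divff ?gt_eqF// mulr1 mul1r.
have GX : G h = 1%:M + (G h - 1%:M) by rewrite addrC subrK.
have X_le : d%:R * `|G h - 1%:M| <= d%:R * c * `|h|.
  rewrite -mulrA ler_wpM2l//; apply: mx_norm_le => [|i j]; first by rewrite mulr_ge0// ltW.
  by have := h1 i j; rewrite !mxE.
have /andP[_ kG] := kappa_near1 hleb X_le h3.
rewrite -GX in kG.
have dgE : 1%:M + - h *: D = diag_mx (\row_i (1 - h * E i i)).
  apply/matrixP => i j; rewrite !mxE; case: eqP => _; first by rewrite !mulr1n mulNr.
  by rewrite !mulr0n mulr0 addr0.
have uD : 1%:M + - h *: D \in unitmx.
  rewrite unitmxE dgE det_diag unitfE prodf_seq_neq0; apply/allP => i _ /=.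
  by rewrite mxE gt_eqF.
have [uU kU] : 1%:M + - h *: U \in unitmx /\ 1 <= kappa (1%:M + - h *: U).
  (* The weights decrease with the index since [U] is strictly upper triangular; for [L] below they
     increase. *)
  apply: (@kappa_unipotent _ (fun i => (d - i)%N)) => i j; rewrite !mxE.
  case: ifPn => [ij _|_]; last by rewrite mulr0 eqxx.
  by apply: ltn_sub2l.
have [uL kL] : 1%:M + - h *: L \in unitmx /\ 1 <= kappa (1%:M + - h *: L).
  apply: (@kappa_unipotent _ (fun i => i)) => i j; rewrite !mxE.
  by case: ifPn => // _; rewrite mulr0 eqxx.
have uE := mxexp_unit E h.
move: kG; rewrite /G !(kappaM hleb) ?unitmx_mul ?uD ?uU ?uL//.
rewrite dgE (kappa_diag hleb); last by move=> i; rewrite mxE.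
set kE := kappa (mxexp _); move=> kG.
have kE0 : 0 <= kE by exact: kappa_ge0.
have P0 : 0 < \prod_i (1 - h * E i i) by apply: prodr_gt0 => i _.
have {}kG : kE <= (1 + 4 * (d%:R * c * `|h|)) ^+ d * \prod_i (1 - h * E i i).
  rewrite -ler_pdivrMr//; apply: le_trans kG.
  have -> : \prod_i ((\row_i0 (1 - h * E i0 i0)) 0 i)^-1 = (\prod_i (1 - h * E i i))^-1.
    by rewrite -prodfV; apply: eq_bigr => i _; rewrite mxE.
  rewrite mulrC -!mulrA; apply: ler_wpM2l; first by rewrite invr_ge0 ltW.
  by rewrite mulrA ler_peMl// mulr_ege1.
apply: le_trans kG _; rewrite expRD mulrC; apply: ler_pM.
- exact: ltW.
- by rewrite exprn_ge0// addr_ge0// !mulr_ge0// ltW.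
- rewrite /mxtrace mulr_sumr expR_sum; apply: ler_prod => i _.
  by rewrite ltW// mulNr; have := expR_ge1Dx (- (h * E i i)).
- apply: (@le_trans _ _ (expR (4 * (d%:R * c * `|h|)) ^+ d)).
    rewrite lerXn2r ?nnegrE ?expR_ge0 ?expR_ge1Dx//.
    by rewrite addr_ge0// !mulr_ge0// ltW.
  rewrite -expRM_natl ler_expR le_eqVlt; apply/orP; left; apply/eqP.
  by rewrite /c; field; rewrite pnatr_eq0 -lt0n.
Unshelve. all: by end_near. Qed.

(** Cut [t] into equal small steps and multiply: the errors [e |t| / N] of the [N] steps add up to
    [e |t|] whatever [N] is, and [e] is arbitrary. *)
Lemma kappa_mxexp (E : 'M[R]_d) t : kappa (mxexp (t *: E)) <= expR (- t * \tr E).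
Proof.
have step e : 0 < e -> kappa (mxexp (t *: E)) <= expR (- t * \tr E + e * `|t|).
  move=> e0; have [del del0 hdel] := kappa_mxexp_small E e0.
  have [N hN] : exists N : nat, `|t| / del <= N.+1%:R.
    exists (Num.truncn (`|t| / del)); rewrite ltW// truncnS_gt//.
  have N0 : 0 < N.+1%:R :> R by rewrite ltr0n.
  have := hdel (t / N.+1%:R); rewrite normrM normfV [`|N.+1%:R|]gtr0_norm//.
  rewrite ler_pdivrMr// -ler_pdivrMl// mulrC => /(_ hN) hk.
  have -> : kappa (mxexp (t *: E)) = kappa (mxexp ((t / N.+1%:R) *: E)) ^+ N.+1.
    have -> : t *: E = ((N.+1%:R * (t / N.+1%:R)) *: E).
      by rewrite mulrCA divff ?mulr1// gt_eqF.
    move: (t / _) => s; elim: N.+1 => [|m IH].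
      by rewrite mul0r scale0r mxexp0 (kappa1 hleb) expr0.
    rewrite -natr1 mulrDl mul1r addrC mxexpD (kappaM hleb) ?mxexp_unit//.
    by rewrite IH exprS.
  apply: (@le_trans _ _ (expR (- (t / N.+1%:R) * \tr E + e * (`|t| / N.+1%:R)) ^+ N.+1)).
    by rewrite lerXn2r ?nnegrE ?expR_ge0// kappa_ge0.
  rewrite -expRM_natl ler_expR le_eqVlt; apply/orP; left; apply/eqP; field.
  by rewrite addrC natr1 pnatr_eq0.
apply/ler_addgt0Pl => e e0.
have h : expR (- t * \tr E + x * `|t|) @[x --> 0^'+] --> expR (- t * \tr E + 0 * `|t|).
  apply: continuous_cvg; first exact: continuous_expR.
  apply: cvgD; first exact: cvg_cst.
  apply: cvgMl; apply: cvg_at_right_filter; exact: cvg_id.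
move: h; rewrite mul0r addr0 => /cvgrPdist_le/(_ _ e0) h.
have [x [hx x0]] : exists x, `|expR (- t * \tr E) - expR (- t * \tr E + x * `|t|)| <= e /\ 0 < x.
  have := filter_ex (filterI h (nbhs_right_gt (0 : R))).
  by move=> [x []]; exists x.
apply: le_trans (step _ x0) _.
move: hx; rewrite distrC ler_norml => /andP[_]; lra.
Qed.

Lemma leb_mxexp (E : 'M[R]_d) t (A : set V) : measurable A ->
  (leb [set x : V | A (mxexp (t *: E) *m x)] <= (expR (- t * \tr E))%:E * leb A)%E.
Proof.
move=> mA; rewrite (leb_linear hleb) ?mxexp_unit// lee_wpmul2r//.
by rewrite lee_fin kappa_mxexp.
Qed.

(** [kappa (-1)] is non-negative with square [kappa 1 = 1]. *)
Lemma leb_reflect (v : 'cV[R]_d) (A : set V) : measurable A ->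
  leb [set x : V | A (v - x)] = leb A.
Proof.
move=> mA.
have uN : (- 1%:M : 'M[R]_d) \in unitmx.
  have /mulmx1_unit[] : - 1%:M *m - 1%:M = 1%:M :> 'M[R]_d by rewrite mulmxN mulNmx mulmx1 opprK.
  by [].
have kN : kappa (- 1%:M) = 1.
  have : kappa (- 1%:M) * kappa (- 1%:M) = 1.
    by rewrite -(kappaM hleb)// mulmxN mulNmx mulmx1 opprK (kappa1 hleb).
  move/eqP; rewrite -expr2 sqrf_eq1 => /orP[/eqP //|/eqP h].
  by have := kappa_ge0 leb (- 1%:M); rewrite h; lra.
have mA' : measurable [set x : V | A (x + v)].
  by have := measurable_affine_preimage 1%:M v mA; under eq_set do rewrite mul1mx.
have := leb_linear hleb uN mA'; rewrite kN mul1e (leb_translate hleb)// => <-.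
by congr (leb _); apply/seteqP; split=> x /=; rewrite mulNmx mul1mx addrC.
Qed.

End lebesgue_exp.

(** * Integrals controlled by a homogeneous function *)

Lemma geometric_nneseries_lt (R : realType) (a z : R) : 0 <= a -> 0 < z -> z < 1 ->
  (\sum_(0 <= k <oo) (a * z ^+ k)%:E < +oo)%E.
Proof.
move=> a0 z0 z1; apply: (@le_lt_trans _ _ (a / (1 - z))%:E); last exact: ltry.
apply: lime_le.
  by apply: is_cvg_nneseries => k _ _; rewrite lee_fin mulr_ge0// exprn_ge0// ltW.
apply: nearW => k; rewrite sumEFin lee_fin.
by apply: geometric_le_lim => //; rewrite gtr0_norm.
Qed.

(** For the origin, which lies in all the sets of the dominating series: the series is infinite
    there, whatever value the integrand takes. *)
Lemma nneseries_cst_pinfty (R : realType) (u : nat -> R) (c : R) : 0 < c -> (forall k, c <= u k) ->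
  (\sum_(0 <= k <oo) (u k)%:E)%E = +oo%E.
Proof.
move=> c0 cu; apply/eqyP => A A0.
have u0 k : 0 <= u k by apply: le_trans (cu k); exact: ltW.
pose N := (Num.truncn (A / c)).+1.
apply: (@le_trans _ _ (\sum_(0 <= k < N) (u k)%:E)%E); last first.
  by apply: nneseries_lim_ge => k _ _; rewrite lee_fin.
rewrite sumEFin lee_fin; apply: (@le_trans _ _ (\sum_(0 <= k < N) c)).
  by rewrite sumr_const_nat subn0 -mulr_natl -ler_pdivrMr// ltW// truncnS_gt.
exact: ler_sum.
Qed.

Lemma integral_le_indic_series d (T : measurableType d) (R : realType)
  (mu : {measure set T -> \bar R}) (f : T -> R) (A B : nat -> set T) (a b : nat -> R) :
  measurable_fun setT f -> (forall x, 0 <= f x) ->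
  (forall k, measurable (A k)) -> (forall k, measurable (B k)) ->
  (forall k, 0 <= a k) -> (forall k, 0 <= b k) ->
  (forall x, (f x)%:E <= \sum_(0 <= k <oo) (a k * \1_(A k) x)%:E
                        + \sum_(0 <= k <oo) (b k * \1_(B k) x)%:E)%E ->
  (\int[mu]_x (f x)%:E <= \sum_(0 <= k <oo) ((a k)%:E * mu (A k))
                        + \sum_(0 <= k <oo) ((b k)%:E * mu (B k)))%E.
Proof.
move=> mf f0 mA mB a0 b0 hf.
have w0 (c : nat -> R) (C : nat -> set T) k x : (forall k, 0 <= c k) ->
    (0 <= (c k * \1_(C k) x)%:E)%E.
  by move=> c0; rewrite lee_fin mulr_ge0// ler0n.
have mw (c : nat -> R) (C : nat -> set T) k : measurable (C k) ->
    measurable_fun setT (fun x => (c k * \1_(C k) x)%:E).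
  by move=> mC; apply/measurable_EFinP; apply: measurable_funM => //; exact: measurable_indic.
have iw (c : nat -> R) (C : nat -> set T) : (forall k, 0 <= c k) -> (forall k, measurable (C k)) ->
    (\int[mu]_x (\sum_(0 <= k <oo) (c k * \1_(C k) x)%:E) =
     \sum_(0 <= k <oo) ((c k)%:E * mu (C k)))%E.
  move=> c0 mC; rewrite integral_nneseries//; last 2 first.
  - by move=> k; exact: mw.
  - by move=> k x _; exact: w0.
  apply: eq_eseriesr => k _; under eq_integral do rewrite EFinM.
  rewrite ge0_integralZl_EFin//; last by apply/measurable_EFinP; exact: measurable_indic.
  by rewrite integral_indic// setIT.
have msum (c : nat -> R) (C : nat -> set T) : (forall k, 0 <= c k) -> (forall k, measurable (C k)) ->
    measurable_fun setT (fun x => \sum_(0 <= k <oo) (c k * \1_(C k) x)%:E)%E.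
  move=> c0 mC; apply: ge0_emeasurable_sum => k *; first exact: w0.
  exact: mw.
have sum0 (c : nat -> R) (C : nat -> set T) x : (forall k, 0 <= c k) ->
   (0 <= \sum_(0 <= k <oo) (c k * \1_(C k) x)%:E)%E.
  by move=> c0; apply: nneseries_ge0 => k _ _; exact: w0.
rewrite -!iw// -ge0_integralD//; last 4 first.
- by move=> x _; exact: sum0.
- exact: msum.
- by move=> x _; exact: sum0.
- exact: msum.
apply: ge0_le_integral => //.
- by move=> x _; rewrite lee_fin.
- exact/measurable_EFinP.
- by apply: emeasurable_funD; exact: msum.
Qed.

Lemma nneseries_ge_term (R : realType) (w : nat -> R) k : (forall k, 0 <= w k) ->
  ((w k)%:E <= \sum_(0 <= j <oo) (w j)%:E)%E.
Proof.
move=> w0; apply: (@le_trans _ _ (\sum_(0 <= j < k.+1) (w j)%:E)%E).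
  by rewrite sumEFin lee_fin big_nat_recr//= lerDr sumr_ge0.
by apply: nneseries_lim_ge => j _ _; rewrite lee_fin.
Qed.

(** The extra [1] makes room for the open upper faces of the box. *)
Lemma box_ball (R : realType) d (K : R) (x : 'cV[R]_d) : `|x| <= K ->
  box (const_mx (- (K + 1))) (const_mx (K + 1)) x.
Proof.
move=> xK i; have := le_trans (mx_entry_le x i 0) xK; rewrite !mxE ler_norml => /andP[h1 h2].
apply/andP; split; first by apply: le_trans h1; rewrite lerN2 lerDl.
by apply: le_lt_trans h2 _; rewrite ltrDl.
Qed.

Lemma mxexp_mul_continuous (R : realType) n m (A : 'M[R]_n) (x : 'M[R]_(n, m)) i j :
  continuous (fun s : R => (mxexp (s *: A) *m x) i j).
Proof.
move=> t; rewrite (_ : (fun _ => _) = (fun s : R => (1%:M *m (mxexp (s *: A) *m x)) i j)).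
  apply: differentiable_continuous; apply/derivable1_diffP.
  by have [] := is_derive_mxexp_mul 1%:M A x t i j.
by apply/funext => s; rewrite mul1mx.
Qed.

Section homogeneous.
Variables (R : realType) (d : nat).
Hypothesis hd : (0 < d)%N.
Variables (E : 'M[R]_d) (phi : 'cV[R]_d -> R).
Hypothesis hE : forall r, eig_re E r -> 0 < r.
Hypothesis phi_cont : continuous phi.
Hypothesis phi_hom : E_homogeneous E phi.
Hypothesis phi_pos : forall x : 'cV[R]_d, x != 0 -> 0 < phi x.

Lemma phi_mxexp t x : x != 0 -> phi (mxexp (t *: E) *m x) = expR t * phi x.
Proof.
by move=> x0; have := phi_hom x0 (expR_gt0 t); rewrite /mxpow expRK.
Qed.

Let sq (x : 'cV[R]_d) : R := \sum_(i < d) x i 0 ^+ 2.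

Let sq_norm x : `|x| ^+ 2 <= sq x.
Proof.
have S0 : 0 <= sq x by apply: sumr_ge0 => i _; exact: sqr_ge0.
rewrite -[leRHS]sqr_sqrtr// ler_sqr ?nnegrE ?sqrtr_ge0//.
apply: mx_norm_le; first exact: sqrtr_ge0.
move=> i j; rewrite ord1 -sqrtr_sqr ler_sqrt// /sq (bigD1 i)//= lerDl sumr_ge0// => l _.
exact: sqr_ge0.
Qed.

Let sq_le x : sq x <= d%:R * `|x| ^+ 2.
Proof.
rewrite mulr_natl -[X in _ <= _ *+ X](card_ord d) -sumr_const; apply: ler_sum => i _.
by rewrite -(real_normK (num_real _)) ler_sqr ?nnegrE// mx_entry_le.
Qed.

(** Compactness of the Euclidean unit sphere; the minimum is taken over row vectors, where bounded
    closed sets are known to be compact, and carried back by transposition. *)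
Lemma phi_min_sphere : exists2 m : R, 0 < m & forall x, sq x = 1 -> m <= phi x.
Proof.
pose f (x : 'rV[R]_d) := phi x^T.
have cT : continuous (fun x : 'rV[R]_d => x^T).
  move=> x A /nbhs_ballP[e /= e0 eA]; apply/nbhs_ballP; exists e => //= y [_ xy].
  by apply: eA; split => // i j; rewrite !mxE; exact: xy.
have cf : continuous f by move=> x; apply: continuous_comp; [exact: cT|exact: phi_cont].
pose S : set 'rV[R]_d := [set x | sq x^T = 1].
have csq : continuous (fun x : 'rV[R]_d => sq x^T).
  move=> x; have FF : Filter (nbhs x) by exact: nbhs_filter.
  apply: (@cvg_sum_ord _ _ (nbhs x) FF) => i.
  rewrite (_ : (fun _ => _) = (fun x : 'rV[R]_d => (x 0 i) ^+ 2)); last first.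
    by apply/funext => y; rewrite mxE.
  by rewrite mxE; apply: cvgM; exact: coord_continuous.
have Sc : compact S.
  apply: bounded_closed_compact.
    exists 1; split => // c c1 x /= Sx.
    apply: le_trans (ltW c1); rewrite -(ler_sqr (x := `|x|)) ?nnegrE// expr1n.
    have := sq_norm x^T; rewrite Sx; apply: le_trans.
    rewrite ler_sqr ?nnegrE//; apply: mx_norm_le => // i j.
    by have := mx_entry_le x^T j i; rewrite mxE.
  rewrite (_ : S = (fun x : 'rV[R]_d => sq x^T) @^-1` [set 1])//.
  by apply: closed_comp => [x _|]; [exact: csq|exact: closed_eq].
have S0 : S !=set0.
  exists (delta_mx 0 (Ordinal hd)); rewrite /S /= /sq (bigD1 (Ordinal hd))//= big1.
    by rewrite !mxE !eqxx expr1n addr0.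
  by move=> i /negbTE i0; rewrite !mxE i0 andbF expr0n.
have [c cS cmin] := compact_EVT_min S0 Sc (continuous_subspaceT cf).
exists (f c).
  apply: phi_pos; apply: contraTneq cS => c0; rewrite notin_setE /S /= c0 /sq big1 => [/eqP|i _].
    by rewrite eq_sym oner_eq0.
  by rewrite mxE expr0n.
move=> x x1; rewrite -(trmxK x); apply: cmin.
by rewrite inE /S /= trmxK.
Qed.

(** A point [x] outside the Euclidean unit ball meets the sphere when it flows backward, at some
    time [t <= 0]. There [m <= phi = e^t phi x <= e^t], so [-t <= |ln m|], and flowing forward from
    the sphere during this bounded time reaches only bounded points. *)
Lemma phi_sublevel_bounded : exists2 K : R, 0 <= K & forall x, phi x <= 1 -> `|x| <= K.
Proof.
have [m m0 hm] := phi_min_sphere.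
have E0 : 0 < varpi E by apply: varpi_gt.
have [K1 K10 hK1] : exists2 K : R, 0 <= K & forall t, t <= 0 -> forall x : 'cV[R]_d,
    `|mxexp (t *: E) *m x| <= K * expR (varpi E / 2 * t) * `|x|.
  apply: mxexp_bound_neg => // e /varpi_le; lra.
have [r r0 rE] := eig_re_ub E.
have [K2 K20 hK2] := mxexp_bound hd rE.
exists (Num.max 1 (K2 * expR (r * `|ln m|))); first by rewrite le_max ler01.
move=> x phix; rewrite le_max.
have [|x1] := leP (sq x) 1.
  move=> /(le_trans (sq_norm x)); rewrite -[X in _ <= X](expr1n _ 2) ler_sqr ?nnegrE// => ->.
  by [].
apply/orP; right.
have xn0 : 0 < `|x|.
  rewrite normr_gt0; apply: contraTneq x1 => ->; rewrite /sq big1 ?ltNge ?ler01// => i _.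
  by rewrite mxE expr0n.
pose g t := sq (mxexp (t *: E) *m x).
have g0 : g 0 = sq x by rewrite /g scale0r mxexp0 mul1mx.
(* At time [T] the squared length is at most [d (K1 |x|)^2 exp (varpi E * T) <= 1]. The [+ 1] makes
   [c >= 1], so that [T <= 0]. *)
pose c := d%:R * (K1 * `|x|) ^+ 2 + 1.
have c1 : 1 <= c by rewrite lerDr mulr_ge0// sqr_ge0.
pose T := - (ln c / varpi E).
have T0 : T <= 0 by rewrite oppr_le0 divr_ge0// ?ln_ge0// ltW.
have gT : g T <= 1.
  apply: le_trans (sq_le _) _.
  apply: (@le_trans _ _ (d%:R * (K1 * expR (varpi E / 2 * T) * `|x|) ^+ 2)).
    by rewrite ler_wpM2l// ler_sqr ?nnegrE// ?hK1// !mulr_ge0// expR_ge0.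
  rewrite mulrAC exprMn -expRM_natl mulrA.
  have -> : 2 * (varpi E / 2) * T = - ln c by rewrite /T; field; rewrite gt_eqF.
  have c0 : 0 < c by exact: lt_le_trans c1.
  by rewrite expRN lnK ?posrE// mulrA ler_pdivrMr// mul1r lerDl.
have gc : continuous g.
  move=> t; apply: cvg_sum_ord => i.
  have h := @mxexp_mul_continuous _ _ _ E x i 0 t.
  exact: (cvgM h h).
have [t] : exists2 t, t \in `[T, 0] & g t = 1.
  apply: IVT => //; first exact: continuous_subspaceT.
  by rewrite ge_min gT/= le_max g0 (ltW x1) orbT.
rewrite in_itv/= => /andP[_ t0] gt1.
have xn : x != 0 by rewrite -normr_gt0.
have := hm _ gt1; rewrite phi_mxexp// => mt.
have {}mt : m <= expR t.
  by apply: le_trans mt _; rewrite ler_piMr// expR_ge0.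
have tm : - t <= `|ln m|.
  rewrite ler_normr; apply/orP; right.
  rewrite lerN2 -(expRK t) ler_ln ?posrE// ?expR_gt0//.
have y1 : `|mxexp (t *: E) *m x| <= 1.
  rewrite -(ler_sqr (y := 1)) ?nnegrE// expr1n -gt1; exact: sq_norm.
have -> : x = mxexp (- t *: E) *m (mxexp (t *: E) *m x).
  by rewrite mulmxA mxexpN_mul mul1mx.
have nt0 : 0 <= - t by rewrite oppr_ge0.
apply: le_trans (hK2 _ nt0 _) _.
apply: (@le_trans _ _ (K2 * expR (r * - t))).
  by rewrite ler_piMr// mulr_ge0// expR_ge0.
by rewrite ler_wpM2l// ler_expR ler_wpM2l// ltW.
Qed.

Variable leb : {measure set (Rvec R d) -> \bar R}.
Hypothesis hleb : is_lebesgue leb.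
Local Notation V := (Rvec R d).

(* The level sets [e^k <= phi < e^(k+1)] have measure of order [e^(k tr E)], so the
   integral is dominated by two geometric series. *)
Lemma integral_homogeneous_lt (f : V -> R) (C kap N : R) :
  measurable_fun setT f -> (forall x, 0 <= f x) ->
  0 < C -> 0 <= kap -> kap < \tr E -> \tr E < N ->
  (forall x : 'cV[R]_d, x != 0 -> phi x <= 1 -> f x <= C * expR (- kap * ln (phi x))) ->
  (forall x : 'cV[R]_d, x != 0 -> 1 <= phi x -> f x <= C * expR (- N * ln (phi x))) ->
  (\int[leb]_x (f x)%:E < +oo)%E.
Proof.
move=> mf f0 C0 kap0 kq qN fle1 fge1.
have [K K0 hK] := phi_sublevel_bounded.
pose Bx : set V := box (const_mx (- (K + 1))) (const_mx (K + 1)).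
have mBx : measurable Bx by exact: measurable_box.
pose vol : R := \prod_(i < d) (2 * (K + 1)).
have vol0 : 0 <= vol by rewrite prodr_ge0// => i _; rewrite mulr_ge0// addr_ge0.
have lebBx : leb Bx = vol%:E.
  rewrite hleb; first by congr EFin; apply: eq_bigr => i _; rewrite !mxE; ring.
  by move=> i; rewrite !mxE (@le_trans _ _ 0)// ?oppr_le0 addr_ge0.
(* [A s] contains the sublevel set [phi <= e^(-s)] and has measure at most [e^(-s tr E)] times that
   of a fixed box, so it can replace the shells. *)
pose A s : set V := [set x : V | Bx (mxexp (s *: E) *m x)].
have mA s : measurable (A s).
  have := measurable_affine_preimage (mxexp (s *: E)) 0 mBx.
  by under eq_set do rewrite addr0.
have lA s : (leb (A s) <= (expR (- s * \tr E) * vol)%:E)%E.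
  by rewrite EFinM -lebBx; exact: leb_mxexp.
have inA s x : x != 0 -> phi x <= expR (- s) -> A s x.
  move=> x0 px; apply: box_ball; apply: hK; rewrite phi_mxexp//.
  by apply: le_trans (ler_wpM2l (expR_ge0 _) px) _; rewrite -expRD subrr expR0.
have A0 s : A s 0.
  by apply: box_ball; rewrite mulmx0 normr0.
pose A1 k := A k%:R.
pose A2 k := A (- k.+1%:R).
(* [a k] bounds [C phi^(-kap)] where [-(k+1) < ln phi <= -k], and [b k] bounds [C phi^(-N)] where
   [k <= ln phi < k+1]; these regions lie in [A1 k] and [A2 k]. The resulting ratios are
   [e^(kap - tr E)] and [e^(tr E - N)]. *)
pose a k : R := C * expR (kap * k.+1%:R).
pose b k : R := C * expR (- N * k%:R).
have a0 k : 0 <= a k by rewrite mulr_ge0 ?expR_ge0// ltW.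
have b0 k : 0 <= b k by rewrite mulr_ge0 ?expR_ge0// ltW.
have i0 (w : nat -> R) (S : nat -> set V) (x : V) : (forall k, 0 <= w k) ->
    (0 <= \sum_(0 <= k <oo) (w k * \1_(S k) x)%:E)%E.
  by move=> w0; apply: nneseries_ge0 => k _ _; rewrite lee_fin mulr_ge0// ler0n.
have term (w : nat -> R) (S : nat -> set V) (x : V) k : (forall k, 0 <= w k) -> S k x ->
    ((w k)%:E <= \sum_(0 <= k <oo) (w k * \1_(S k) x)%:E)%E.
  move=> w0 Sk; rewrite [leLHS](_ : _ = (w k * \1_(S k) x)%:E).
    by apply: nneseries_ge_term => j; rewrite mulr_ge0// ler0n.
  by rewrite indicE mem_set// mulr1.
have key1 (y u v : \bar R) : u = +oo%E -> (0 <= v)%E -> (y <= u + v)%E.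
  by move=> ->; case: v => //= *; rewrite ?leey.
have key2 (y w u v : \bar R) : (y <= w -> w <= u -> 0 <= v -> y <= u + v)%E.
  by move=> yw wu v0; rewrite (le_trans yw)// (le_trans wu)// leeDl.
have key3 (y w u v : \bar R) : (y <= w -> w <= v -> 0 <= u -> y <= u + v)%E.
  by move=> yw wu v0; rewrite (le_trans yw)// (le_trans wu)// leeDr.
have hle : (\int[leb]_x (f x)%:E <= \sum_(0 <= k <oo) ((a k)%:E * leb (A1 k)) +
   \sum_(0 <= k <oo) ((b k)%:E * leb (A2 k)))%E.
  apply: (@integral_le_indic_series _ _ _ _ _ A1 A2) => // [k|k|].
  - exact: mA.
  - exact: mA.
  move=> x; have [x0|x0] := eqVneq (x : 'cV[R]_d) 0.
    have e : (\sum_(0 <= k <oo) (a k * \1_(A1 k) x)%:E = +oo)%E.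
      apply: (nneseries_cst_pinfty C0) => k.
      have Ax : A1 k x by rewrite x0; exact: A0.
      rewrite indicE mem_set// mulr1 ler_peMr ?(ltW C0)// -expR0 ler_expR.
      by rewrite mulr_ge0.
    exact: (key1 _ _ _ e (i0 b A2 x b0)).
  have p0 := phi_pos x0.
  have [p1|p1] := leP (phi x) 1.
    pose k := Num.truncn (- ln (phi x)).
    have lp : 0 <= - ln (phi x) by rewrite oppr_ge0 ln_le0.
    have /andP[k1 k2] : k%:R <= - ln (phi x) < k.+1%:R by exact: truncn_itv.
    apply: (key2 _ _ _ _ _ (term a A1 x k a0 _) (i0 b A2 x b0)).
      rewrite lee_fin (le_trans (fle1 _ x0 p1))// /a ler_wpM2l ?(ltW C0)//.
      by rewrite ler_expR mulNr -mulrN ler_wpM2l// ltW.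
    by apply: inA => //; rewrite -[leLHS]lnK ?posrE// ler_expR lerNr.
  pose k := Num.truncn (ln (phi x)).
  have lp : 0 <= ln (phi x) by rewrite ln_ge0// ltW.
  have /andP[k1 k2] : k%:R <= ln (phi x) < k.+1%:R by exact: truncn_itv.
  apply: (key3 _ _ _ _ _ (term b A2 x k b0 _) (i0 a A1 x a0)).
    rewrite lee_fin (le_trans (fge1 _ x0 (ltW p1)))//.
    have N0 : 0 <= N by rewrite (le_trans _ (ltW (lt_trans kq qN))).
    by rewrite /b ler_wpM2l ?(ltW C0)// ler_expR !mulNr lerN2 ler_wpM2l.
  by apply: inA => //; rewrite opprK -[leLHS]lnK ?posrE// ler_expR ltW.
have lAc s c : 0 <= c -> (c%:E * leb (A s) <= (c * (expR (- s * \tr E) * vol))%:E)%E.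
  by move=> c0; rewrite EFinM lee_wpmul2l// lee_fin.
apply: le_lt_trans hle _.
rewrite lte_add_pinfty//.
  apply: (@le_lt_trans _ _ (\sum_(0 <= k <oo) (C * expR kap * vol * expR (kap - \tr E) ^+ k)%:E)%E).
    apply: lee_nneseries => [k _|k _]; first by rewrite mule_ge0// lee_fin.
    apply: le_trans (lAc _ _ (a0 k)) _; rewrite lee_fin /a -expRM_natl -natr1 mulrDr mulr1 expRD.
    rewrite le_eqVlt; apply/orP; left; apply/eqP.
    rewrite mulrBr expRD mulNr [k%:R * kap]mulrC; ring.
  apply: geometric_nneseries_lt; [|exact: expR_gt0|].
    by rewrite !mulr_ge0// ?expR_ge0// ltW.
  by rewrite expR_lt1 subr_lt0.
apply: (@le_lt_trans _ _ (\sum_(0 <= k <oo) (C * expR (\tr E) * vol * expR (\tr E - N) ^+ k)%:E)%E).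
  apply: lee_nneseries => [k _|k _]; first by rewrite mule_ge0// lee_fin.
  apply: le_trans (lAc _ _ (b0 k)) _; rewrite lee_fin /b -expRM_natl opprK -natr1 mulrDl mul1r.
  rewrite le_eqVlt; apply/orP; left; apply/eqP.
  rewrite mulrBr !expRD mulNr [k%:R * N]mulrC; ring.
apply: geometric_nneseries_lt; [|exact: expR_gt0|].
  by rewrite !mulr_ge0// ?expR_ge0// ltW.
by rewrite expR_lt1 subr_lt0.
Qed.

End homogeneous.

(** * Independence and convergence in probability *)

Section bounded_measurable.
Context d (T : measurableType d) (R : realType) (P : probability T R).
Implicit Types f g : T -> R.

Definition bounded_mfun f := measurable_fun setT f /\ exists M : R, forall x, `|f x| <= M.

Lemma bounded_mfun_integrable f : bounded_mfun f -> P.-integrable setT (EFin \o f).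
Proof.
move=> [mf [M fM]]; apply: (@le_integrable _ _ _ _ _ _ _ (cst M%:E)) => //.
- exact/measurable_EFinP.
- move=> x _ /=; rewrite lee_fin (le_trans (fM x))//; exact: ler_norm.
- by apply: finite_measure_integrable_cst.
Qed.

Lemma bounded_mfunD f g : bounded_mfun f -> bounded_mfun g -> bounded_mfun (fun x => f x + g x).
Proof.
move=> [mf [M fM]] [mg [N gN]]; split; first exact: measurable_funD.
by exists (M + N) => x; rewrite (le_trans (ler_normD _ _))// lerD.
Qed.

Lemma bounded_mfunM f g : bounded_mfun f -> bounded_mfun g -> bounded_mfun (fun x => f x * g x).
Proof.
move=> [mf [M fM]] [mg [N gN]]; split; first exact: measurable_funM.
by exists (M * N) => x; rewrite normrM ler_pM.
Qed.

Lemma bounded_mfun_cst c : bounded_mfun (fun=> c).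
Proof. by split; [exact: measurable_cst|exists `|c|]. Qed.

Lemma bounded_mfunN f : bounded_mfun f -> bounded_mfun (fun x => - f x).
Proof.
move=> [mf [M fM]]; split; first exact: measurable_funN.
by exists M => x; rewrite normrN.
Qed.

Lemma bounded_mfun_indic (A : set T) : measurable A -> bounded_mfun \1_A.
Proof.
move=> mA; split; first exact: measurable_indic.
by exists 1 => x; rewrite indicE; case: (_ \in _); rewrite ?normr1 ?normr0.
Qed.

Lemma bounded_mfun_sum (I : Type) (r : seq I) (F : I -> T -> R) :
  (forall i, bounded_mfun (F i)) -> bounded_mfun (fun x => \sum_(i <- r) F i x).
Proof.
move=> hF; elim: r => [|i r IH].
  by under eq_fun do rewrite big_nil; exact: bounded_mfun_cst.
by under eq_fun do rewrite big_cons; exact: bounded_mfunD.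
Qed.

Definition mean f : R := Rintegral P setT f.

Lemma meanD f g : bounded_mfun f -> bounded_mfun g -> mean (fun x => f x + g x) = mean f + mean g.
Proof. by move=> hf hg; rewrite /mean RintegralD//; exact: bounded_mfun_integrable. Qed.

Lemma meanZ c f : bounded_mfun f -> mean (fun x => c * f x) = c * mean f.
Proof. by move=> hf; rewrite /mean RintegralZl//; exact: bounded_mfun_integrable. Qed.

Lemma meanN f : bounded_mfun f -> mean (fun x => - f x) = - mean f.
Proof.
by move=> hf; rewrite -mulN1r -meanZ//; congr mean; apply/funext => x; rewrite mulN1r.
Qed.

Lemma mean_cst c : mean (fun=> c) = c.
Proof. by rewrite /mean Rintegral_cst// [X in fine X]probability_setT mulr1. Qed.

Lemma mean_sum (I : Type) (r : seq I) (F : I -> T -> R) :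
  (forall i, bounded_mfun (F i)) -> mean (fun x => \sum_(i <- r) F i x) = \sum_(i <- r) mean (F i).
Proof.
move=> hF; elim: r => [|i r IH].
  by rewrite big_nil; under eq_fun do rewrite big_nil; exact: mean_cst.
rewrite big_cons -IH -meanD//; last exact: bounded_mfun_sum.
by congr mean; apply/funext => x; rewrite big_cons.
Qed.

Lemma mean_le f g : bounded_mfun f -> bounded_mfun g -> (forall x, f x <= g x) -> mean f <= mean g.
Proof. by move=> hf hg fg; apply: le_Rintegral => //; exact: bounded_mfun_integrable. Qed.

Lemma mean_norm_le f c : bounded_mfun f -> (forall x, `|f x| <= c) -> `|mean f| <= c.
Proof.
move=> hf fc; rewrite ler_norml; apply/andP; split.
  rewrite -[leLHS]mean_cst; apply: mean_le => //; first exact: bounded_mfun_cst.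
  by move=> x; have := fc x; rewrite ler_norml => /andP[].
rewrite -[leRHS]mean_cst; apply: mean_le => //; first exact: bounded_mfun_cst.
by move=> x; have := fc x; rewrite ler_norml => /andP[].
Qed.

Lemma mean_indic (A : set T) : measurable A -> mean \1_A = fine (P A).
Proof. by move=> mA; rewrite /mean /Rintegral integral_indic// setIT. Qed.

End bounded_measurable.

Section factorization.
Context d (T : measurableType d) (R : realType) (P : probability T R).
Context d' (V : measurableType d').

Lemma bounded_mfun_comp (h : V -> R) (X : T -> V) : measurable_fun setT X ->
  bounded_mfun h -> bounded_mfun (fun w => h (X w)).
Proof.
move=> mX [mh [M hM]]; split; first exact: (measurableT_comp mh).
by exists M.
Qed.

Lemma measurable_preimageT (X : T -> V) (S : set V) : measurable_fun setT X -> measurable S ->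
  measurable (X @^-1` S).
Proof. by move=> mX mS; rewrite -[X in measurable X]setTI; exact: mX. Qed.

(* [h] is uniformly approximated by combinations of indicators of its level sets. *)
Lemma mean_factor (X : T -> V) (W : T -> R) (al : R) : measurable_fun setT X ->
  bounded_mfun W ->
  (forall S, measurable S -> mean P (fun w => W w * \1_S (X w)) = al * fine (P (X @^-1` S))) ->
  forall h : V -> R, bounded_mfun h -> mean P (fun w => W w * h (X w)) = al * mean P (fun w => h (X w)).
Proof.
move=> mX hW hS.
have pos (h : V -> R) (M : R) : bounded_mfun h -> (forall v, 0 <= h v <= M) ->
    mean P (fun w => W w * h (X w)) = al * mean P (fun w => h (X w)).
  move=> hh hM; have [mW [C WC]] := hW.
  have C0 : 0 <= C by apply: le_trans (WC point).
  (* Rounding [h] down to multiples of [1/N] gives a step function [g] within [1/N] of it, for which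
     the identity is exact; the two sides for [h] then differ by at most [(C + |al|) / N]. *)
  suff key N : (0 < N)%N ->
      `|mean P (fun w => W w * h (X w)) - al * mean P (fun w => h (X w))| <= (C + `|al|) / N%:R.
    apply/eqP; rewrite -subr_eq0 -normr_le0; apply/ler_addgt0Pl => e e0; rewrite addr0.
    pose N := (Num.truncn ((C + `|al|) / e)).+1.
    have N0 : 0 < N%:R :> R by rewrite ltr0n.
    apply: le_trans (key N isT) _; rewrite ler_pdivrMr// mulrC -ler_pdivrMr//.
    by rewrite ltW// truncnS_gt.
  move=> N0; have Nr : 0 < N%:R :> R by rewrite ltr0n.
  pose L := (Num.truncn (M * N%:R)).+1.
  pose S (k : nat) : set V := [set v | Num.truncn (h v * N%:R) = k].
  have [mh _] := hh.
  have mS k : measurable (S k).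
    have -> : S k = (fun v => h v * N%:R) @^-1` (`[k%:R, k.+1%:R[%classic : set R).
      apply/seteqP; split=> v /=; rewrite in_itv /= => hv.
        have /andP[h0 _] := hM v; rewrite -hv; apply: truncn_itv.
        by rewrite mulr_ge0// ltW.
      exact: truncn_def.
    rewrite -[X in measurable X]setTI; apply: measurable_funM => //.
  pose g v : R := \sum_(k < L) (k%:R / N%:R) * \1_(S k) v.
  have gE v : g v = (Num.truncn (h v * N%:R))%:R / N%:R.
    have /andP[h0 h1] := hM v.
    have hL : (Num.truncn (h v * N%:R) < L)%N.
      by rewrite ltnS; apply: le_truncn; rewrite ler_wpM2r// ltW.
    rewrite /g (bigD1 (Ordinal hL))//= big1 ?addr0.
      by rewrite indicE mem_set ?mulr1.
    move=> i /eqP ne; rewrite indicE memNset ?mulr0// => Si; apply: ne.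
    by apply: val_inj; rewrite /= Si.
  have gh v : `|h v - g v| <= N%:R^-1.
    have /andP[h0 h1] := hM v; rewrite gE.
    have /andP[t1 t2] := truncn_itv (mulr_ge0 h0 (ltW Nr)).
    rewrite ger0_norm; last by rewrite subr_ge0 ler_pdivrMr.
    rewrite -(ler_pM2r Nr) mulrBl divfK ?gt_eqF// mulVf ?gt_eqF//.
    by rewrite lerBlDr addrC natr1 ltW.
  have hg : bounded_mfun g.
    apply: bounded_mfun_sum => k; apply: bounded_mfunM; first exact: bounded_mfun_cst.
    exact: bounded_mfun_indic.
  have hgX := bounded_mfun_comp mX hg; have hhX := bounded_mfun_comp mX hh.
  have geq : mean P (fun w => W w * g (X w)) = al * mean P (fun w => g (X w)).
    have hi k : bounded_mfun (fun w => \1_(S k) (X w) : R).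
      by apply: (@bounded_mfun_comp \1_(S k)) => //; exact: bounded_mfun_indic.
    rewrite (_ : (fun w => W w * g (X w)) =
      (fun w => \sum_(k < L) (k%:R / N%:R) * (W w * \1_(S k) (X w)))); last first.
      by apply/funext => w; rewrite /g mulr_sumr; apply: eq_bigr => k _; rewrite mulrCA.
    rewrite !mean_sum; last 2 first.
    - by move=> k; apply: bounded_mfunM => //; exact: bounded_mfun_cst.
    - move=> k; apply: bounded_mfunM; first exact: bounded_mfun_cst.
      exact: bounded_mfunM.
    rewrite mulr_sumr; apply: eq_bigr => k _.
    rewrite !meanZ//; last exact: bounded_mfunM.
    rewrite hS// mulrCA; congr (al * (_ * _)).
    rewrite -mean_indic; last exact: measurable_preimageT.
    by congr mean; apply/funext => w; rewrite !indicE.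
  have -> : mean P (fun w => W w * h (X w)) - al * mean P (fun w => h (X w)) =
      mean P (fun w => W w * (h (X w) - g (X w))) - al * mean P (fun w => h (X w) - g (X w)).
    have e1 : mean P (fun w => h (X w) - g (X w)) = mean P (fun w => h (X w)) - mean P (fun w => g (X w)).
      by rewrite -meanN// -meanD//; exact: bounded_mfunN.
    have e2 : mean P (fun w => W w * (h (X w) - g (X w))) =
       mean P (fun w => W w * h (X w)) - mean P (fun w => W w * g (X w)).
      rewrite -meanN; last exact: bounded_mfunM.
      rewrite -meanD; [|exact: bounded_mfunM|by apply: bounded_mfunN; exact: bounded_mfunM].
      by congr mean; apply/funext => w; rewrite mulrBr.
    by rewrite e1 e2 geq; ring.
  have hd : bounded_mfun (fun w => h (X w) - g (X w)) by apply: bounded_mfunD => //; exact: bounded_mfunN.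
  rewrite mulrDl (le_trans (ler_normB _ _))// lerD//.
    apply: mean_norm_le => [|w]; first exact: bounded_mfunM.
    by rewrite normrM ler_pM.
  by rewrite normrM ler_wpM2l//; apply: mean_norm_le.
move=> h hh; have [mh [M hM]] := hh.
have [mW _] := hW.
(* A signed [h] is shifted by its bound [M] to become non-negative. The shift cancels because [al]
   is the mean of [W], as the case of the whole space shows. *)
have h1 : bounded_mfun (fun v => h v + M) by apply: bounded_mfunD => //; exact: bounded_mfun_cst.
have := pos _ (M + M) h1; have hc c : bounded_mfun (fun=> c : R) by exact: bounded_mfun_cst.
have hhX := bounded_mfun_comp mX hh.
have e1 : mean P (fun w => W w * (h (X w) + M)) = mean P (fun w => W w * h (X w)) + M * mean P W.
  rewrite -meanZ// -meanD; [|exact: bounded_mfunM|exact: bounded_mfunM].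
  by congr mean; apply/funext => w; rewrite mulrDr [M * _]mulrC.
have e2 : mean P W = al.
  have := hS setT measurableT; rewrite preimage_setT [X in fine X]probability_setT mulr1 => <-.
  by congr mean; apply/funext => w; rewrite indicT mulr1.
rewrite e1 e2 meanD// mean_cst => H; apply: (addIr (M * al)).
rewrite H; first by rewrite mulrDr [al * M]mulrC.
move=> v; have := hM v; rewrite ler_norml => /andP[a b]; apply/andP; split.
  by rewrite -lerBlDr sub0r.
by rewrite lerD2r.
Qed.

End factorization.

Lemma realC_prod (R : realType) m (f : 'I_m -> R) :
  ((\prod_i f i)%:C)%C = \prod_i ((f i)%:C)%C.
Proof.
by apply: (big_morph (fun x : R => (x%:C)%C)) => // x y; exact: (rmorphM (@real_complex R)).
Qed.

Lemma fine_prod (R : realType) m (f : 'I_m -> \bar R) : (forall i, f i \is a fin_num) ->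
  fine (\prod_(i < m) f i)%E = \prod_(i < m) fine (f i).
Proof.
move=> hf; rewrite -[RHS]/(fine (EFin _)) (big_morph EFin (id1 := 1%E) (op1 := mule))//.
by congr fine; apply: eq_bigr => i _; rewrite fineK.
Qed.

Section complex_mean.
Context d (T : measurableType d) (R : realType) (P : probability T R).
Local Notation C := (R[i]).

Definition bounded_cmfun (Z : T -> C) :=
  bounded_mfun (fun w => complex.Re (Z w)) /\ bounded_mfun (fun w => complex.Im (Z w)).

Definition cmean (Z : T -> C) : C :=
  (mean P (fun w => complex.Re (Z w)) +i* mean P (fun w => complex.Im (Z w)))%C.

Lemma ReM (x y : C) : complex.Re (x * y) = complex.Re x * complex.Re y - complex.Im x * complex.Im y.
Proof. by case: x; case: y. Qed.

Lemma ImM (x y : C) : complex.Im (x * y) = complex.Re x * complex.Im y + complex.Im x * complex.Re y.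
Proof. by case: x; case: y. Qed.

Lemma bounded_cmfunM Z W : bounded_cmfun Z -> bounded_cmfun W -> bounded_cmfun (fun w => Z w * W w).
Proof.
move=> [Z1 Z2] [W1 W2]; split.
  rewrite (_ : (fun _ => _) = (fun w => complex.Re (Z w) * complex.Re (W w) +
     - (complex.Im (Z w) * complex.Im (W w)))); last by apply/funext => w; rewrite ReM.
  apply: bounded_mfunD; [exact: bounded_mfunM|apply: bounded_mfunN; exact: bounded_mfunM].
rewrite (_ : (fun _ => _) = (fun w => complex.Re (Z w) * complex.Im (W w) +
   complex.Im (Z w) * complex.Re (W w))); last by apply/funext => w; rewrite ImM.
by apply: bounded_mfunD; exact: bounded_mfunM.
Qed.

Lemma bounded_cmfun_prod (I : Type) (r : seq I) (Q : pred I) (F : I -> T -> C) :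
  (forall i, bounded_cmfun (F i)) -> bounded_cmfun (fun w => \prod_(i <- r | Q i) F i w).
Proof.
move=> hF; elim: r => [|i r IH].
  by under eq_fun do rewrite big_nil; split => /=; exact: bounded_mfun_cst.
under eq_fun do rewrite big_cons; case: (Q i) => //; exact: bounded_cmfunM.
Qed.

Lemma cmean_real (f : T -> R) : cmean (fun w => (f w)%:C%C) = ((mean P f)%:C)%C.
Proof. by rewrite /cmean /= mean_cst. Qed.

Context d' (V : measurableType d').

Lemma cmean_factor (X : T -> V) (Z : T -> C) (al : C) : measurable_fun setT X ->
  bounded_cmfun Z ->
  (forall S, measurable S -> cmean (fun w => Z w * ((\1_S (X w) : R)%:C)%C) = al * ((fine (P (X @^-1` S)))%:C)%C) ->
  forall h : V -> C, bounded_mfun (fun v => complex.Re (h v)) -> bounded_mfun (fun v => complex.Im (h v)) ->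
  cmean (fun w => Z w * h (X w)) = al * cmean (fun w => h (X w)).
Proof.
move=> mX [hZ1 hZ2] hS h h1 h2.
have R1 : forall S, measurable S ->
    mean P (fun w => complex.Re (Z w) * \1_S (X w)) = complex.Re al * fine (P (X @^-1` S)).
  move=> S mS; have /(congr1 (@complex.Re R)) := hS S mS.
  rewrite ReM /= mulr0 subr0 => <-; congr mean; apply/funext => w.
  by rewrite ReM /= mulr0 subr0.
have I1 : forall S, measurable S ->
    mean P (fun w => complex.Im (Z w) * \1_S (X w)) = complex.Im al * fine (P (X @^-1` S)).
  move=> S mS; have /(congr1 (@complex.Im R)) := hS S mS.
  rewrite ImM /= mulr0 add0r => <-; congr mean; apply/funext => w.
  by rewrite ImM /= mulr0 add0r.
have b1 := bounded_mfun_comp mX h1; have b2 := bounded_mfun_comp mX h2.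
have a11 := mean_factor mX hZ1 R1 h1; have a12 := mean_factor mX hZ1 R1 h2.
have a21 := mean_factor mX hZ2 I1 h1; have a22 := mean_factor mX hZ2 I1 h2.
apply/eqP; rewrite eq_complex; apply/andP; split; apply/eqP; rewrite ?ReM ?ImM /=.
  rewrite -a11 -a22 -meanN; last exact: bounded_mfunM.
  rewrite -meanD; [|exact: bounded_mfunM|by apply: bounded_mfunN; exact: bounded_mfunM].
  by congr mean; apply/funext => w; rewrite ReM.
rewrite -a12 -a21 -meanD; [|exact: bounded_mfunM|exact: bounded_mfunM].
by congr mean; apply/funext => w; rewrite ImM.
Qed.

Lemma cmean_prod m (X : 'I_m -> T -> V) : (forall i, measurable_fun setT (X i)) ->
  (forall Bs : 'I_m -> set V, (forall i, measurable (Bs i)) ->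
    P (\bigcap_(i in [set: 'I_m]) (X i @^-1` Bs i)) = (\prod_(i < m) P (X i @^-1` Bs i))%E) ->
  forall h : 'I_m -> V -> C,
    (forall i, bounded_mfun (fun v => complex.Re (h i v))) ->
    (forall i, bounded_mfun (fun v => complex.Im (h i v))) ->
  cmean (fun w => \prod_i h i (X i w)) = \prod_i cmean (fun w => h i (X i w)).
Proof.
move=> mX ind.
(* Indices below [k] carry arbitrary bounded functions, the others indicators. For [k = 0] this is
   the independence hypothesis; each step frees one index, by [cmean_factor] with the remaining
   product as weight. *)
suff key k : (k <= m)%N -> forall h : 'I_m -> V -> C,
    (forall i, bounded_mfun (fun v => complex.Re (h i v))) ->
    (forall i, bounded_mfun (fun v => complex.Im (h i v))) ->
    (forall i : 'I_m, (k <= i)%N -> exists2 S, measurable S & h i = (fun v => ((\1_S v : R)%:C)%C)) ->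
    cmean (fun w => \prod_i h i (X i w)) = \prod_i cmean (fun w => h i (X i w)).
  move=> h h1 h2; apply: (key m) => // i mi.
  by have := ltn_ord i; rewrite ltnNge mi.
elim: k => [|k IH] km h h1 h2 hk.
  have /choice[Bs hBs] i : exists S, measurable S /\ h i = (fun v => ((\1_S v : R)%:C)%C).
    by have [S mS hS] := hk i isT; exists S.
  have mB i : measurable (X i @^-1` Bs i) by apply: measurable_preimageT => //; have [] := hBs i.
  have eR i : (fun w => h i (X i w)) = (fun w => ((\1_(X i @^-1` Bs i) w : R)%:C)%C).
    by apply/funext => w; have [_ ->] := hBs i; rewrite !indicE.
  under [RHS]eq_bigr => i _.
    rewrite eR cmean_real mean_indic//.
    over.
  rewrite (_ : (fun w => _) = (fun w => ((\1_(\bigcap_(i in [set: 'I_m]) (X i @^-1` Bs i)) w : R)%:C)%C)).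
    rewrite cmean_real mean_indic; last exact: fin_bigcap_measurable.
    rewrite ind => [|i]; last by have [] := hBs i.
    by rewrite fine_prod ?realC_prod// => i; exact: fin_num_measure.
  apply/funext => w; rewrite indicE.
  under eq_bigr => i _ do rewrite (congr1 (fun f => f w) (eR i)).
  rewrite -realC_prod.
  congr (_%:C)%C; have [/set_mem wB|/negP wB] := boolP (w \in _).
    by rewrite big1// => i _; rewrite indicE mem_set//; exact: wB.
  have [i wi] : exists i, ~ (X i @^-1` Bs i) w.
    by apply/existsNP => H; apply: wB; rewrite inE => i _; exact: H.
  by rewrite (bigD1 i)//= indicE memNset// mul0r.
pose ik := Ordinal km.
rewrite (bigD1 ik)//= mulrC.
have hcm i : bounded_cmfun (fun w => h i (X i w)).
  by split; [exact: (bounded_mfun_comp (mX i) (h1 i))|exact: (bounded_mfun_comp (mX i) (h2 i))].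
transitivity (cmean (fun w => (\prod_(i < m | i != ik) h i (X i w)) * h ik (X ik w))).
  by congr cmean; apply/funext => w; rewrite (bigD1 ik)//= mulrC.
apply: cmean_factor => //; first exact: bounded_cmfun_prod.
move=> S mS.
pose h' (i : 'I_m) : V -> C := if i == ik then (fun v => ((\1_S v : R)%:C)%C) else h i.
have e w : \prod_i h' i (X i w) = (\prod_(i < m | i != ik) h i (X i w)) * ((\1_S (X ik w) : R)%:C)%C.
  rewrite (bigD1 ik)//= mulrC {2}/h' eqxx; congr (_ * _); apply: eq_bigr => i /negbTE ne.
  by rewrite /h' ne.
transitivity (cmean (fun w => \prod_i h' i (X i w))).
  by congr cmean; apply/funext => w; rewrite e.
rewrite (IH (ltnW km) h').
- rewrite (bigD1 ik)//= mulrC {2}/h' eqxx; congr (_ * _).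
    by apply: eq_bigr => i /negbTE ne; rewrite /h' ne.
  rewrite cmean_real -mean_indic; last exact: measurable_preimageT.
  by congr ((mean P _)%:C)%C; apply/funext => w; rewrite !indicE.
- by move=> i; rewrite /h'; case: eqP => _ //=; exact: bounded_mfun_indic.
- by move=> i; rewrite /h'; case: eqP => _ //=; exact: bounded_mfun_cst.
- move=> i; rewrite /h' leq_eqVlt => /orP[/eqP ki|ki].
    by rewrite (_ : i = ik) ?eqxx; [exists S|apply: val_inj].
  rewrite (_ : (i == ik) = false); first exact: hk.
  by apply/eqP => ii; rewrite ii /= ltnn in ki.
Qed.

End complex_mean.

Lemma dotv_mulmx (R : realType) n (u x : 'cV[R]_n) (Q : 'M[R]_n) :
  dotv u (Q *m x) = dotv (Q^T *m u) x.
Proof.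
rewrite /dotv; under eq_bigr do rewrite mxE mulr_sumr.
rewrite exchange_big /=; apply: eq_bigr => j _; rewrite mxE mulr_suml.
by apply: eq_bigr => i _; rewrite mxE mulrA [u i 0 * _]mulrC.
Qed.

Lemma dotv_sum (R : realType) n (u : 'cV[R]_n) m (x : 'I_m -> 'cV[R]_n) :
  dotv u (\sum_i x i) = \sum_i dotv u (x i).
Proof.
rewrite /dotv; under eq_bigr do rewrite summxE mulr_sumr.
by rewrite exchange_big.
Qed.

Lemma continuous_dotv (R : realType) n (u : 'cV[R]_n) : continuous (dotv u).
Proof.
move=> x; have FF : Filter (nbhs x) by exact: nbhs_filter.
apply: (@cvg_sum_ord _ _ (nbhs x) FF) => i.
by apply: cvgMr; exact: coord_continuous.
Qed.

Lemma measurable_dotv (R : realType) n (u : 'cV[R]_n) :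
  measurable_fun [set: Rvec R n] (fun x : Rvec R n => dotv u x).
Proof. by apply: continuous_measurable_rvec; exact: continuous_dotv. Qed.

Definition expi (R : realType) (t : R) : R[i] := (cos t +i* sin t)%C.

Lemma expiD (R : realType) (s t : R) : expi (s + t) = expi s * expi t.
Proof. by rewrite /expi cosD sinD; apply/eqP; rewrite eq_complex /= [sin s * _ + _]addrC !eqxx. Qed.

Lemma expi_sum (R : realType) m (t : 'I_m -> R) : expi (\sum_i t i) = \prod_i expi (t i).
Proof.
apply: (big_morph (@expi R)) => [s u|]; first exact: expiD.
by rewrite /expi cos0 sin0.
Qed.

Lemma bounded_mfun_cos d (T : measurableType d) (R : realType) (f : T -> R) :
  measurable_fun setT f -> bounded_mfun (fun w => cos (f w)).
Proof.
move=> mf; split; first by apply: measurableT_comp => //; apply: continuous_measurable_fun; exact: continuous_cos.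
by exists 1 => x; rewrite ler_norml cos_geN1 cos_le1.
Qed.

Lemma bounded_mfun_sin d (T : measurableType d) (R : realType) (f : T -> R) :
  measurable_fun setT f -> bounded_mfun (fun w => sin (f w)).
Proof.
move=> mf; split; first by apply: measurableT_comp => //; apply: continuous_measurable_fun; exact: continuous_sin.
by exists 1 => x; rewrite ler_norml sin_geN1 sin_le1.
Qed.

Lemma charfun_rvE dT (T : measurableType dT) (R : realType) (P : probability T R) n
  (X : T -> 'cV[R]_n) u : charfun_rv P X u = cmean P (fun w => expi (dotv u (X w))).
Proof. by []. Qed.

Lemma charfun_rv_indep dT (T : measurableType dT) (R : realType) (P : probability T R) n m
  (X : 'I_m -> T -> 'cV[R]_n) (Q : 'I_m -> 'M[R]_n) u :
  (forall i, measurable_fun setT (X i : T -> Rvec R n)) -> indep_rvecs P X ->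
  charfun_rv P (fun w => \sum_i Q i *m X i w) u = \prod_i charfun_rv P (X i) ((Q i)^T *m u).
Proof.
move=> mX ind; rewrite charfun_rvE.
under eq_fun => w.
  rewrite dotv_sum expi_sum.
  under eq_bigr do rewrite dotv_mulmx.
  over.
rewrite (@cmean_prod _ _ _ P _ (Rvec R n) m X mX ind (fun i v => expi (dotv ((Q i)^T *m u) v)))//.
- by move=> i; apply: bounded_mfun_cos; exact: measurable_dotv.
- by move=> i; apply: bounded_mfun_sin; exact: measurable_dotv.
Qed.

Lemma EFin_mean d (T : measurableType d) (R : realType) (P : probability T R) (f : T -> R) :
  bounded_mfun f -> ((mean P f)%:E = \int[P]_w (f w)%:E)%E.
Proof.
move=> hf; rewrite /mean /Rintegral fineK//.
exact: (integrable_fin_num measurableT (bounded_mfun_integrable P hf)).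
Qed.

(** * Tail probabilities from the characteristic function *)

Section truncation.
Context d (T : measurableType d) (R : realType) (P : probability T R).

Lemma integral_1Bcos (K x : R) : 0 < K -> x != 0 ->
  (\int[lebesgue_measure]_(t in `[0%R, K]) (1 - cos (t * x))%:E = (K - sin (K * x) / x)%:E)%E.
Proof.
move=> K0 x0.
pose F t := t - sin (t * x) / x.
have dF t : is_derive t (1 : R) F (1 - cos (t * x)).
  have h1 : is_derive t (1 : R) (fun s : R => s * x) x.
    have := is_derive_mulfun (is_derive_id t 1) (is_derive_cst x t 1).
    by rewrite mul1r mulr0 addr0.
  have h2 := is_derive1_comp (g := fun s : R => s * x) (is_derive_sin (t * x)) h1.
  have h3 := is_derive_mulfun h2 (is_derive_cst x^-1 t 1).
  have h4 := is_deriveB (is_derive_id t 1) h3.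
  apply: is_derive_eq.
  by rewrite mulr0 addr0 mulfK.
have cF : continuous F.
  by move=> t; apply: differentiable_continuous; apply/derivable1_diffP; have [] := dF t.
rewrite (@continuous_FTC2 _ _ F).
- by rewrite /F mul0r sin0 mul0r subr0 sube0.
- exact: K0.
- apply: continuous_subspaceT => t; apply: cvgB; first exact: cvg_cst.
  apply: continuous_comp; [apply: cvgMl; exact: cvg_id|exact: continuous_cos].
- split; [by move=> t _; have [] := dF t|exact/cvg_at_right_filter/cF|exact/cvg_at_left_filter/cF].
- by move=> t _; rewrite derive1E derive_val.
Qed.

(** The integral is [K - sin (K x) / x], and [1 / |x| <= K / 2]. *)
Lemma integral_1Bcos_ge (K x : R) : 0 < K -> 2 / K <= `|x| ->
  ((K / 2)%:E <= \int[lebesgue_measure]_(t in `[0%R, K]) (1 - cos (t * x))%:E)%E.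
Proof.
move=> K0 Kx.
have x0 : 0 < `|x| by apply: lt_le_trans Kx; rewrite divr_gt0.
rewrite integral_1Bcos//; last by rewrite -normr_gt0.
rewrite lee_fin.
have : `|sin (K * x) / x| <= K / 2.
  rewrite normrM normfV ler_pdivrMr//.
  apply: (@le_trans _ _ 1); first by rewrite ler_norml sin_geN1 sin_le1.
  apply: (@le_trans _ _ (K / 2 * (2 / K))).
    by rewrite mulrA mulfVK// divff// gt_eqF.
  by rewrite ler_wpM2l// divr_ge0// ltW.
rewrite ler_norml => /andP[_]; lra.
Qed.

(** Integrate [1 - cos (t X)] over [t] in [[0, K]] and over the probability space. In one order the
    result is at most [s K]; in the other, each outcome with [|X| >= 2 / K] contributes at least
    [K / 2]. *)
Lemma prob_ge_le_cos (X : T -> R) (K s : R) : measurable_fun setT X -> 0 < K ->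
  (forall t, 0 <= t <= K -> 1 - mean P (fun w => cos (t * X w)) <= s) ->
  (P [set w | (2 / K <= `|X w|)%R] <= (2 * s)%:E)%E.
Proof.
move=> mX K0 hs.
pose I : set R := `[0, K]%classic.
have mI : measurable I by exact: measurable_itv.
pose A := [set w | (2 / K <= `|X w|)%R].
have mA : measurable A.
  rewrite (_ : A = (fun w => `|X w|) @^-1` `[2 / K, +oo[%classic).
    by apply: measurable_preimageT; [exact: measurableT_comp|exact: measurable_itv].
  by apply/seteqP; split=> w /=; rewrite /A /= in_itv /= andbT.
pose f (z : R * T) : \bar R := ((1 - cos (z.1 * X z.2)) * \1_I z.1)%:E.
have c0 t w : 0 <= 1 - cos (t * X w) by rewrite subr_ge0 cos_le1.
have mf : measurable_fun setT f.
  apply/measurable_EFinP; apply: measurable_funM.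
    apply: measurable_funB => //; apply: measurableT_comp; first by apply: continuous_measurable_fun; exact: continuous_cos.
    apply: measurable_funM; first exact: measurable_fst.
    by apply: measurableT_comp => //; exact: measurable_snd.
  have mI1 : measurable_fun setT (\1_I : R -> R) by exact: measurable_indic.
  exact: (measurableT_comp mI1 measurable_fst).
have f0 z : (0 <= f z)%E by rewrite /f lee_fin mulr_ge0// ler0n.
have fub := fubini_tonelli (m1 := lebesgue_measure) (m2 := P) f mf f0.
have L : (\int[P]_w \int[lebesgue_measure]_t f (t, w) >= (K / 2)%:E * P A)%E.
  rewrite -[X in P X]setIT -integral_indic// -ge0_integralZl_EFin//; last 2 first.
  - by apply/measurable_EFinP; exact: measurable_indic.
  - by rewrite divr_ge0// ltW.
  apply: ge0_le_integral => //.
  - by move=> w _; rewrite mule_ge0// lee_fin ?ler0n// divr_ge0// ltW.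
  - apply/measurable_EFinP; apply: (@measurable_funM _ _ _ _ (fun=> K / 2) \1_A) => //.
  - exact: (measurable_fun_fubini_tonelli_G (m1 := lebesgue_measure) f mf f0).
  move=> w _; rewrite indicE; case: (boolP (w \in A)) => [/set_mem Aw|_]; last first.
    by rewrite mule0; apply: integral_ge0.
  rewrite mule1; apply: le_trans (integral_1Bcos_ge K0 Aw) _.
  rewrite integral_mkcond epatch_indic le_eqVlt; apply/orP; left; apply/eqP.
  by apply: eq_integral => t _; rewrite /f /= EFinM.
have s0 : 0 <= s.
  have := hs 0; rewrite lexx ltW// => /(_ isT).
  under eq_fun do rewrite mul0r cos0.
  by rewrite mean_cst subrr.
have bc t : bounded_mfun (fun w => cos (t * X w)).
  by apply: bounded_mfun_cos; exact: measurable_funM.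
have U : (\int[lebesgue_measure]_t \int[P]_w f (t, w) <= (s * K)%:E)%E.
  apply: (@le_trans _ _ (\int[lebesgue_measure]_t (s * \1_I t)%:E)%E).
    apply: ge0_le_integral => //.
    - by move=> t _; apply: integral_ge0 => w _.
    - exact: (measurable_fun_fubini_tonelli_F (m2 := P) f mf f0).
    - by apply/measurable_EFinP; apply: measurable_funM => //; exact: measurable_indic.
    move=> t _; rewrite /f /= -EFin_mean; last first.
      apply: bounded_mfunM; last exact: bounded_mfun_cst.
      by apply: bounded_mfunD; [exact: bounded_mfun_cst|exact: bounded_mfunN].
    rewrite lee_fin indicE; case: (boolP (t \in I)) => [/set_mem tI|_]; last first.
      by under eq_fun do rewrite mulr0; rewrite mean_cst mulr0.
    under eq_fun do rewrite mulr1.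
    rewrite mulr1 meanD; [|exact: bounded_mfun_cst|exact: bounded_mfunN].
    by rewrite mean_cst meanN// hs//; move: tI; rewrite /I /= in_itv.
  under eq_integral do rewrite EFinM.
  rewrite ge0_integralZl_EFin//; last first.
    by apply/measurable_EFinP; exact: measurable_indic.
  have lI : lebesgue_measure (`[0%R, K]%classic : set R) = K%:E.
    by rewrite lebesgue_measure_itv/= lte_fin K0 sube0.
  rewrite integral_indic// setIT.
  by rewrite -[leLHS]/(s%:E * lebesgue_measure (`[0%R, K]%classic : set R))%E lI EFinM.
have := le_trans L (eq_ind _ (fun z => (z <= _)%E) U _ fub).
have Pf := fin_num_measure P A mA.
rewrite -(fineK Pf) -EFinM !lee_fin => h.
have : K * fine (P A) <= K * (2 * s) by lra.
by rewrite ler_pM2l.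
Qed.

End truncation.

Lemma geometric_nneseries_le (R : realType) (a z : R) : 0 <= a -> 0 < z -> z < 1 ->
  (\sum_(0 <= k <oo) (a * z ^+ k)%:E <= (a / (1 - z))%:E)%E.
Proof.
move=> a0 z0 z1; apply: lime_le.
  by apply: is_cvg_nneseries => k _ _; rewrite lee_fin mulr_ge0// exprn_ge0// ltW.
apply: nearW => k; rewrite sumEFin lee_fin.
by apply: geometric_le_lim => //; rewrite gtr0_norm.
Qed.

Lemma cvg_geometric_increments (R : realType) (u : nat -> R) (c : R) : 0 <= c ->
  (forall k, `|u k.+1 - u k| <= c * (2^-1) ^+ k) ->
  exists2 y, u @ \oo --> y & forall k, `|u k - y| <= 2 * c * (2^-1) ^+ k.
Proof.
move=> c0 hu.
have h2 : `|2^-1 : R| < 1 by rewrite ger0_norm// invf_lt1// ltr1n.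
have cs : cvgn (series (fun k => u k.+1 - u k)).
  apply: normed_cvg; apply: (@series_le_cvg _ _ (geometric c 2^-1)) => //=.
  - by move=> k; rewrite mulr_ge0// exprn_ge0.
  - exact: is_cvg_geometric_series.
have cu : cvgn u.
  have -> : u = (fun n => series (fun k => u k.+1 - u k) n + u 0).
    apply/funext => n; rewrite /series /= telescope_sumr// ?subrK//.
  by apply: is_cvgD => //; exact: is_cvg_cst.
exists (limn u) => // k.
(* The factor [1 - 2^(-l)] is what lets the induction on [l] close. *)
have tail l : `|u k - u (k + l)%N| <= 2 * c * (2^-1) ^+ k * (1 - (2^-1) ^+ l).
  elim: l => [|l IH]; first by rewrite addn0 subrr normr0 expr0 subrr mulr0.
  have h := hu (k + l)%N; rewrite -addnS in h.
  have e : u k - u (k + l.+1)%N = (u k - u (k + l)%N) - (u (k + l.+1)%N - u (k + l)%N) by ring.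
  rewrite e (le_trans (ler_normB _ _))// (le_trans (lerD IH h))//.
  by rewrite exprD exprS le_eqVlt; apply/orP; left; apply/eqP; field.
have h0 : `|u k - u l| @[l --> \oo] --> `|u k - limn u|.
  by apply: cvg_norm; apply: cvgB => //; exact: cvg_cst.
rewrite -(cvg_lim _ h0)//; apply: limr_le; first exact: (cvgP _ h0).
near=> l; have kl : (k <= l)%N by near: l; exact: nbhs_infty_ge.
rewrite -(subnKC kl); apply: le_trans (tail _) _.
by rewrite ler_piMr ?mulr_ge0 ?exprn_ge0// gerBl exprn_ge0.
Unshelve. all: by end_near. Qed.

Section fast_cauchy.
Context d (T : measurableType d) (R : realType) (P : probability T R) (n : nat).
Local Notation V := (Rvec R n).

Lemma measurable_norm_gt (Z : T -> 'cV[R]_n) : (forall i, measurable_fun setT (fun w => Z w i 0)) ->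
  forall c : R, 0 <= c -> measurable [set w | c < `|Z w|].
Proof.
move=> mZ c c0; rewrite (_ : mkset _ = \bigcup_(i in [set: 'I_n]) [set w | c < `|Z w i 0|]).
  apply: fin_bigcup_measurable => // i _.
  rewrite (_ : mkset _ = (fun w => `|Z w i 0|) @^-1` `]c, +oo[%classic).
    by apply: measurable_preimageT; [exact: measurableT_comp|exact: measurable_itv].
  by apply/seteqP; split=> w /=; rewrite in_itv /= andbT.
apply/seteqP; split=> [w /= cw|w [i _] /= cw]; last by apply: lt_le_trans cw (mx_entry_le _ _ _).
apply: contrapT => H; move: cw; rewrite ltNge => /negP; apply.
apply: mx_norm_le => // i j; rewrite ord1 leNgt; apply/negP => h.
by apply: H; exists i.
Qed.

(** A quantitative Borel-Cantelli argument: outside [Bad j], of probability at most [2 C 2^(-j)],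
    all increments from rank [j] on are geometrically small, so the sequence converges there within
    [2 * 2^(-j)] of [X j]. *)
Lemma fast_cauchy_prob (X : nat -> T -> 'cV[R]_n) (C : R) : 0 <= C ->
  (forall j, measurable_fun setT (X j : T -> V)) ->
  (forall j, P [set w | ((2^-1) ^+ j < `|X j.+1 w - X j w|)%R] <= (C * (2^-1) ^+ j)%:E)%E ->
  exists Y : T -> 'cV[R]_n, measurable_fun setT (Y : T -> V) /\
    forall eps : R, 0 < eps -> P [set w | eps < `|X j w - Y w|] @[j --> \oo] --> 0%E.
Proof.
move=> C0 mX hP.
have mc j i : measurable_fun setT (fun w => X j w i 0) by exact: (measurable_rvec_coord i (mX j)).
(* An upper limit is measurable on the whole space, including where the sequence diverges; [fine]
   replaces infinite values by [0]. *)
pose Y w : 'cV[R]_n := \col_i fine (limn_esup (fun j => (X j w i 0)%:E)).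
have mYc i : measurable_fun setT (fun w => Y w i 0).
  rewrite (_ : (fun w => Y w i 0) = fine \o (fun w => limn_esup (fun j => (X j w i 0)%:E))).
    apply: measurableT_comp => //.
    by apply: measurable_fun_limn_esup => j; exact/measurable_EFinP.
  by apply/funext => w; rewrite mxE.
have mnorm := measurable_norm_gt.
have mD j : measurable [set w | (2^-1) ^+ j < `|X j.+1 w - X j w|].
  apply: mnorm; last by rewrite exprn_ge0.
  move=> i; rewrite (_ : (fun _ => _) = (fun w => X j.+1 w i 0 - X j w i 0)).
    exact: measurable_funB.
  by apply/funext => w; rewrite !mxE.
have mE j eps : 0 <= eps -> measurable [set w | eps < `|X j w - Y w|].
  apply: mnorm => i; rewrite (_ : (fun _ => _) = (fun w => X j w i 0 - Y w i 0)).
    exact: measurable_funB.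
  by apply/funext => w; rewrite !mxE.
pose bad j := [set w | (2^-1) ^+ j < `|X j.+1 w - X j w|].
pose Bad j := \bigcup_k bad (j + k)%N.
have mBad j : measurable (Bad j) by apply: bigcup_measurable => k _; exact: mD.
have PBad j : (P (Bad j) <= (2 * C * (2^-1) ^+ j)%:E)%E.
  apply: (@le_trans _ _ (\sum_(0 <= k <oo) P (bad (j + k)%N))%E).
    by apply: measure_sigma_subadditive => // k; exact: mD.
  apply: (@le_trans _ _ (\sum_(0 <= k <oo) (C * (2^-1) ^+ j * (2^-1) ^+ k)%:E)%E).
    apply: lee_nneseries => // k _; apply: le_trans (hP _) _.
    by rewrite lee_fin exprD mulrA.
  apply: le_trans (geometric_nneseries_le _ _ _) _ => //.
  - by rewrite mulr_ge0// exprn_ge0.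
  - by rewrite invf_lt1// ltr1n.
  by rewrite lee_fin le_eqVlt; apply/orP; left; apply/eqP; field.
have good j w : ~ Bad j w -> `|X j w - Y w| <= 2 * (2^-1) ^+ j.
  move=> nB; apply: mx_norm_le => [|i l]; first by rewrite mulr_ge0// exprn_ge0.
  rewrite ord1 mxE [(- Y w) i 0]mxE.
  have hk k : `|X (j + k).+1 w i 0 - X (j + k)%N w i 0| <= (2^-1) ^+ j * (2^-1) ^+ k.
    rewrite -exprD leNgt; apply/negP => h; apply: nB; exists k => //=.
    by apply: lt_le_trans h _; have := mx_entry_le (X (j + k).+1 w - X (j + k)%N w) i 0; rewrite !mxE.
  have c0 : 0 <= (2^-1 : R) ^+ j by rewrite exprn_ge0.
  have hk' k : `|(fun k => X (j + k)%N w i 0) k.+1 - (fun k => X (j + k)%N w i 0) k| <= (2^-1) ^+ j * (2^-1) ^+ k.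
    by rewrite /= addnS.
  have [y cy hy] := cvg_geometric_increments c0 hk'.
  have := hy 0%N; rewrite expr0 mulr1 addn0.
  suff -> : Y w i 0 = y by [].
  rewrite mxE (_ : limn_esup _ = y%:E)//.
  have cX : (fun k => X k w i 0) @ \oo --> y.
    by rewrite -(cvg_shiftn j); under eq_fun do rewrite addnC.
  have cXe : (fun k => (X k w i 0)%:E) @ \oo --> y%:E by apply: cvg_EFin => //; exact: nearW.
  by have [_ ->] := cvg_limn_einf_sup cXe.
exists Y; split; first exact: measurable_fun_rvec.
move=> eps eps0.
apply: (@squeeze_cvge _ _ _ _ (cst 0%E) _ (fun j => (2 * C * (2^-1) ^+ j)%:E)).
- near=> j; apply/andP; split; first exact: measure_ge0.
  apply: le_trans (PBad j); apply: le_measure; rewrite ?inE//.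
    by apply: mE; exact: ltW.
  move=> w /= epsw; apply: contrapT => /good; apply/negP; rewrite -ltNge; apply: lt_trans epsw.
  have : (2^-1 : R) ^+ j < eps / 2.
    near: j; have h2 : `|2^-1 : R| < 1 by rewrite ger0_norm// invf_lt1// ltr1n.
    have e2 : 0 < eps / 2 by rewrite divr_gt0.
    by have /cvgr_lt := cvg_expr h2; apply.
  lra.
- exact: cvg_cst.
- have h2 : `|2^-1 : R| < 1 by rewrite ger0_norm// invf_lt1// ltr1n.
  have : 2 * C * (2^-1) ^+ j @[j --> \oo] --> (2 * C * 0 : R) by apply: cvgMr; exact: cvg_expr.
  by rewrite mulr0 => h; apply: cvg_EFin => //; exact: nearW.
Unshelve. all: by end_near. Qed.

End fast_cauchy.

(** * Exponents of infinitely divisible laws *)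

Lemma mvt_bound0 (R : realType) (f df : R -> R) (K x : R) :
  (forall t, is_derive t (1 : R) f (df t)) -> (forall t, `|t| <= `|x| -> `|df t| <= K) ->
  `|f x - f 0| <= K * `|x|.
Proof.
move=> hf hK.
have cf : continuous f.
  by move=> t; apply: differentiable_continuous; apply/derivable1_diffP; have [] := hf t.
have [x0|x0] := leP 0 x.
  have [c] := MVT_segment x0 (fun t _ => hf t) (continuous_subspaceT cf).
  rewrite in_itv/= => /andP[c0 cx] ->; rewrite subr0 normrM ler_wpM2r//.
  by apply: hK; rewrite !ger0_norm.
have [c] := MVT_segment (ltW x0) (fun t _ => hf t) (continuous_subspaceT cf).
rewrite in_itv/= => /andP[xc c0]; rewrite distrC => ->; rewrite sub0r normrM normrN ler_wpM2r//.
by apply: hK; rewrite !ler0_norm ?lerN2// ltW.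
Qed.

Lemma norm_sin_le (R : realType) (x : R) : `|sin x| <= `|x|.
Proof.
have := @mvt_bound0 R sin cos 1 x; rewrite sin0 subr0 mul1r; apply => //.
by move=> t _; rewrite ler_norml cos_geN1 cos_le1.
Qed.

Lemma norm_cosB1_le (R : realType) (x : R) : `|cos x - 1| <= x ^+ 2.
Proof.
have := @mvt_bound0 R cos (fun t => - sin t) `|x| x; rewrite cos0 -expr2 real_normK ?num_real//.
apply => // t tx; rewrite normrN; exact: le_trans (norm_sin_le t) tx.
Qed.

Lemma norm_cosB1_le1 (R : realType) (x : R) : `|cos x - 1| <= `|x|.
Proof.
have := @mvt_bound0 R cos (fun t => - sin t) 1 x; rewrite cos0 mul1r.
by apply => // t _; rewrite normrN ler_norml sin_geN1 sin_le1.
Qed.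

Lemma norm_sinB_le (R : realType) (x : R) : `|sin x - x| <= x ^+ 2.
Proof.
have hd t : is_derive t (1 : R) (fun t => sin t - t) (cos t - 1).
  exact: (is_deriveB (is_derive_sin t) (is_derive_id t 1)).
have hb t : `|t| <= `|x| -> `|cos t - 1| <= `|x|.
  by move=> tx; exact: le_trans (norm_cosB1_le1 t) tx.
have := mvt_bound0 hd hb.
by rewrite sin0 !subr0 -expr2 real_normK ?num_real.
Qed.

Lemma dotv_ge0 (R : realType) n (x : 'cV[R]_n) : 0 <= dotv x x.
Proof. by apply: sumr_ge0 => i _; rewrite -expr2 sqr_ge0. Qed.

Lemma dotvZl (R : realType) n (c : R) (u x : 'cV[R]_n) : dotv (c *: u) x = c * dotv u x.
Proof. by rewrite /dotv mulr_sumr; apply: eq_bigr => i _; rewrite mxE mulrA. Qed.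

Lemma dotvZr (R : realType) n (c : R) (u x : 'cV[R]_n) : dotv u (c *: x) = c * dotv u x.
Proof. by rewrite /dotv mulr_sumr; apply: eq_bigr => i _; rewrite mxE mulrCA. Qed.

Lemma dotv0l (R : realType) n (x : 'cV[R]_n) : dotv 0 x = 0.
Proof. by rewrite /dotv big1// => i _; rewrite mxE mul0r. Qed.

Lemma dotv_norm_le (R : realType) n (u x : 'cV[R]_n) : `|dotv u x| <= n%:R * `|u| * `|x|.
Proof.
rewrite /dotv (le_trans (ler_norm_sum _ _ _))//.
rewrite -mulrA mulr_natl -[X in _ <= _ *+ X](card_ord n) -sumr_const; apply: ler_sum => i _.
by rewrite normrM ler_pM// mx_entry_le.
Qed.

Lemma dotv_sqr_le (R : realType) n (u x : 'cV[R]_n) : dotv u x ^+ 2 <= (n%:R * `|u|) ^+ 2 * dotv x x.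
Proof.
have xx : `|x| ^+ 2 <= dotv x x.
  rewrite -[leRHS]sqr_sqrtr ?dotv_ge0// ler_sqr ?nnegrE ?sqrtr_ge0//.
  apply: mx_norm_le; first exact: sqrtr_ge0.
  move=> i j; rewrite ord1 -sqrtr_sqr ler_sqrt ?dotv_ge0// /dotv (bigD1 i)//= -expr2 lerDl.
  by apply: sumr_ge0 => l _; rewrite -expr2 sqr_ge0.
rewrite -(real_normK (num_real (dotv u x))).
apply: (@le_trans _ _ ((n%:R * `|u| * `|x|) ^+ 2)).
  by rewrite ler_sqr ?nnegrE// ?dotv_norm_le// !mulr_ge0.
by rewrite exprMn ler_wpM2l// sqr_ge0.
Qed.

Lemma enorm_le1 (R : realType) n (x : 'cV[R]_n) : (enorm x <= 1) = (dotv x x <= 1).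
Proof. by rewrite /enorm -{1}sqrtr1 ler_sqrt. Qed.

Section levy.
Variables (R : realType) (n : nat).
Local Notation V := (Rvec R n).
Variable nu : {measure set V -> \bar R}.
Hypothesis hnu : levy_measure nu.

Definition lk_cos (u : 'cV[R]_n) (x : V) : R := cos (dotv u x) - 1.
Definition lk_sin (u : 'cV[R]_n) (x : V) : R :=
  sin (dotv u x) - dotv u x * ((enorm (x : 'cV[R]_n) <= 1)%R)%:R.
Definition lk_cut (x : V) : R := Num.min 1 (dotv (x : 'cV[R]_n) x).

Lemma measurable_dotvv : measurable_fun setT (fun x : V => dotv (x : 'cV[R]_n) x).
Proof.
by apply: measurable_sum => i; apply: measurable_funM; exact: measurable_coord.
Qed.

Lemma lk_cut_ge0 x : 0 <= lk_cut x.
Proof. by rewrite /lk_cut le_min ler01 dotv_ge0. Qed.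

Lemma lk_cut_integrable : nu.-integrable setT (EFin \o lk_cut).
Proof.
apply/integrableP; split.
  by apply/measurable_EFinP; apply: measurable_minr => //; exact: measurable_dotvv.
under eq_integral => x _ do rewrite /= ger0_norm ?lk_cut_ge0//.
by have [_] := hnu.
Qed.

(** One constant for both integrands of the exponent when [|u| <= c]: [2] serves the large jumps,
    and [(n c)^2] the small ones, where they are quadratic in [<u, x>]. *)
Definition lk_const (c : R) : R := 2 + (n%:R * c) ^+ 2.

Lemma lk_const_ge0 c : 0 <= lk_const c.
Proof. by rewrite addr_ge0// sqr_ge0. Qed.

Lemma lk_cos_le (u : 'cV[R]_n) c x : `|u| <= c -> `|lk_cos u x| <= lk_const c * lk_cut x.
Proof.
move=> uc; have cc : (n%:R * `|u|) ^+ 2 <= (n%:R * c) ^+ 2.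
  by rewrite ler_sqr ?nnegrE ?mulr_ge0 ?ler_wpM2l// (le_trans _ uc).
have c2 : 0 <= (n%:R * c) ^+ 2 by exact: sqr_ge0.
rewrite /lk_cut /lk_const; have [d1|d1] := leP 1 (dotv (x : 'cV[R]_n) x).
  rewrite mulr1; apply: (@le_trans _ _ 2); last by rewrite lerDl.
  rewrite ler_norml; have := cos_geN1 (dotv u x); have := cos_le1 (dotv u x).
  by rewrite /lk_cos => h1 h2; apply/andP; split; lra.
apply: le_trans (norm_cosB1_le _) _; apply: le_trans (dotv_sqr_le _ _) _.
rewrite ler_wpM2r ?dotv_ge0//; apply: le_trans cc _; rewrite lerDr//.
Qed.

Lemma lk_sin_le (u : 'cV[R]_n) c x : `|u| <= c -> `|lk_sin u x| <= lk_const c * lk_cut x.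
Proof.
move=> uc; have cc : (n%:R * `|u|) ^+ 2 <= (n%:R * c) ^+ 2.
  by rewrite ler_sqr ?nnegrE ?mulr_ge0 ?ler_wpM2l// (le_trans _ uc).
have c2 : 0 <= (n%:R * c) ^+ 2 by exact: sqr_ge0.
rewrite /lk_cut /lk_const /lk_sin enorm_le1; have [d1|d1] := leP (dotv (x : 'cV[R]_n) x) 1.
  rewrite mulr1.
  apply: le_trans (norm_sinB_le _) _; apply: le_trans (dotv_sqr_le _ _) _.
  by rewrite ler_wpM2r ?dotv_ge0//; apply: le_trans cc _; rewrite lerDr.
rewrite mulr0 subr0.
rewrite mulr1; apply: (@le_trans _ _ 2); last by rewrite lerDl.
by rewrite (@le_trans _ _ 1)// ?ler1n// ler_norml sin_geN1 sin_le1.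
Qed.

Lemma measurable_lk_cos u : measurable_fun setT (lk_cos u).
Proof.
apply: measurable_funB => //; apply: measurableT_comp; last exact: measurable_dotv.
by apply: continuous_measurable_fun; exact: continuous_cos.
Qed.

Lemma measurable_lk_sin u : measurable_fun setT (lk_sin u).
Proof.
apply: measurable_funB.
  apply: measurableT_comp; last exact: measurable_dotv.
  by apply: continuous_measurable_fun; exact: continuous_sin.
apply: measurable_funM; first exact: measurable_dotv.
pose S : set V := (fun x : V => dotv (x : 'cV[R]_n) x) @^-1` `]-oo, 1]%classic.
have mS : measurable S.
  by apply: measurable_preimageT; [exact: measurable_dotvv|exact: measurable_itv].
rewrite (_ : (fun _ => _) = \1_S); first exact: measurable_indic.
apply/funext => x; rewrite indicE enorm_le1; congr (_%:R); congr nat_of_bool.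
by apply/idP/idP => [h|/set_mem]; [apply/mem_set|]; rewrite /S /= in_itv.
Qed.

Lemma lk_bound_integrable c : nu.-integrable setT (EFin \o (fun x => lk_const c * lk_cut x)).
Proof.
have := integrableZl measurableT (lk_const c) lk_cut_integrable.
by apply: eq_integrable => // x _; rewrite /= EFinM.
Qed.

Lemma integrable_lk_cos u : nu.-integrable setT (EFin \o lk_cos u).
Proof.
apply: (le_integrable measurableT _ _ (lk_bound_integrable `|u|)).
  by apply/measurable_EFinP; exact: measurable_lk_cos.
move=> x _ /=; rewrite lee_fin [leRHS]ger0_norm ?mulr_ge0 ?lk_const_ge0 ?lk_cut_ge0//.
exact: lk_cos_le.
Qed.

Lemma integrable_lk_sin u : nu.-integrable setT (EFin \o lk_sin u).
Proof.
apply: (le_integrable measurableT _ _ (lk_bound_integrable `|u|)).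
  by apply/measurable_EFinP; exact: measurable_lk_sin.
move=> x _ /=; rewrite lee_fin [leRHS]ger0_norm ?mulr_ge0 ?lk_const_ge0 ?lk_cut_ge0//.
exact: lk_sin_le.
Qed.

Lemma Rintegral_lk_bounded c : exists L : R, forall u : 'cV[R]_n, `|u| <= c ->
  `|Rintegral nu setT (lk_cos u)| <= L /\ `|Rintegral nu setT (lk_sin u)| <= L.
Proof.
exists (Rintegral nu setT (fun x => lk_const c * lk_cut x)) => u uc.
have key f : nu.-integrable setT (EFin \o f) -> (forall x, `|f x| <= lk_const c * lk_cut x) ->
    `|Rintegral nu setT f| <= Rintegral nu setT (fun x => lk_const c * lk_cut x).
  move=> fi fle; apply: le_trans (le_normr_Rintegral measurableT fi) _.
  apply: le_Rintegral => //; last exact: lk_bound_integrable.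
  exact: integrable_norm fi.
split; apply: key; [exact: integrable_lk_cos|by move=> x; exact: lk_cos_le|
  exact: integrable_lk_sin|by move=> x; exact: lk_sin_le].
Qed.

(** Continuity is established along rays only, since two logarithms of the same characteristic
    function are compared along rays. *)
Lemma continuous_ray_integral (f : R -> V -> R) (g : 'cV[R]_n -> V -> R) u :
  (forall t, f t = g (t *: u)) ->
  (forall v, nu.-integrable setT (EFin \o g v)) ->
  (forall v c x, `|v| <= c -> `|g v x| <= lk_const c * lk_cut x) ->
  (forall x, continuous (f ^~ x)) ->
  continuous (fun t => Rintegral nu setT (f t)).
Proof.
move=> fg gi gle fc t.
have tI : t \in `]t - 1, t + 1[%classic.
  by rewrite inE /= in_itv /= ltrBlDr ltrDl ltr01.
apply: (@continuity_under_integral _ _ _ nu f setT measurableT (t - 1) (t + 1) _ _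
  (fun x => lk_const ((`|t| + 1) * `|u|) * lk_cut x)) => //.
- by move=> s _; rewrite fg.
- by apply: aeW => x _ s _; exact: fc.
- exact: lk_bound_integrable.
- move=> s; rewrite /= in_itv /= => /andP[s1 s2]; apply: aeW => x _; rewrite fg; apply: gle.
  rewrite normrZ ler_wpM2r//.
  have -> : s = t + (s - t) by ring.
  by rewrite (le_trans (ler_normD _ _))// lerD2l ler_norml; apply/andP; split; lra.
Qed.

Lemma continuous_lk_cos_ray u : continuous (fun t : R => Rintegral nu setT (lk_cos (t *: u))).
Proof.
apply: (@continuous_ray_integral (fun t => lk_cos (t *: u)) lk_cos u) => //.
- exact: integrable_lk_cos.
- by move=> v c x; exact: lk_cos_le.
- move=> x t; rewrite /lk_cos; apply: cvgB; last exact: cvg_cst.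
  under eq_cvg do rewrite dotvZl; rewrite dotvZl.
  by apply: continuous_comp; [apply: cvgMl; exact: cvg_id|exact: continuous_cos].
Qed.

Lemma continuous_lk_sin_ray u : continuous (fun t : R => Rintegral nu setT (lk_sin (t *: u))).
Proof.
apply: (@continuous_ray_integral (fun t => lk_sin (t *: u)) lk_sin u) => //.
- exact: integrable_lk_sin.
- by move=> v c x; exact: lk_sin_le.
- move=> x; rewrite (_ : (fun t => _) = (fun t : R => sin (t * dotv u x) -
      t * dotv u x * ((enorm (x : 'cV[R]_n) <= 1)%R)%:R)); last first.
    by apply/funext => t; rewrite /lk_sin dotvZl.
  move=> t.
  have cl : {for t, continuous (fun s : R => s * dotv u x)} by apply: cvgMl; exact: cvg_id.
  apply: cvgB; last by apply: cvgMl.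
  by apply: continuous_comp => //; exact: continuous_sin.
Qed.

Variables (a : 'cV[R]_n) (Q : 'M[R]_n).
Hypothesis Q0 : forall u : 'cV[R]_n, 0 <= dotv u (Q *m u).
Local Notation psi := (lk_exponent a Q nu).

Lemma lk_exponentE u : psi u =
  ((- (dotv u (Q *m u)) / 2 + Rintegral nu setT (lk_cos u)) +i*
   (dotv a u + Rintegral nu setT (lk_sin u)))%C.
Proof. by []. Qed.

Lemma Re_lk_le0 u : complex.Re (psi u) <= 0.
Proof.
rewrite lk_exponentE /=; have := Q0 u => h.
have : Rintegral nu setT (lk_cos u) <= 0.
  rewrite -[leRHS](_ : Rintegral nu setT (fun=> 0) = 0); last by rewrite /Rintegral integral0.
  apply: (le_Rintegral measurableT (integrable_lk_cos u) (integrable0 _ _)).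
  by move=> x _; rewrite subr_le0 cos_le1.
lra.
Qed.

Lemma lk_exponent0 : psi 0 = 0.
Proof.
rewrite lk_exponentE dotv0l.
have -> : lk_cos 0 = (fun=> 0) by apply/funext => x; rewrite /lk_cos dotv0l cos0 subrr.
have -> : lk_sin 0 = (fun=> 0) by apply/funext => x; rewrite /lk_sin dotv0l sin0 mul0r subrr.
have -> : Rintegral nu setT (fun=> 0) = 0 by rewrite /Rintegral integral0.
have -> : dotv a 0 = 0 by rewrite /dotv big1// => i _; rewrite mxE mulr0.
by rewrite oppr0 mul0r !addr0.
Qed.

Definition lk_size u : R := `|complex.Re (psi u)| + `|complex.Im (psi u)|.

Lemma lk_size_bounded c : exists2 L : R, 0 <= L & forall u : 'cV[R]_n, `|u| <= c -> lk_size u <= L.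
Proof.
have [L hL] := Rintegral_lk_bounded c.
exists (`|n%:R * c * (n%:R * `|Q| * c)| + `|n%:R * `|a| * c| + `|L| + `|L|).
  by rewrite !addr_ge0.
move=> u uc; have [h1 h2] := hL u uc; rewrite /lk_size lk_exponentE /=.
have h3 : `|- dotv u (Q *m u) / 2| <= `|n%:R * c * (n%:R * `|Q| * c)|.
  rewrite mulNr normrN normrM; apply: (@le_trans _ _ `|dotv u (Q *m u)|).
    by rewrite ler_piMr// ger0_norm// invf_le1// ler1n.
  apply: le_trans (dotv_norm_le _ _) _; apply: le_trans (ler_norm _).
  rewrite ler_pM ?mulr_ge0 ?ler_wpM2l//.
  by apply: le_trans (mulmx_norm _ _) _; rewrite ler_wpM2l// mulr_ge0.
have h4 : `|dotv a u| <= `|n%:R * `|a| * c|.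
  apply: le_trans (dotv_norm_le _ _) _; apply: le_trans (ler_norm _).
  by rewrite ler_wpM2l// mulr_ge0.
have := ler_normD (- dotv u (Q *m u) / 2) (Rintegral nu setT (lk_cos u)).
have := ler_normD (dotv a u) (Rintegral nu setT (lk_sin u)).
have := ler_norm L.
lra.
Qed.

Lemma continuous_Re_lk_ray u : continuous (fun t : R => complex.Re (psi (t *: u))).
Proof.
move=> t; apply: cvgD; last exact: continuous_lk_cos_ray.
apply: cvgMl; apply: cvgN.
rewrite -scalemxAr dotvZl dotvZr.
under eq_cvg do rewrite -scalemxAr dotvZl dotvZr.
by apply: cvgM; [exact: cvg_id|apply: cvgMl; exact: cvg_id].
Qed.

Lemma continuous_Im_lk_ray u : continuous (fun t : R => complex.Im (psi (t *: u))).
Proof.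
move=> t; apply: cvgD; last exact: continuous_lk_sin_ray.
rewrite dotvZr; under eq_cvg do rewrite dotvZr.
by apply: cvgMl; exact: cvg_id.
Qed.

Lemma lk_exponent_scale (c : R) (nuA : {measure set V -> \bar R}) u : 0 <= c ->
  (forall S, nuA S = (c%:E * nu S)%E) ->
  lk_exponent (c *: a) (c *: Q) nuA u = (c%:C)%C * psi u.
Proof.
move=> c0 hA.
have int f : nu.-integrable setT (EFin \o f) -> Rintegral nuA setT f = c * Rintegral nu setT f.
  move=> fi; have /integrableP[mf _] := fi.
  have pos g : measurable_fun setT g -> (forall x, (0 <= g x)%E) ->
      (\int[nuA]_x g x = c%:E * \int[nu]_x g x)%E.
    move=> mg g0; rewrite -(ge0_integral_mscale nu measurableT (NngNum c0) mg) => [|x _]; last exact: g0.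
    by apply: eq_measure_integral => A mA _; rewrite hA.
  rewrite /Rintegral integralE !pos;
    try (by move=> x; first [exact: funepos_ge0|exact: funeneg_ge0]);
    try by first [exact: measurable_funepos|exact: measurable_funeneg].
  rewrite [in RHS]integralE.
  have f1 := integrable_pos_fin_num measurableT fi.
  have f2 := integrable_neg_fin_num measurableT fi.
  by rewrite -(fineK f1) -(fineK f2) -!EFinM -!EFinB /= mulrBr.
rewrite /lk_exponent !int; [|exact: integrable_lk_sin|exact: integrable_lk_cos].
rewrite dotvZl -scalemxAl dotvZr.
by apply/eqP; rewrite eq_complex /= !mul0r subr0 addr0; apply/andP; split; apply/eqP; ring.
Qed.

End levy.

Lemma cexpD (R : realType) (x y : R[i]) : cexp (x + y) = cexp x * cexp y.
Proof.
case: x y => [a b] [c d]; rewrite /cexp /= expRD cosD sinD.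
by apply/eqP; rewrite eq_complex /=; apply/andP; split; apply/eqP; ring.
Qed.

Lemma cexp_sum (R : realType) m (x : 'I_m -> R[i]) : cexp (\sum_i x i) = \prod_i cexp (x i).
Proof.
apply: (big_morph (@cexp R)) => [s u|]; first exact: cexpD.
by rewrite /cexp /= expR0 cos0 sin0 mulr1 mulr0.
Qed.

(** Moduli identify the real parts, and the difference of the imaginary parts has cosine [1]
    everywhere. Were it nonzero somewhere, continuity would give it, in absolute value, some value
    in [(0, 1]], where the cosine is not [1]. *)
Lemma cexp_lift_unique (R : realType) (p1 p2 q1 q2 : R -> R) :
  continuous p1 -> continuous p2 -> continuous q1 -> continuous q2 ->
  p2 0 = q2 0 ->
  (forall t, cexp (p1 t +i* p2 t)%C = cexp (q1 t +i* q2 t)%C) ->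
  forall t, p1 t = q1 t /\ p2 t = q2 t.
Proof.
move=> cp1 cp2 cq1 cq2 e0 he.
have key t : p1 t = q1 t /\ cos (p2 t - q2 t) = 1.
  have [] := he t; move: (p1 t) (q1 t) (p2 t) (q2 t) => x y u v h1 h2.
  have sq (z w : R) : (expR z * cos w) ^+ 2 + (expR z * sin w) ^+ 2 = expR z ^+ 2.
    by rewrite !exprMn -mulrDr cos2Dsin2 mulr1.
  have xy : x = y.
    apply: expR_inj; apply/eqP; rewrite -(eqrXn2 (n := 2)) ?expR_ge0//.
    by rewrite -(sq x u) -(sq y v) h1 h2.
  split=> //; rewrite xy in h1 h2.
  have e1 : cos u = cos v by apply: (mulfI _ h1); rewrite gt_eqF// expR_gt0.
  have e2 : sin u = sin v by apply: (mulfI _ h2); rewrite gt_eqF// expR_gt0.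
  by rewrite cosB e1 e2 -!expr2 cos2Dsin2.
move=> t; split; first by have [] := key t.
apply/eqP; rewrite -subr_eq0; apply: contraT => dn0.
pose D s := `|p2 s - q2 s|.
have cD : continuous D.
  by move=> s; apply: cvg_norm; apply: cvgB; [exact: cp2|exact: cq2].
have D0 : D 0 = 0 by rewrite /D e0 subrr normr0.
have Dt : 0 < D t by rewrite /D normr_gt0.
have [s Ds] : exists s, D s = Num.min (D t) 1.
  have m0 : 0 <= Num.min (D t) 1 by rewrite le_min ler01 ltW.
  have m1 : Num.min (D t) 1 <= D t by rewrite ge_min lexx.
  have [t0|t0] := leP 0 t.
    have [s _ hs] : exists2 s, s \in `[0, t] & D s = Num.min (D t) 1.
      apply: IVT => //; first exact: continuous_subspaceT.
      by rewrite D0 ge_min m0 /= le_max m1 orbT.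
    by exists s.
  have [s _ hs] : exists2 s, s \in `[t, 0] & D s = Num.min (D t) 1.
    apply: IVT => //; [exact: ltW|exact: continuous_subspaceT|].
    by rewrite D0 ge_min m0 orbT /= le_max m1.
  by exists s.
have c1 : cos (D s) = 1.
  by rewrite /D; case: (ger0P (p2 s - q2 s)) => _; rewrite ?cosN; exact: (key s).2.
rewrite Ds in c1.
have m0 : 0 < Num.min (D t) 1 by rewrite lt_min Dt ltr01.
have m1 : Num.min (D t) 1 <= 1 by rewrite ge_min lexx orbT.
have := @cos_inj R (Num.min (D t) 1) 0; rewrite !in_itv /= lexx pi_ge0 (ltW m0) /=.
move=> /(_ _ isT); rewrite cos0 c1 (le_trans m1) //; last first.
  by apply: le_trans (pi_ge2 R); rewrite ler1n.
by move=> /(_ isT erefl) h; move: m0; rewrite h ltxx.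
Qed.

(** * The exponent of a full strictly operator-stable law *)

Section stable_exponent.
Variables (R : realType) (n : nat).
Hypothesis hn : (0 < n)%N.
Local Notation V := (Rvec R n).
Variables (mu : probability V R) (B : 'M[R]_n).
Variables (a : 'cV[R]_n) (Q : 'M[R]_n) (nu : {measure set V -> \bar R}).
Hypothesis hmu : has_levy_triplet (charfun mu) a Q nu.
Local Notation psi := (lk_exponent a Q nu).

(** Stability is stated with some continuous logarithm [psi0]. Along the ray of [u], both
    [e^t psi0 (s u)] and [psi (s v)], with [v = e^(tB) u], are continuous logarithms of one
    function, so they agree; [t = 0] then gives [psi0 = psi]. *)
Lemma lk_exponent_scaling : strictly_operator_stable mu B ->
  forall t u, psi (mxexp (t *: B) *m u) = ((expR t)%:C)%C * psi u.
Proof.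
move=> [_ [psi0 [[cRe cIm psi00 hpsi0] hs]]].
have [hnu _ _ hpsi] := hmu.
have key t u : ((expR t)%:C)%C * psi0 u = psi (mxexp (t *: B) *m u).
  set v := mxexp (t *: B) *m u.
  have cray (f : 'cV[R]_n -> R) : continuous f -> continuous (fun s : R => f (s *: u)).
    move=> cf s; apply: continuous_comp; last exact: cf.
    by apply: cvgZl; exact: cvg_id.
  have := @cexp_lift_unique R (fun s => expR t * complex.Re (psi0 (s *: u)))
    (fun s => expR t * complex.Im (psi0 (s *: u)))
    (fun s => complex.Re (psi (s *: v))) (fun s => complex.Im (psi (s *: v))).
  move=> /(_ _ _ _ _ _ _ 1); rewrite !scale1r => H.
  have [] := H.
  - by move=> s; apply: cvgMr; exact: (cray _ cRe).
  - by move=> s; apply: cvgMr; exact: (cray _ cIm).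
  - exact: continuous_Re_lk_ray.
  - exact: continuous_Im_lk_ray.
  - by rewrite !scale0r psi00 lk_exponent0 //= mulr0.
  - move=> s; have := hs (expR t) (expR_gt0 t) (s *: u).
    rewrite /mxpow expRK -scalemxAr -/v hpsi.
    by move: (psi0 _) (psi _) => [x y] [x' y'] /=; rewrite /cexp /= !mul0r subr0 addr0.
  case: (psi0 u) => x y; case: (psi v) => x' y' /= <- <-.
  by apply/eqP; rewrite eq_complex /= !mul0r subr0 addr0 !eqxx.
move=> t u; rewrite -key; congr (_ * _).
by have := key 0 u; rewrite expR0 scale0r mxexp0 mul1mx mul1r.
Qed.

(** If the characteristic function is [1] on the line of [u], the truncation inequality with [s = 0]
    makes [<u, X>] vanish almost surely, so the support lies in the hyperplane [<u, x> = 0]. *)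
Lemma charfun_ray_trivial u : full mu -> (forall t : R, psi (t *: u) = 0) -> u = 0.
Proof.
move=> mu_full hu; apply/eqP; apply: contraT => u0; exfalso.
have [hnu _ _ hpsi] := hmu.
apply: (mu_full u 0 u0) => x hx /=; apply/eqP; apply: contraT => c0; exfalso.
pose c := `|dotv u x|; have c_gt0 : 0 < c by rewrite normr_gt0.
pose U : set 'cV[R]_n := (fun y => `|dotv u y|) @^-1` `]c / 2, +oo[%classic.
have oU : open U.
  have cf : continuous (fun y : 'cV[R]_n => `|dotv u y|).
    move=> y; apply: (@continuous_comp _ _ _ (dotv u) (fun z : R => `|z|)).
      exact: continuous_dotv.
    exact: norm_continuous.
  by move/continuousP : cf; apply; exact: interval_open.
have Ux : U x by rewrite /U /= in_itv /= andbT -/c; lra.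
have := hx U oU Ux; apply/negP; rewrite -leNgt.
(* [K = 4 / c] makes the threshold [2 / K] equal to [c / 2], the one that defines [U]. *)
have K0 : 0 < 4 / c by rewrite divr_gt0.
have := @prob_ge_le_cos _ _ _ mu (fun y : V => dotv u y) (4 / c) 0 (measurable_dotv u) K0.
rewrite mulr0 => H; apply: (le_trans _ (H _)).
  apply: le_measure; rewrite ?inE.
  - exact: open_measurable_rvec.
  - rewrite (_ : [set w | _] = (fun y : V => `|dotv u y|) @^-1` `[2 / (4 / c), +oo[%classic).
      apply: measurable_preimageT; last exact: measurable_itv.
      by apply: measurableT_comp => //; exact: measurable_dotv.
    by apply/seteqP; split=> w /=; rewrite in_itv /= andbT.
  - move=> y; rewrite /U /= in_itv /= andbT => /ltW; apply: le_trans.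
    by rewrite le_eqVlt; apply/orP; left; apply/eqP; field; rewrite gt_eqF.
move=> t _; have := hpsi (t *: u); rewrite hu => /(congr1 (@complex.Re R)).
rewrite /cexp /= expR0 cos0 mulr1 => e.
suff -> : mean mu (fun w => cos (t * dotv u w)) = 1 by rewrite subrr.
by rewrite -e; congr mean; apply/funext => y; rewrite dotvZl.
Qed.

Hypothesis hstable : strictly_operator_stable mu B.
Hypothesis hfull : full mu.
Local Notation size := (lk_size nu a Q).

Lemma lk_size_scaling t u : size (mxexp (t *: B) *m u) = expR t * size u.
Proof.
rewrite /lk_size lk_exponent_scaling//; case: (psi u) => x y /=.
by rewrite !mul0r subr0 addr0 !normrM (ger0_norm (expR_ge0 t)) mulrDr.
Qed.

Lemma lk_size_eq0 u : size u = 0 -> psi u = 0.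
Proof.
rewrite /lk_size => /eqP; rewrite paddr_eq0// !normr_eq0.
by case: (psi u) => x y /= /andP[/eqP -> /eqP ->].
Qed.

(** On a bounded orbit the size stays bounded, yet it equals [e^t] times its initial value for all
    [t >= 0]. *)
Lemma lk_size_eq0_bounded_orbit u c : (forall t, 0 <= t -> `|mxexp (t *: B) *m u| <= c) ->
  forall s : R, psi (s *: u) = 0.
Proof.
move=> hc s; apply: lk_size_eq0; have [hnu _ _ _] := hmu.
have [L L0 hL] := @lk_size_bounded R n nu hnu a Q (`|s| * c).
have size0 : 0 <= size (s *: u) by rewrite addr_ge0.
apply/eqP; rewrite eq_le size0 andbT; apply/ler_addgt0Pl => e e0; rewrite addr0.
pose t := Num.max 0 (ln (L / e)).
have t0 : 0 <= t by rewrite le_max lexx.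
have h : expR t * size (s *: u) <= L.
  rewrite -lk_size_scaling; apply: hL; rewrite -scalemxAr normrZ.
  by rewrite ler_wpM2l// hc.
rewrite -(ler_pM2l (expR_gt0 t)); apply: le_trans h _.
have [->|L0'] := eqVneq L 0; first by rewrite mulr_ge0// ?expR_ge0// ltW.
have Lg : 0 < L by rewrite lt_def L0' L0.
rewrite -ler_pdivrMr// -[leLHS]lnK ?posrE ?divr_gt0// ler_expR.
by rewrite le_max lexx orbT.
Qed.

(* On the real span of an eigenvector with non-positive real part the flow of [B] is bounded,
   so there the exponent vanishes and the law is degenerate. *)
Lemma stable_eig_gt0 e : eig_re B e -> 0 < e.
Proof.
move=> Be; rewrite ltNge; apply/negP => e0.
have [u [v [b [uv Bu Bv]]]] := eig_re_vec Be.
pose sq (x : 'cV[R]_n) : R := \sum_(i < n) x i 0 ^+ 2.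
have sq_ge0 x : 0 <= sq x by apply: sumr_ge0 => i _; exact: sqr_ge0.
have sq_norm x : `|x| <= Num.sqrt (sq x).
  apply: mx_norm_le; first exact: sqrtr_ge0.
  move=> i j; rewrite ord1 -sqrtr_sqr ler_sqrt// /sq (bigD1 i)//= lerDl sumr_ge0// => l _.
  exact: sqr_ge0.
pose x t := mxexp (t *: B) *m u; pose y t := mxexp (t *: B) *m v.
pose N t := sq (x t) + sq (y t).
have dx t i : is_derive t (1 : R) (fun t => x t i 0) (e * x t i 0 - b * y t i 0).
  have := is_derive_mxexp_mul 1%:M B u t i 0.
  under eq_fun do rewrite mul1mx.
  rewrite mul1mx mulmxA (mxexp_comm t (erefl (B *m B))) -mulmxA Bu.
  by rewrite mulmxBr -!scalemxAr !mxE.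
have dy t i : is_derive t (1 : R) (fun t => y t i 0) (e * y t i 0 + b * x t i 0).
  have := is_derive_mxexp_mul 1%:M B v t i 0.
  under eq_fun do rewrite mul1mx.
  rewrite mul1mx mulmxA (mxexp_comm t (erefl (B *m B))) -mulmxA Bv.
  by rewrite mulmxDr -!scalemxAr !mxE.
(* The imaginary part [b] acts as a rotation and cancels in the sum of the two squared norms. *)
have dN t : is_derive t (1 : R) N (2 * e * N t).
  have sqd (f : R -> R) df : is_derive t (1 : R) f df ->
      is_derive t (1 : R) (fun u => f u ^+ 2) (2 * (f t * df)).
    move=> h; rewrite (_ : 2 * _ = df * f t + f t * df); last by ring.
    exact: (is_derive_mulfun h h).
  have h1 := is_derive_sum_ord (fun i => sqd _ _ (dx t i)).
  have h2 := is_derive_sum_ord (fun i => sqd _ _ (dy t i)).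
  have := is_deriveD h1 h2.
  rewrite -big_split /= (_ : \sum_(i < n) _ = 2 * e * N t)//.
  rewrite /N /sq -big_split /= mulr_sumr; apply: eq_bigr => i _; ring.
have Nle t : 0 <= t -> N t <= N 0.
  move=> t0; apply: le_trans (gronwall dN (fun s => lexx _) t0) _.
  rewrite ler_piMl ?addr_ge0// -expR0 ler_expR mulr_le0_ge0// mulr_ge0_le0//.
have bx t : 0 <= t -> `|x t| <= Num.sqrt (N 0).
  move=> t0; apply: le_trans (sq_norm _) _; rewrite ler_sqrt ?addr_ge0//.
  by apply: le_trans (Nle _ t0); rewrite lerDl.
have byy t : 0 <= t -> `|y t| <= Num.sqrt (N 0).
  move=> t0; apply: le_trans (sq_norm _) _; rewrite ler_sqrt ?addr_ge0//.
  by apply: le_trans (Nle _ t0); rewrite lerDr.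
have u0 := charfun_ray_trivial hfull (lk_size_eq0_bounded_orbit bx).
have v0 := charfun_ray_trivial hfull (lk_size_eq0_bounded_orbit byy).
by move: uv; rewrite u0 v0 !eqxx.
Qed.

(** Flow [u] for the time [t = - ln |u| / r]: it lands in a fixed ball, where the size is bounded by
    [L], and scaling back multiplies by [e^(-t) = |u|^(1/r)]. For [|u| >= 1] the time is negative
    and the rate [r1] below the spectrum applies; for [|u| < 1] it is positive and a rate [r2] above
    the spectrum applies, whence [p = 1 / r2]. *)
Lemma lk_size_growth r1 : 0 < r1 -> r1 < varpi B ->
  exists p L : R, [/\ 0 < p, p <= r1^-1, 0 <= L &
    forall u, size u <= L * (`|u| `^ p + `|u| `^ r1^-1)].
Proof.
move=> r10 r1B; have [hnu _ _ _] := hmu.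
have [r2 r20 hr2] := eig_re_ub B.
have [r12] : r1 < r2.
  have [e Be] := eig_re_nonempty B hn.
  by apply: lt_trans r1B _; apply: le_lt_trans (varpi_le Be) (hr2 _ Be).
have [K1 K10 hK1] : exists2 K : R, 0 <= K & forall t, t <= 0 -> forall x : 'cV[R]_n,
    `|mxexp (t *: B) *m x| <= K * expR (r1 * t) * `|x|.
  by apply: mxexp_bound_neg => // e /varpi_le; exact: lt_le_trans.
have [K2 K20 hK2] := mxexp_bound hn hr2.
have [L L0 hL] := @lk_size_bounded R n nu hnu a Q (Num.max K1 K2).
exists r2^-1, L; split => //.
- by rewrite invr_gt0.
- by rewrite lef_pV2 ?posrE// ltW.
move=> u; have [->|u0] := eqVneq u 0.
  rewrite /lk_size lk_exponent0//= !normr0 addr0 mulr_ge0// addr_ge0// powR_ge0.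
have un : 0 < `|u| by rewrite normr_gt0.
have gen r t : 0 < r -> t = - (ln `|u| / r) ->
    `|mxexp (t *: B) *m u| <= Num.max K1 K2 -> size u <= L * `|u| `^ r^-1.
  move=> r0 tE /hL; rewrite lk_size_scaling /powR gt_eqF//.
  rewrite -ler_pdivlMl ?expR_gt0// -expRN tE opprK mulrC.
  by rewrite [ln _ / r]mulrC.
have e1 (r t K : R) : 0 < r -> t = - (ln `|u| / r) -> K * expR (r * t) * `|u| = K.
  move=> r0 ->; rewrite mulrN mulrCA divff ?gt_eqF// mulr1 expRN lnK ?posrE//.
  by rewrite mulfVK// gt_eqF.
have [u1|u1] := leP 1 `|u|.
  apply: (@le_trans _ _ (L * `|u| `^ r1^-1)); last first.
    by rewrite ler_wpM2l// lerDr powR_ge0.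
  apply: (gen r1 _ r10 erefl); rewrite le_max; apply/orP; left.
  have := hK1 (- (ln `|u| / r1)); rewrite oppr_le0 divr_ge0 ?ln_ge0 ?(ltW r10)// => /(_ isT u).
  by rewrite e1.
apply: (@le_trans _ _ (L * `|u| `^ r2^-1)); last first.
  by rewrite ler_wpM2l// lerDl powR_ge0.
apply: (gen r2 _ r20 erefl); rewrite le_max; apply/orP; right.
have := hK2 (- (ln `|u| / r2)); rewrite oppr_ge0 ler_pdivrMr// mul0r ln_le0 ?(ltW u1)// => /(_ isT u).
by rewrite e1.
Qed.

End stable_exponent.

(** * Integrals of simple functions *)

Lemma Re_realM (R : realType) (c : R) (z : R[i]) : complex.Re ((c%:C)%C * z) = c * complex.Re z.
Proof. by case: z => x y /=; rewrite mul0r subr0. Qed.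

Lemma Im_realM (R : realType) (c : R) (z : R[i]) : complex.Im ((c%:C)%C * z) = c * complex.Im z.
Proof. by case: z => x y /=; rewrite mul0r addr0. Qed.

Lemma norm_Re_Im_realM (R : realType) (c : R) (z : R[i]) : 0 <= c ->
  `|complex.Re ((c%:C)%C * z)| + `|complex.Im ((c%:C)%C * z)| =
  c * (`|complex.Re z| + `|complex.Im z|).
Proof. by move=> c0; rewrite Re_realM Im_realM !normrM -mulrDr ger0_norm. Qed.

Lemma Re_sum (R : realType) m (z : 'I_m -> R[i]) :
  complex.Re (\sum_i z i) = \sum_i complex.Re (z i).
Proof. by apply: (big_morph (@complex.Re R)) => // -[? ?] [? ?]. Qed.

Lemma Im_sum (R : realType) m (z : 'I_m -> R[i]) :
  complex.Im (\sum_i z i) = \sum_i complex.Im (z i).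
Proof. by apply: (big_morph (@complex.Im R)) => // -[? ?] [? ?]. Qed.

(** Write [1 - e^x cos y = (1 - e^x) + e^x (1 - cos y)], with [e^x <= 1]. *)
Lemma subr1_Re_cexp (R : realType) (z : R[i]) : complex.Re z <= 0 ->
  1 - complex.Re (cexp z) <= `|complex.Re z| + `|complex.Im z|.
Proof.
case: z => x y /= x0; have e1 : expR x <= 1 by rewrite -expR0 ler_expR.
have e0 := expR_ge0 x; have h1 := expR_ge1Dx x.
have := norm_cosB1_le1 y; rewrite ler_norml => /andP[h2 _].
have h3 : 0 <= 1 - cos y by rewrite subr_ge0 cos_le1.
rewrite (ler0_norm x0); nra.
Qed.

Section random_measure.
Variables (R : realType) (d n : nat).
Context dT (T : measurableType dT) (P : probability T R).
Variable leb : {measure set (Rvec R d) -> \bar R}.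
Variable M : set (Rvec R d) -> T -> 'cV[R]_n.
Hypothesis hadd : forall As : nat -> set (Rvec R d),
  (forall i, fin_borel leb (As i)) -> trivIset setT As ->
  fin_borel leb (\bigcup_i As i) ->
  {ae P, forall w, series (fun i => M (As i) w) @ \oo --> M (\bigcup_i As i) w}.

Lemma fin_borel0 : fin_borel leb set0.
Proof. by split; [exact: measurable0|rewrite measure0 ltry]. Qed.

Lemma fin_borelI A B : measurable B -> fin_borel leb A -> fin_borel leb (B `&` A).
Proof.
move=> mB [mA lA]; split; first exact: measurableI.
by apply: le_lt_trans lA; apply: le_measure; rewrite ?inE//; exact: measurableI.
Qed.

(** Additivity along a sequence of empty sets gives a convergent series with constant terms. *)
Lemma random_measure0 : {ae P, forall w, M set0 w = 0}.
Proof.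
have := hadd (As := fun=> set0) (fun=> fin_borel0) (@trivIset_set0 _ _ _).
rewrite bigcup0//; move/(_ fin_borel0).
apply: filterS => w h.
have /cvg_series_cvg_0 h0 : cvgn (series (fun _ : nat => M set0 w)) by apply/cvg_ex; exists (M set0 w).
have h1 : (fun _ : nat => M set0 w) @ \oo --> M set0 w by exact: cvg_cst.
exact: (cvg_unique _ h1 h0).
Qed.

Lemma random_measure_fin_add m (A : 'I_m -> set (Rvec R d)) (U : set (Rvec R d)) :
  (forall i, fin_borel leb (A i)) -> (forall i j, i != j -> A i `&` A j = set0) ->
  fin_borel leb U -> (forall x, U x <-> exists i, A i x) ->
  {ae P, forall w, M U w = \sum_i M (A i) w}.
Proof.
move=> fA dA fU hU.
pose As (i : nat) : set (Rvec R d) := if insub i is Some j then A j else set0.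
have AsE (i : 'I_m) : As i = A i by rewrite /As valK.
have As0 i : (m <= i)%N -> As i = set0 by rewrite /As; case: insubP => // j; rewrite ltnNge => /negP.
have fAs i : fin_borel leb (As i) by rewrite /As; case: insubP => // _; exact: fin_borel0.
have tAs : trivIset setT As.
  apply/trivIsetP => i j _ _ ij; rewrite /As.
  case: insubP => [i' _ ei|_]; last by rewrite set0I.
  case: insubP => [j' _ ej|_]; last by rewrite setI0.
  by apply: dA; apply: contraNneq ij => e; rewrite -ei -ej e.
have eU : \bigcup_i As i = U.
  apply/seteqP; split=> x.
    move=> [i _]; rewrite /As; case: insubP => // j _ _ Ax.
    by apply/hU; exists j.
  by move=> /hU[i Ax]; exists (i : nat) => //; rewrite AsE.
have := hadd fAs tAs; rewrite eU => /(_ fU) h1.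
apply: filterS2 h1 random_measure0 => w h w0.
have h2 : series (fun i => M (As i) w) @ \oo --> \sum_i M (A i) w.
  apply: cvg_near_cst; exists m => // N /= mN.
  rewrite /series /= (@big_cat_nat _ _ _ m)//= big_mkord [X in _ + X]big_nat_cond.
  rewrite [X in _ + X]big1 ?addr0; first by apply: eq_bigr => i _; rewrite AsE.
  by move=> i /andP[/andP[mi _] _]; rewrite As0.
exact: (cvg_unique _ h h2).
Qed.

Variables (m : nat) (A : 'I_m -> set (Rvec R d)).
Hypothesis fA : forall i, fin_borel leb (A i).

Definition cell (x : Rvec R d) : {set 'I_m} := [set i | `[< A i x >]]%SET.
(* Empty for [S = set0]: the complement of the union may have infinite measure. *)
Definition atom (S : {set 'I_m}) : set (Rvec R d) := [set x | S != finset.set0 /\ cell x = S].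

Lemma fin_borel_atom S : fin_borel leb (atom S).
Proof.
have [->|S0] := eqVneq S finset.set0.
  rewrite (_ : atom _ = set0); first exact: fin_borel0.
  by apply/seteqP; split=> x //= [/eqP].
have [i Si] := set0Pn _ S0.
rewrite (_ : atom S = (\bigcap_(j in [set: 'I_m]) (if j \in S then A j else ~` A j)) `&` A i).
  apply: fin_borelI => //; apply: fin_bigcap_measurable => // j _.
  by case: ifP => _; [|apply: measurableC]; have [] := fA j.
apply/seteqP; split=> x /=.
  move=> [_ xS]; split=> [j _|].
    by case: ifPn; rewrite -xS inE => /asboolP.
  by move: Si; rewrite -xS inE => /asboolP.
move=> [h _]; split=> //; apply/setP => j; rewrite inE.
have := h j I; case: ifP => jS hj; first exact/asboolP.
by apply/asboolPn.
Qed.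

Local Notation N := #|{: {set 'I_m}}|.
Local Notation Sk k := (enum_val (k : 'I_N)).

Lemma atom_disjoint (k l : 'I_N) : k != l -> atom (Sk k) `&` atom (Sk l) = set0.
Proof.
move=> kl; apply/seteqP; split=> x //= [[_ e1] [_ e2]].
by move: kl; rewrite -(inj_eq (@enum_val_inj _ _)) -e1 -e2 eqxx.
Qed.

(** The sets [A i] may overlap, as happens for the difference of two simple functions. Independence
    holds only for disjoint sets, so the integral is rewritten over the atoms. *)
Lemma simple_int_atoms (Q : 'I_m -> 'M[R]_n) :
  {ae P, forall w, \sum_i Q i *m M (A i) w = \sum_k (\sum_(i in Sk k) Q i) *m M (atom (Sk k)) w}.
Proof.
have h i : {ae P, forall w, M (A i) w = \sum_k (if i \in Sk k then M (atom (Sk k)) w else 0)}.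
  pose D (k : 'I_N) : set (Rvec R d) := if i \in Sk k then atom (Sk k) else set0.
  have h1 : {ae P, forall w, M (A i) w = \sum_k M (D k) w}.
    apply: random_measure_fin_add => //.
    - by move=> k; rewrite /D; case: ifP => _; [exact: fin_borel_atom|exact: fin_borel0].
    - move=> k l kl; rewrite /D; case: ifP; case: ifP => _ _; rewrite ?set0I ?setI0//.
      exact: atom_disjoint.
    - move=> x; split.
        move=> Ax; have ix : i \in cell x by rewrite inE; exact/asboolP.
        exists (enum_rank (cell x)); rewrite /D enum_rankK ix; split=> //.
        by apply/set0Pn; exists i.
      by move=> [k]; rewrite /D; case: ifP => // + [_ e]; rewrite -e inE => /asboolP.
  apply: filterS2 h1 random_measure0 => w -> w0; apply: eq_bigr => k _.
  by rewrite /D; case: ifP => // _; rewrite w0.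
have {}h : {ae P, forall w, forall i, M (A i) w = \sum_k (if i \in Sk k then M (atom (Sk k)) w else 0)}.
  exact: filter_forall.
apply: filterS h => w h.
under eq_bigr => i _ do rewrite h mulmx_sumr.
rewrite exchange_big /=; apply: eq_bigr => k _.
rewrite mulmx_suml [RHS]big_mkcond; apply: eq_bigr => i _.
by case: ifP => // _; rewrite mulmx0.
Qed.

Variables (a : 'cV[R]_n) (C : 'M[R]_n) (nu : {measure set (Rvec R n) -> \bar R}).
Local Notation psi := (lk_exponent a C nu).
Hypothesis hcf : forall A, fin_borel leb A ->
  [/\ measurable_fun setT (M A : T -> Rvec R n),
      inf_div_cf (charfun_rv P (M A)) &
      exists nuA : {measure set (Rvec R n) -> \bar R},
        (forall S, nuA S = ((fine (leb A))%:E * nu S)%E) /\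
        has_levy_triplet (charfun_rv P (M A))
          (fine (leb A) *: a) (fine (leb A) *: C) nuA].
Hypothesis hind : forall m (As : 'I_m -> set (Rvec R d)),
  (forall i, fin_borel leb (As i)) ->
  (forall i j, i != j -> As i `&` As j = set0) ->
  indep_rvecs P (fun i => M (As i)).
Hypothesis hnu : levy_measure nu.
Hypothesis hC : forall u, 0 <= dotv u (C *m u).

Lemma charfun_random_measure D u : fin_borel leb D ->
  charfun_rv P (M D) u = cexp (((fine (leb D))%:C)%C * psi u).
Proof.
move=> fD; have [_ _ [nuD [nuE [_ _ _ ->]]]] := hcf fD.
congr cexp; rewrite (lk_exponent_scale hnu _ _ _ _ nuE) ?fine_ge0//.
Qed.

Lemma measurable_mulmx_rvec (X : T -> 'cV[R]_n) (Q : 'M[R]_n) :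
  measurable_fun setT (X : T -> Rvec R n) ->
  measurable_fun setT ((fun w => Q *m X w) : T -> Rvec R n).
Proof.
move=> mX; apply: measurable_fun_rvec => i.
under eq_fun do rewrite mxE.
apply: measurable_sum => j; apply: measurable_funM => //.
exact: measurable_rvec_coord.
Qed.

Lemma measurable_simple_int (Q : 'I_m -> 'M[R]_n) :
  measurable_fun setT ((fun w => \sum_i Q i *m M (A i) w) : T -> Rvec R n).
Proof.
apply: measurable_fun_rvec => l; under eq_fun do rewrite summxE.
apply: measurable_sum => i; apply: (@measurable_rvec_coord _ _ _ _ (fun w => Q i *m M (A i) w) l).
by apply: measurable_mulmx_rvec; have [] := hcf (fA i).
Qed.

Lemma charfun_simple_int (Q : 'I_m -> 'M[R]_n) u :
  charfun_rv P (fun w => \sum_i Q i *m M (A i) w) u =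
  cexp (\sum_k ((fine (leb (atom (Sk k))))%:C)%C * psi ((\sum_(i in Sk k) Q i)^T *m u)).
Proof.
have mat (k : 'I_N) : measurable_fun setT (M (atom (Sk k)) : T -> Rvec R n).
  by have [] := hcf (fin_borel_atom (Sk k)).
transitivity (charfun_rv P (fun w => \sum_k (\sum_(i in Sk k) Q i) *m M (atom (Sk k)) w) u).
  have mX := measurable_simple_int Q.
  have mY : measurable_fun setT
      ((fun w => \sum_k (\sum_(i in Sk k) Q i) *m M (atom (Sk k)) w) : T -> Rvec R n).
    apply: measurable_fun_rvec => l; under eq_fun do rewrite summxE.
    apply: measurable_sum => k.
    apply: (@measurable_rvec_coord _ _ _ _ (fun w => (\sum_(i in Sk k) Q i) *m M (atom (Sk k)) w) l).
    exact: measurable_mulmx_rvec.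
  have h (f : R -> R) : continuous f ->
      Rintegral P setT (fun w => f (dotv u (\sum_i Q i *m M (A i) w))) =
      Rintegral P setT (fun w => f (dotv u (\sum_k (\sum_(i in Sk k) Q i) *m M (atom (Sk k)) w))).
    move=> cf; rewrite /Rintegral; congr fine.
    have mf (X : T -> Rvec R n) : measurable_fun setT X ->
        measurable_fun setT (fun w => (f (dotv u (X w)))%:E).
      move=> mXX; apply/measurable_EFinP; apply: measurableT_comp.
        exact: continuous_measurable_fun.
      exact: (measurableT_comp (measurable_dotv u) mXX).
    apply: ae_eq_integral => //; [exact: mf|exact: mf|].
    by apply: filterS (simple_int_atoms Q) => w /= -> _.
  rewrite /charfun_rv; congr (_ +i* _)%C; apply: h; [exact: continuous_cos|exact: continuous_sin].
rewrite charfun_rv_indep//; last first.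
  by apply: hind => [k|k l kl]; [exact: fin_borel_atom|exact: atom_disjoint].
rewrite cexp_sum; apply: eq_bigr => k _.
by rewrite charfun_random_measure//; exact: fin_borel_atom.
Qed.

Variable G : R -> R.
Hypothesis G_ge0 : forall r, 0 <= r -> 0 <= G r.
Hypothesis G_mono : forall r s, 0 <= r -> r <= s -> G r <= G s.
Hypothesis psi_le_G : forall u, lk_size nu a C u <= G `|u|.

(** The sum is the integral of [G (c |F|)] over the union of the atoms. It is compared with a
    majorant [h] because the later bound is a sum of two approximation errors. *)
Lemma atom_sum_le_integral (Q : 'I_m -> 'M[R]_n) c (h : Rvec R d -> R) : 0 <= c ->
  measurable_fun setT h ->
  (forall x, G (c * `|simple_fun A Q x|) <= h x) ->
  ((\sum_(k < N) fine (leb (atom (Sk k))) * G (c * `|(\sum_(i in Sk k) Q i : 'M[R]_n)|))%:E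
    <= \int[leb]_x (h x)%:E)%E.
Proof.
move=> c0 mh hh.
have matom k : measurable (atom (Sk k)) by have [] := fin_borel_atom (Sk k).
pose g k : R := G (c * `|(\sum_(i in Sk k) Q i : 'M[R]_n)|).
have g0 k : 0 <= g k by apply: G_ge0; rewrite mulr_ge0.
have h0 x : 0 <= h x by apply: le_trans (hh x); rewrite G_ge0// mulr_ge0.
have e : (\sum_(k < N) fine (leb (atom (Sk k))) * g k)%:E =
    (\int[leb]_x (\sum_(k < N) (g k * \1_(atom (Sk k)) x)%:E))%E.
  rewrite ge0_integral_sum//; last 2 first.
  - move=> k; apply/measurable_EFinP; apply: measurable_funM => //.
  - by move=> k x _; rewrite lee_fin mulr_ge0// indicE.
  rewrite -sumEFin; apply: eq_bigr => k _.
  under eq_integral do rewrite EFinM.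
  rewrite ge0_integralZl_EFin//; last exact/measurable_EFinP.
  rewrite integral_indic// setIT -[leb _]fineK; first by rewrite -EFinM mulrC.
  rewrite ge0_fin_numE//.
  by have [] := fin_borel_atom (Sk k).
rewrite e; apply: ge0_le_integral => //.
- by move=> x _; apply: sume_ge0 => k _; rewrite lee_fin mulr_ge0// indicE.
- apply: emeasurable_sum => k; apply/measurable_EFinP; exact: measurable_funM.
- exact/measurable_EFinP.
move=> x _; rewrite sumEFin lee_fin.
(* Only the atom of the cell of [x] can contain [x], so one term of the sum survives at most. *)
pose k0 := enum_rank (cell x).
rewrite (bigD1 k0)//= big1 ?addr0; last first.
  move=> k kk0; rewrite indicE memNset ?mulr0//= => -[_ e1]; move/negP: kk0; apply.
  by rewrite /k0 e1 enum_valK.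
rewrite indicE; case: (boolP (x \in _)) => [_|_]; last by rewrite mulr0.
rewrite mulr1; apply: le_trans (hh x); rewrite /g /k0 enum_rankK.
rewrite le_eqVlt; apply/orP; left; apply/eqP; congr (G (c * `|_|)).
rewrite /simple_fun [LHS]big_mkcond; apply: eq_bigr => i _.
by rewrite inE.
Qed.

(** The truncation inequality with [u = t e_l]: as [|u| <= K], [|F^T u| <= n K |F|], which explains
    the constant in the hypothesis on [h]. *)
Lemma prob_simple_int_coord (Q : 'I_m -> 'M[R]_n) K s (h : Rvec R d -> R) l : 0 < K ->
  measurable_fun setT h ->
  (forall x, G (n%:R * K * `|simple_fun A Q x|) <= h x) ->
  (\int[leb]_x (h x)%:E <= s%:E)%E ->
  (P [set w | (2 / K <= `|(\sum_i Q i *m M (A i) w) l 0|)%R] <= (2 * s)%:E)%E.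
Proof.
move=> K0 mh hh hs.
apply: prob_ge_le_cos => //.
  exact: (measurable_rvec_coord l (measurable_simple_int Q)).
move=> t /andP[t0 tK].
pose u : 'cV[R]_n := t *: delta_mx l 0.
have un : `|u| <= K.
  apply: mx_norm_le => [|i j]; first exact: ltW.
  rewrite /u !mxE normrM (ger0_norm t0); case: (_ && _) => /=; last by rewrite normr0 mulr0 ltW.
  by rewrite normr1 mulr1.
have eu x : dotv u x = t * x l 0.
  rewrite /u dotvZl /dotv (bigD1 l)//= mxE !eqxx mul1r big1 ?addr0// => i il.
  by rewrite mxE (negbTE il) mul0r.
have := charfun_simple_int Q u => /(congr1 (@complex.Re R)) /=.
under eq_Rintegral do rewrite eu.
rewrite -/(mean P _) => ->.
have ReE k : complex.Re (((fine (leb (atom (Sk k))))%:C)%C * psi ((\sum_(i in Sk k) Q i)^T *m u)) <= 0.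
  by rewrite Re_realM mulr_ge0_le0 ?fine_ge0// Re_lk_le0.
apply: le_trans (subr1_Re_cexp _) _; first by rewrite Re_sum sumr_le0.
have nK0 : 0 <= n%:R * K by rewrite mulr_ge0// ltW.
have := le_trans (atom_sum_le_integral nK0 mh hh) hs; rewrite lee_fin; apply: le_trans.
rewrite Re_sum Im_sum.
apply: le_trans (lerD (ler_norm_sum _ _ _) (ler_norm_sum _ _ _)) _.
rewrite -big_split; apply: ler_sum => k _.
rewrite [leLHS](norm_Re_Im_realM _ (fine_ge0 (measure_ge0 leb _))).
apply: ler_wpM2l; first exact: fine_ge0.
apply: le_trans (psi_le_G _) _; apply: G_mono => //.
apply: le_trans (mulmx_norm _ _) _.
rewrite -!mulrA; apply: ler_wpM2l => //; rewrite mulrC; apply: ler_pM => //.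
by apply: mx_norm_le => // i j; rewrite mxE mx_entry_le.
Qed.

End random_measure.

(** * Approximation by simple functions *)

Section quantization.
Variable R : realType.

Definition dyadic_val j (s : bool) (k : nat) : R := (-1) ^+ s * (k%:R / 2 ^+ j).

Definition dyadic_cell j (s : bool) (k : nat) : set R :=
  [set v | (v < 0) = s /\ k%:R <= `|v| * 2 ^+ j < k.+1%:R].

(** Rounding toward zero, with the sign kept apart, so that the approximation never exceeds the
    function in absolute value; this provides the domination needed later. *)
Definition dyadic_trunc j (v : R) : R := dyadic_val j (v < 0) (Num.truncn (`|v| * 2 ^+ j)).

Lemma dyadic_cellP j v s k : dyadic_cell j s k v -> (v < 0) = s /\ Num.truncn (`|v| * 2 ^+ j) = k.
Proof. by move=> [-> /truncn_def]. Qed.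

Lemma dyadic_cell_trunc j v : dyadic_cell j (v < 0) (Num.truncn (`|v| * 2 ^+ j)) v.
Proof. by split=> //; apply: truncn_itv; rewrite mulr_ge0// exprn_ge0. Qed.

Lemma measurable_dyadic_cell j s k : measurable (dyadic_cell j s k).
Proof.
rewrite (_ : dyadic_cell j s k = (if s then `]-oo, 0%R[%classic else ~` `]-oo, 0%R[%classic) `&`
    (fun v => `|v| * 2 ^+ j) @^-1` `[k%:R, k.+1%:R[%classic).
  apply: measurableI; first by case: s => //; exact: measurableC.
  apply: measurable_preimageT; last exact: measurable_itv.
  by apply: measurable_funM => //; exact: measurableT_comp.
apply/seteqP; split=> v /=; rewrite in_itv /=.
  by move=> [<- ->]; split=> //; case: ifPn => /=; rewrite in_itv //= => /negP.
rewrite /dyadic_cell /=; case: s => /= -[]; rewrite in_itv /=; first by move=> ->.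
by move=> /negP/negbTE ->.
Qed.

Lemma dyadic_trunc_itv j v :
  exists2 y, 0 <= y /\ y <= `|v| < y + (2^-1) ^+ j & dyadic_trunc j v = (-1) ^+ (v < 0)%R * y.
Proof.
have p0 : (0 : R) < 2 ^+ j by rewrite exprn_gt0.
have /andP[h1 h2] := @truncn_itv R (`|v| * 2 ^+ j) (mulr_ge0 (normr_ge0 v) (ltW p0)).
exists ((Num.truncn (`|v| * 2 ^+ j))%:R / 2 ^+ j) => //; split.
  by rewrite divr_ge0// ltW.
rewrite ler_pdivrMr// h1 /= exprVn -[X in _ < _ + X]mul1r -mulrDl ltr_pdivlMr//.
by rewrite natr1.
Qed.

Lemma dyadic_trunc_norm j v : `|dyadic_trunc j v| <= `|v|.
Proof.
have [y [y0 /andP[yv _]] ->] := dyadic_trunc_itv j v.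
by rewrite normrMsign ger0_norm.
Qed.

Lemma dyadic_trunc_dist j v : `|dyadic_trunc j v - v| <= (2^-1) ^+ j.
Proof.
have [y [y0 /andP[yv vy]] ->] := dyadic_trunc_itv j v.
have h : `|y - `|v| | <= (2^-1) ^+ j by rewrite distrC ger0_norm ?subr_ge0// lerBlDl ltW.
apply: le_trans h; case: (ltrP v 0) => v0 /=.
  by rewrite (ltr0_norm v0) expr1 mulN1r opprK -opprD normrN.
by rewrite expr0 mul1r (ger0_norm v0).
Qed.

End quantization.

Section simple_approximation.
Variables (R : realType) (d n : nat).
Variable leb : {measure set (Rvec R d) -> \bar R}.
Hypothesis hleb : is_lebesgue leb.
Variable f : 'cV[R]_d -> 'M[R]_n.
Hypothesis mf : forall i l, measurable_fun [set: Rvec R d] (fun x : Rvec R d => f x i l).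

(** The bound on [x] gives finite measure, the bound on [f x] finitely many rounded values. *)
Definition small j : set (Rvec R d) :=
  [set x | (forall i, `|(x : 'cV[R]_d) i 0| <= j%:R) /\ (forall i l, `|f x i l| <= 2 ^+ j)].

Definition simple_approx j (x : 'cV[R]_d) : 'M[R]_n :=
  if `[< small j x >] then \matrix_(i, l) dyadic_trunc j (f x i l) else 0.

(** For a value at most [2^j] rounded at scale [2^-j], the integer part of the code is at most
    [4^j], both ends included. *)
Local Notation code j := 'M[bool * 'I_(4 ^ j).+1]_n.
Local Notation idx j := 'I_(#|{: code j}|).

Definition approx_cell j (k : idx j) : set (Rvec R d) :=
  small j `&` [set x | forall i l, dyadic_cell j (enum_val k i l).1 (enum_val k i l).2 (f x i l)].

Definition approx_val j (k : idx j) : 'M[R]_n :=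
  \matrix_(i, l) dyadic_val R j (enum_val k i l).1 (enum_val k i l).2.

Lemma measurable_le_norm dT (T : measurableType dT) (g : T -> R) (c : R) :
  measurable_fun setT g -> measurable [set x | `|g x| <= c].
Proof.
move=> mg; rewrite (_ : mkset _ = (fun x => `|g x|) @^-1` `]-oo, c]%classic).
  by apply: measurable_preimageT; [exact: measurableT_comp|exact: measurable_itv].
by apply/seteqP; split=> x /=; rewrite in_itv.
Qed.

Lemma measurable_small j : measurable (small j).
Proof.
apply: measurableI.
  by apply: measurable_forall_fin => i; apply: measurable_le_norm; exact: measurable_coord.
by apply: measurable_forall_fin => i; apply: measurable_forall_fin => l; apply: measurable_le_norm.
Qed.

Lemma fin_borel_small j : fin_borel leb (small j).
Proof.
split; first exact: measurable_small.
pose c : R := j%:R + 1; have c0 : 0 <= c by rewrite addr_ge0.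
have cc : - c <= c by lra.
apply: (@le_lt_trans _ _ (leb (box (const_mx (- c)) (const_mx c)))).
  apply: le_measure; rewrite ?inE; [exact: measurable_small|exact: measurable_box|].
  move=> x [hx _] i; have := hx i; rewrite ler_norml !mxE /c => /andP[h1 h2]; apply/andP; split; lra.
by rewrite hleb ?ltry// => i; rewrite !mxE.
Qed.

Lemma fin_borel_approx_cell j k : fin_borel leb (approx_cell (j := j) k).
Proof.
rewrite /approx_cell setIC; apply: fin_borelI; last exact: fin_borel_small.
apply: measurable_forall_fin => i; apply: measurable_forall_fin => l.
by apply: measurable_preimageT => //; exact: measurable_dyadic_cell.
Qed.

Lemma approx_cell_inj j (k k' : idx j) x : approx_cell k x -> approx_cell k' x -> k = k'.
Proof.
move=> [_ h] [_ h']; apply: enum_val_inj; apply/matrixP => i l.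
have [h1 h2] := dyadic_cellP (h i l); have [h1' h2'] := dyadic_cellP (h' i l).
move: h1 h2 h1' h2'; case: (enum_val k i l) => s a; case: (enum_val k' i l) => s' a' /=.
by move=> -> e -> e'; congr (_, _); apply: val_inj; rewrite /= -e -e'.
Qed.

Lemma simple_approxE j x : simple_fun (@approx_cell j) (@approx_val j) x = simple_approx j x.
Proof.
rewrite /simple_approx; case: asboolP => sx; last first.
  by rewrite /simple_fun big1// => k _; rewrite asboolF// => -[].
pose c : code j := \matrix_(i, l) ((f x i l < 0)%R, inord (Num.truncn (`|f x i l| * 2 ^+ j))).
have cl i l : Num.truncn (`|f x i l| * 2 ^+ j) = (c i l).2.
  rewrite mxE /= inordK// ltnS -[leqRHS](@natrK R) le_truncn// natrX.
  rewrite (_ : 4%:R = 2 * 2 :> R) ?exprMn; last by rewrite -natrM.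
  by rewrite ler_wpM2r ?exprn_ge0//; case: sx => _; exact.
have ck : approx_cell (enum_rank c) x.
  split=> // i l; rewrite enum_rankK -cl mxE /=.
  exact: dyadic_cell_trunc.
rewrite /simple_fun (bigD1 (enum_rank c))//= asboolT// big1 ?addr0; last first.
  move=> k kc; rewrite asboolF// => kx; move: kc.
  by rewrite (approx_cell_inj kx ck) eqxx.
apply/matrixP => i l; rewrite !mxE enum_rankK /dyadic_trunc cl.
by rewrite !mxE.
Qed.

Lemma simple_approx_norm j x i l : `|simple_approx j x i l| <= `|f x i l|.
Proof.
rewrite /simple_approx; case: asboolP => _; last by rewrite mxE normr0.
by rewrite mxE dyadic_trunc_norm.
Qed.

Lemma cvg_simple_approx_entry x i l : simple_approx j x i l @[j --> \oo] --> f x i l.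
Proof.
have h2 : `|2^-1 : R| < 1 by rewrite ger0_norm// invf_lt1// ltr1n.
apply/cvgrPdist_le => e e0; near=> j.
have sx : small j x.
  have jb : `|x| + `|f x| <= j%:R by near: j; exact: nbhs_infty_ger.
  split=> [i'|i' l'].
    by apply: le_trans (mx_entry_le _ _ _) _; apply: le_trans jb; rewrite lerDl.
  apply: le_trans (mx_entry_le _ _ _) _; apply: (@le_trans _ _ j%:R).
    by apply: le_trans jb; rewrite lerDr.
  by rewrite -natrX ler_nat ltnW// ltn_expl.
rewrite /simple_approx asboolT// mxE distrC; apply: le_trans (dyadic_trunc_dist _ _) _.
apply: ltW; near: j.
by have /cvgr_lt := cvg_expr h2; apply.
Unshelve. all: by end_near. Qed.

Lemma cvg_simple_approx x : simple_approx j x @[j --> \oo] --> f x.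
Proof.
apply/cvgrPdist_le => e e0.
have h : \forall j \near \oo, forall i l, `|f x i l - simple_approx j x i l| <= e.
  apply: filter_forall => i; apply: filter_forall => l.
  by have /cvgrPdist_le := @cvg_simple_approx_entry x i l; apply.
apply: filterS h => j h; apply: mx_norm_le => [|i l]; first exact: ltW.
by rewrite !mxE.
Qed.

Lemma measurable_simple_approx j i l :
  measurable_fun [set: Rvec R d] (fun x : Rvec R d => simple_approx j x i l).
Proof.
rewrite (_ : (fun _ => _) = (fun x => \sum_(k < #|{: code j}|)
    (\1_(approx_cell k) x * approx_val k i l))).
  apply: measurable_sum => k; apply: measurable_funM => //; apply: measurable_indic.
  by have [] := fin_borel_approx_cell k.
apply/funext => x; rewrite -simple_approxE /simple_fun summxE; apply: eq_bigr => k _.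
rewrite indicE; case: asboolP => kx; first by rewrite mem_set// mul1r.
by rewrite memNset// mul0r mxE.
Qed.

End simple_approximation.

Section entry_sum.
Variables (R : realType) (n : nat).

(** Equivalent to the norm, but a sum over entries: measurability, limits and domination are then
    checked entry by entry. *)
Definition entry_sum (A : 'M[R]_n) : R := \sum_i \sum_l `|A i l|.

Lemma entry_sum_ge0 A : 0 <= entry_sum A.
Proof. by apply: sumr_ge0 => i _; apply: sumr_ge0. Qed.

Lemma norm_le_entry_sum A : `|A| <= entry_sum A.
Proof.
apply: mx_norm_le => [|i l]; first exact: entry_sum_ge0.
rewrite /entry_sum (bigD1 i)//= (bigD1 l)//= -addrA lerDl addr_ge0 ?sumr_ge0// => k _.
exact: sumr_ge0.
Qed.

Lemma entry_sum_le_norm A : entry_sum A <= (n * n)%:R * `|A|.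
Proof.
rewrite natrM -mulrA mulr_natl -[X in _ <= _ *+ X](card_ord n) -sumr_const; apply: ler_sum => i _.
rewrite mulr_natl -[X in _ <= _ *+ X](card_ord n) -sumr_const; apply: ler_sum => l _.
exact: mx_entry_le.
Qed.

Lemma measurable_entry_sum dT (T : measurableType dT) (F : T -> 'M[R]_n) :
  (forall i l, measurable_fun setT (fun x => F x i l)) ->
  measurable_fun setT (fun x => entry_sum (F x)).
Proof.
move=> mF; apply: measurable_sum => i; apply: measurable_sum => l.
exact: measurableT_comp.
Qed.

Lemma cvg_entry_sum_simple_approx d (f : 'cV[R]_d -> 'M[R]_n) x :
  entry_sum (simple_approx f j x - f x) @[j --> \oo] --> 0.
Proof.
have s0 : \sum_(i < n) \sum_(l < n) (0 : R) = 0 by rewrite big1// => i _; rewrite big1.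
rewrite -s0; apply: (@cvg_sum_ord _ _ \oo) => i; apply: (@cvg_sum_ord _ _ \oo) => l.
under eq_fun do rewrite !mxE.
rewrite -(normr0 R) -(subrr (f x i l)); apply: cvg_norm; apply: cvgB; last exact: cvg_cst.
exact: cvg_simple_approx_entry.
Qed.

End entry_sum.

(** * A sufficient condition for the existence of the integral *)

Section KS_criterion.
Variables (R : realType) (d n : nat).
Context dT (T : measurableType dT) (P : probability T R).
Variable leb : {measure set (Rvec R d) -> \bar R}.
Variable M : set (Rvec R d) -> T -> 'cV[R]_n.
Hypothesis hadd : forall As : nat -> set (Rvec R d),
  (forall i, fin_borel leb (As i)) -> trivIset setT As ->
  fin_borel leb (\bigcup_i As i) ->
  {ae P, forall w, series (fun i => M (As i) w) @ \oo --> M (\bigcup_i As i) w}.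
Variables (a : 'cV[R]_n) (C : 'M[R]_n) (nu : {measure set (Rvec R n) -> \bar R}).
Hypothesis hcf : forall A, fin_borel leb A ->
  [/\ measurable_fun setT (M A : T -> Rvec R n),
      inf_div_cf (charfun_rv P (M A)) &
      exists nuA : {measure set (Rvec R n) -> \bar R},
        (forall S, nuA S = ((fine (leb A))%:E * nu S)%E) /\
        has_levy_triplet (charfun_rv P (M A))
          (fine (leb A) *: a) (fine (leb A) *: C) nuA].
Hypothesis hind : forall m (As : 'I_m -> set (Rvec R d)),
  (forall i, fin_borel leb (As i)) ->
  (forall i j, i != j -> As i `&` As j = set0) ->
  indep_rvecs P (fun i => M (As i)).
Hypothesis hnu : levy_measure nu.
Hypothesis hC : forall u, 0 <= dotv u (C *m u).
Variable G : R -> R.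
Hypothesis G_ge0 : forall r, 0 <= r -> 0 <= G r.
Hypothesis G_mono : forall r s, 0 <= r -> r <= s -> G r <= G s.
Hypothesis psi_le_G : forall u, lk_size nu a C u <= G `|u|.

Lemma prob_simple_int (m : nat) (A : 'I_m -> set (Rvec R d)) (Q : 'I_m -> 'M[R]_n) K s
    (h : Rvec R d -> R) : (forall i, fin_borel leb (A i)) -> 0 < K ->
  measurable_fun setT h ->
  (forall x, G (n%:R * K * `|simple_fun A Q x|) <= h x) ->
  (\int[leb]_x (h x)%:E <= s%:E)%E ->
  (P [set w | (2 / K < `|\sum_i Q i *m M (A i) w|)%R] <= (n%:R * (2 * s))%:E)%E.
Proof.
move=> fA K0 mh hh hs.
pose X : T -> 'cV[R]_n := fun w => \sum_i Q i *m M (A i) w.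
have mX : measurable_fun setT (X : T -> Rvec R n) := measurable_simple_int fA hcf Q.
have mXc l : measurable_fun setT (fun w => X w l 0) := measurable_rvec_coord l mX.
pose S k := if insub k is Some l then [set w | (2 / K <= `|X w l 0|)%R] else set0.
have mS k : measurable (S k).
  rewrite /S; case: insubP => [l _ _|//].
  rewrite (_ : mkset _ = (fun w => `|X w l 0|) @^-1` `[2 / K, +oo[%classic).
    by apply: measurable_preimageT; [exact: measurableT_comp|exact: measurable_itv].
  by apply/seteqP; split=> w /=; rewrite in_itv /= andbT.
have SE (l : 'I_n) : S l = [set w | (2 / K <= `|X w l 0|)%R] by rewrite /S valK.
apply: (@le_trans _ _ (\sum_(k < n) P (S k))%E).
  apply: content_subadditive => //.
    by apply: measurable_norm_gt => //; rewrite divr_ge0// ltW.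
  move=> w /= hw; rewrite -bigcup_mkord; apply: contrapT => hn; move: hw.
  apply/negP; rewrite -leNgt; apply: mx_norm_le; first by rewrite divr_ge0// ltW.
  move=> i j; rewrite ord1 leNgt; apply/negP => hl; apply: hn; exists i => //=.
  by rewrite SE /= ltW.
apply: (@le_trans _ _ (\sum_(k < n) (2 * s)%:E)%E).
  apply: lee_sum => l _; rewrite SE.
  have H := prob_simple_int_coord hadd fA hcf hind hnu hC G_ge0 G_mono psi_le_G l K0 mh hh hs.
  exact: H.
by rewrite sumEFin sumr_const card_ord -(mulr_natl (2 * s)).
Qed.

(** Restricting a simple function to [B] only decreases its norm pointwise, so one bound on
    consecutive differences serves every [B], and the same approximating sequence works for all of
    them. *)
Lemma KS_integrable_of_approx (f : 'cV[R]_d -> 'M[R]_n) (ms : nat -> nat)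
    (As : forall j, 'I_(ms j) -> set (Rvec R d)) (Qs : forall j, 'I_(ms j) -> 'M[R]_n)
    (h : nat -> Rvec R d -> R) :
  (forall j i, fin_borel leb (As j i)) ->
  (forall j i i', i != i' -> As j i `&` As j i' = set0) ->
  (forall x, simple_fun (As j) (Qs j) x @[j --> \oo] --> f x) ->
  (forall j, measurable_fun setT (h j)) ->
  (forall j x, G (n%:R * (2 * 2 ^+ j) *
     `|simple_fun (As j.+1) (Qs j.+1) x - simple_fun (As j) (Qs j) x|) <= h j x) ->
  (forall j, \int[leb]_x (h j x)%:E <= ((2^-1) ^+ j)%:E)%E ->
  KS_integrable P leb M f.
Proof.
move=> fAs dAs cf mh hh hs; exists ms, As, Qs; split=> //; first exact: aeW.
move=> B mB; pose X j : T -> 'cV[R]_n := simple_int M (As j) (Qs j) B.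
have fBA j i : fin_borel leb (B `&` As j i) by exact: fin_borelI.
apply: (@fast_cauchy_prob _ _ _ P n X (n%:R * 2)); first by rewrite mulr_ge0.
  by move=> j; exact: (measurable_simple_int (fBA j) hcf).
move=> j.
(* The difference of two consecutive simple functions, written as one simple function over the
   concatenated, possibly overlapping families. *)
pose A (i : 'I_(ms j.+1 + ms j)) :=
  match fintype.split i with inl k => B `&` As j.+1 k | inr k => B `&` As j k end.
pose Q (i : 'I_(ms j.+1 + ms j)) :=
  match fintype.split i with inl k => Qs j.+1 k | inr k => - Qs j k end.
have Al k : A (lshift _ k) = B `&` As j.+1 k by rewrite /A (unsplitK (inl k)).
have Ar k : A (rshift _ k) = B `&` As j k by rewrite /A (unsplitK (inr k)).
have Ql k : Q (lshift _ k) = Qs j.+1 k by rewrite /Q (unsplitK (inl k)).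
have Qr k : Q (rshift _ k) = - Qs j k by rewrite /Q (unsplitK (inr k)).
have XE w : X j.+1 w - X j w = \sum_i Q i *m M (A i) w.
  rewrite big_split_ord /= /X /simple_int -sumrN; congr (_ + _); apply: eq_bigr => k _.
    by rewrite Al Ql.
  by rewrite Ar Qr mulNmx.
have FE x : simple_fun A Q x =
    if `[< B x >] then simple_fun (As j.+1) (Qs j.+1) x - simple_fun (As j) (Qs j) x else 0.
  rewrite /simple_fun big_split_ord /=.
  case: asboolP => Bx; last first.
    by rewrite !big1 ?addr0// => k _; rewrite ?Al ?Ar asboolF// => -[].
  rewrite -sumrN; congr (_ + _); apply: eq_bigr => k _.
    by rewrite Al Ql asbool_and asboolT.
  rewrite Ar Qr asbool_and asboolT//=.
  by case: ifP => _; rewrite ?oppr0.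
have fA i : fin_borel leb (A i) by rewrite /A; case: fintype.split.
(* This [K] makes the threshold [2 / K] equal to [2^(-j)]. *)
have K0 : (0 : R) < 2 * 2 ^+ j by rewrite mulr_gt0// exprn_gt0.
have := @prob_simple_int _ A Q (2 * 2 ^+ j) ((2^-1) ^+ j) (h j) fA K0 (mh j) _ (hs j).
rewrite -mulrA => H; rewrite (_ : mkset _ =
  [set w | (2 / (2 * 2 ^+ j) < `|\sum_i Q i *m M (A i) w|)%R]).
  apply: H => x; apply: le_trans (hh j x); apply: G_mono; first by rewrite !mulr_ge0// ltW.
  rewrite FE; case: asboolP => _ //.
  by rewrite normr0 mulr0 !mulr_ge0// ltW.
apply/seteqP; split=> w /=; rewrite -XE; rewrite (_ : 2 / (2 * 2 ^+ j) = (2^-1) ^+ j)//;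
  by rewrite invfM mulrA divff// mul1r exprVn.
Qed.

Hypothesis G_meas : measurable_fun setT G.
Hypothesis G_cvg0 : forall u : nat -> R, (forall k, 0 <= u k) -> u @ \oo --> 0 ->
  (fun k => G (u k)) @ \oo --> 0.
Hypothesis hleb : is_lebesgue leb.
Variable f : 'cV[R]_d -> 'M[R]_n.
Hypothesis mf : forall i l, measurable_fun [set: Rvec R d] (fun x : Rvec R d => f x i l).
Hypothesis f_lint : forall c : R, 0 <= c -> (\int[leb]_x (G (c * entry_sum (f x)))%:E < +oo)%E.

Let err (c : R) j (x : Rvec R d) : R := G (c * entry_sum (simple_approx f j x - f x)).

Let err_ge0 c j x : 0 <= c -> 0 <= err c j x.
Proof. by move=> c0; apply: G_ge0; rewrite mulr_ge0// entry_sum_ge0. Qed.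

Let measurable_err c j : measurable_fun setT (err c j).
Proof.
apply: measurableT_comp => //; apply: measurable_funM => //; apply: measurable_entry_sum => i l.
rewrite (_ : (fun _ => _) = (fun x => simple_approx f j x i l - f x i l)).
  by apply: measurable_funB; [exact: (measurable_simple_approx hleb mf)|exact: mf].
by apply/funext => x; rewrite !mxE.
Qed.

(** Dominated convergence: the entries of the approximation are bounded by those of [f], so
    [G (2 c |f|)] dominates. Hence finiteness is required for every [c]. *)
Lemma lint_simple_approx_cvg0 c : 0 <= c ->
  (\int[leb]_x (err c j x)%:E)%E @[j --> \oo] --> 0%E.
Proof.
move=> c0; pose g (x : Rvec R d) := G (2 * c * entry_sum (f x)).
have c20 : 0 <= 2 * c by rewrite mulr_ge0.
have g0 x : 0 <= g x by apply: G_ge0; rewrite mulr_ge0// entry_sum_ge0.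
have mg : measurable_fun setT g.
  by apply: measurableT_comp => //; apply: measurable_funM => //; exact: measurable_entry_sum.
have ig : leb.-integrable setT (EFin \o g).
  apply/integrableP; split; first exact/measurable_EFinP.
  under eq_integral => x _ do rewrite /= ger0_norm//.
  exact: f_lint.
have := @dominated_convergence _ _ _ leb setT measurableT (fun j x => (err c j x)%:E)
  (cst 0%E) (EFin \o g).
case=> //.
- by move=> j; apply/measurable_EFinP; exact: measurable_err.
- apply: aeW => x _; apply: cvg_EFin; first exact: nearW.
  apply: G_cvg0 => [j|]; first by rewrite mulr_ge0// entry_sum_ge0.
  rewrite -(mulr0 c); apply: cvgMr.
  exact: cvg_entry_sum_simple_approx.
- apply: aeW => x j _ /=; rewrite lee_fin ger0_norm; last exact: err_ge0.
  apply: G_mono; first by rewrite mulr_ge0// entry_sum_ge0.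
  rewrite [2 * c]mulrC -mulrA; apply: ler_wpM2l => //; rewrite mulr_sumr; apply: ler_sum => i _.
  rewrite mulr_sumr; apply: ler_sum => l _; rewrite !mxE (le_trans (ler_normB _ _))//.
  by rewrite mulr_natl mulr2n lerD// simple_approx_norm.
move=> _ _; rewrite integral0; exact.
Qed.

Lemma KS_integrable_of_lint : KS_integrable P leb M f.
Proof.
(* The outer factor [2] comes from bounding a sum of two errors by twice the larger one. *)
pose c j : R := 2 * (n%:R * (2 * 2 ^+ j)).
have c0 j : 0 <= c j by rewrite !mulr_ge0// exprn_ge0.
have cS j : c j <= c j.+1.
  by rewrite /c !ler_wpM2l// ler_weXn2l// ler1n.
(* The levels [m j] may fail to be monotone; [j <= m j] suffices for convergence. The extra factor
   [1/2] lets the errors at [j] and [j.+1] add up to at most [2^(-j)]. *)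
have /choice[m hm] j : exists m, (j <= m)%N /\
    (\int[leb]_x (err (c j) m x)%:E <= (2^-1 * (2^-1) ^+ j)%:E)%E.
  have e0 : (0 : R) < 2^-1 * (2^-1) ^+ j by rewrite mulr_gt0// exprn_gt0.
  have /fine_cvgP[hfin /cvgrPdist_lt/(_ _ e0) hc] := lint_simple_approx_cvg0 (c0 j).
  have [N _ /(_ N (leqnn N)) [jN [h1 h2]]] : \forall m \near \oo, (j <= m)%N /\
     ((\int[leb]_x (err (c j) m x)%:E)%E \is a fin_num /\
      `|fine 0%E - fine (\int[leb]_x (err (c j) m x)%:E)%E| < 2^-1 * (2^-1) ^+ j).
    by near=> m; split; [near: m; exact: nbhs_infty_ge|split; near: m].
  exists N; split => //; rewrite -[X in (X <= _)%E]fineK// lee_fin ltW//.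
  by move: h2; rewrite /= sub0r normrN; exact: le_lt_trans (ler_norm _).
pose h j x := err (c j) (m j) x + err (c j.+1) (m j.+1) x.
have E j x : simple_fun (@approx_cell R d n f (m j)) (@approx_val R n (m j)) x =
    simple_approx f (m j) x by exact: simple_approxE.
have mm : m @ \oo --> \oo.
  move=> S [N _ hN]; exists N => // j /= Nj; apply: hN => /=.
  by apply: leq_trans Nj _; have [] := hm j.
apply: (@KS_integrable_of_approx f _ (fun j => @approx_cell R d n f (m j))
  (fun j => @approx_val R n (m j)) h).
- by move=> j i; exact: (fin_borel_approx_cell hleb mf).
- move=> j i i' /eqP ii'; apply/seteqP; split=> x //= [h1 h2].
  exact: (ii' (approx_cell_inj h1 h2)).
- move=> x; under eq_fun do rewrite E.
  exact: (cvg_comp _ _ mm (@cvg_simple_approx _ _ _ f x)).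
- by move=> j; apply: measurable_funD; exact: measurable_err.
- move=> j x; rewrite !E /h /err.
  set A := simple_approx f (m j.+1) x; set A' := simple_approx f (m j) x.
  set r := entry_sum (A' - f x); set r' := entry_sum (A - f x).
  have r0 : 0 <= r := entry_sum_ge0 _; have r0' : 0 <= r' := entry_sum_ge0 _.
  have dAA : `|A - A'| <= r + r'.
    rewrite (_ : A - A' = (A - f x) - (A' - f x)); last by rewrite opprB addrA subrK.
    by rewrite (le_trans (ler_normB _ _))// addrC lerD// norm_le_entry_sum.
  pose k : R := n%:R * (2 * 2 ^+ j); have k0 : 0 <= k by rewrite !mulr_ge0// exprn_ge0.
  have aux (b u v : R) : 0 <= b -> u <= 2 * v -> b * u <= 2 * b * v by move=> ? ?; nra.
  have G1 : 0 <= G (c j * r) by rewrite G_ge0// mulr_ge0.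
  have G2 : 0 <= G (c j.+1 * r') by rewrite G_ge0// mulr_ge0.
  rewrite -/k; have [rr|rr] := leP r r'.
    apply: (@le_trans _ _ (G (c j.+1 * r'))); last by rewrite lerDr.
    apply: G_mono; first by rewrite mulr_ge0.
    apply: (@le_trans _ _ (c j * r')); last by rewrite ler_wpM2r.
    by apply: (aux k) => //; lra.
  apply: (@le_trans _ _ (G (c j * r))); last by rewrite lerDl.
  apply: G_mono; first by rewrite mulr_ge0.
  by apply: (aux k) => //; lra.
move=> j; have mE k l : measurable_fun setT (fun x => (err (c k) l x)%:E).
  by apply/measurable_EFinP; exact: measurable_err.
rewrite (_ : (fun x => _) = (fun x => (err (c j) (m j) x)%:E + (err (c j.+1) (m j.+1) x)%:E)%E)//.
rewrite ge0_integralD//; [|by move=> x _; rewrite lee_fin err_ge0..].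
apply: (@le_trans _ _ ((2^-1 * (2^-1) ^+ j)%:E + (2^-1 * (2^-1) ^+ j.+1)%:E)%E).
  by apply: leeD; [exact: (hm j).2|exact: (hm j.+1).2].
have : (0 : R) <= (2^-1) ^+ j by rewrite exprn_ge0.
rewrite -EFinD lee_fin exprS; lra.
Unshelve. all: by end_near. Qed.

End KS_criterion.

(** * Integrability of the kernel *)

(** The trace is the sum of the complex roots of the characteristic polynomial, read off its second
    coefficient; being real, it is the sum of their real parts. *)
Lemma trace_gt0 (R : realType) n (A : 'M[R]_n) : (0 < n)%N -> (forall r, eig_re A r -> 0 < r) ->
  0 < \tr A.
Proof.
move=> n0 hA.
pose Ac : 'M[R[i]]_n := map_mx (fun x : R => (x%:C)%C) A.
have [rs] := closed_field_poly_normal (char_poly Ac).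
rewrite (monicP (char_poly_monic Ac)) scale1r => rsE.
have szrs : size rs = n.
  by have := size_char_poly Ac; rewrite rsE size_prod_XsubC => -[].
have rs0 : size rs != 0%N by rewrite szrs -lt0n.
have := char_poly_trace Ac n0; rewrite rsE -[in n.-1]szrs coefPn_prod_XsubC// => /oppr_inj e.
have -> : \tr A = \sum_(z <- rs) complex.Re z.
  have ReD (x y : R[i]) : complex.Re (x + y) = complex.Re x + complex.Re y by case: x; case: y.
  have Re0 : complex.Re (0 : R[i]) = 0 by [].
  rewrite -(big_morph (@complex.Re R) ReD Re0) e /mxtrace.
  rewrite (big_morph (@complex.Re R) ReD Re0).
  by apply: eq_bigr => i _; rewrite mxE.
have hz z : z \in rs -> 0 < complex.Re z.
  move=> zr; apply: hA; exists z => //=.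
  by rewrite eigenvalue_root_char -/Ac rsE root_prod_XsubC.
case: rs szrs hz {e rsE rs0} => [sz0|z rs _ hz]; first by rewrite -sz0 in n0.
rewrite big_cons ltr_wpDr// ?hz ?mem_head// big_seq sumr_ge0// => y yr.
by apply/ltW/hz; rewrite in_cons yr orbT.
Qed.

(** The right side is the maximum, reached at [t = ln (a / c)]; convexity of the exponential gives
    the bound. *)
Lemma linear_sub_expR_le (R : realType) (a c t : R) : 0 < a -> 0 < c ->
  a * t - c * expR t <= a * (ln (a / c) - 1).
Proof.
move=> a0 c0; pose s := ln (a / c).
have es : c * expR s = a by rewrite /s lnK ?posrE ?divr_gt0// mulrCA divff ?mulr1// gt_eqF.
have : a * (1 + (t - s)) <= c * expR t.
  rewrite -[in leRHS](subrK s t) expRD mulrCA es mulrC.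
  by rewrite ler_wpM2r ?expR_ge1Dx// ltW.
rewrite -/s; lra.
Qed.

Section two_powers.
Variables (R : realType) (p b L : R).
Hypotheses (p0 : 0 < p) (pb : p <= b) (L0 : 0 <= L).

Definition two_powers (r : R) : R := L * (r `^ p + r `^ b).
Local Notation G := two_powers.

Let b0 : 0 < b. Proof. exact: lt_le_trans p0 pb. Qed.

Lemma two_powers_ge0 r : 0 <= G r.
Proof. by rewrite mulr_ge0// addr_ge0// powR_ge0. Qed.

Lemma two_powers_mono r s : 0 <= r -> r <= s -> G r <= G s.
Proof.
move=> r0 rs; have s0 := le_trans r0 rs.
by apply: ler_wpM2l => //; apply: lerD; apply: ge0_ler_powR; rewrite ?nnegrE// ltW.
Qed.

Lemma measurable_two_powers : measurable_fun setT G.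
Proof. by apply: measurable_funM => //; apply: measurable_funD. Qed.

Lemma powR_cvg0_seq (q : R) (u : nat -> R) : 0 < q -> (forall k, 0 <= u k) ->
  u @ \oo --> 0 -> u k `^ q @[k --> \oo] --> 0.
Proof.
move=> q0 u0 cu; apply/cvgr0Pnorm_le => e e0.
have d0 : 0 < e `^ q^-1 by rewrite powR_gt0.
have /cvgr0Pnorm_le/(_ _ d0) := cu.
apply: filterS => k; rewrite ger0_norm// => h.
rewrite ger0_norm ?powR_ge0//.
rewrite -[leRHS]powRr1 ?(ltW e0)// -(mulVf (lt0r_neq0 q0)) powRrM.
by apply: (ge0_ler_powR (ltW q0)); rewrite ?nnegrE ?powR_ge0.
Qed.

Lemma two_powers_cvg0 (u : nat -> R) : (forall k, 0 <= u k) -> u @ \oo --> 0 ->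
  G (u k) @[k --> \oo] --> 0.
Proof.
move=> u0 cu; have h : u k `^ p + u k `^ b @[k --> \oo] --> 0 + 0.
  by apply: cvgD; exact: powR_cvg0_seq.
by rewrite -(mulr0 L) -(addr0 0); apply: cvgMr.
Qed.

(** Replaces subadditivity: the sum is at most twice the larger argument, and [G] is monotone. *)
Lemma two_powersD r s : 0 <= r -> 0 <= s -> G (r + s) <= G (2 * r) + G (2 * s).
Proof.
move=> r0 s0; have [rs|rs] := leP r s.
  apply: (@le_trans _ _ (G (2 * s))); last by rewrite lerDr two_powers_ge0.
  by apply: two_powers_mono; [rewrite addr_ge0|lra].
apply: (@le_trans _ _ (G (2 * r))); last by rewrite lerDl two_powers_ge0.
by apply: two_powers_mono; [rewrite addr_ge0|lra].
Qed.

Lemma two_powers_expR c s D : 0 <= c -> p * s <= D -> b * s <= D ->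
  G (c * expR s) <= G c * expR D.
Proof.
move=> c0 hp hb; rewrite /two_powers -mulrA; apply: ler_wpM2l => //.
rewrite mulrDl !powRM ?expR_ge0// -!expRM; apply: lerD; apply: ler_wpM2l; rewrite ?powR_ge0//.
  by rewrite ler_expR mulrC.
by rewrite ler_expR mulrC.
Qed.

End two_powers.

Lemma measurable_reflect (R : realType) d (v : 'cV[R]_d) :
  measurable_fun setT ((fun y => v - y) : Rvec R d -> Rvec R d).
Proof.
apply: measurable_fun_rvec => i.
rewrite (_ : (fun _ => _) = (fun y : Rvec R d => v i 0 - (y : 'cV[R]_d) i 0)).
  by apply: measurable_funB => //; exact: measurable_coord.
by apply/funext => y; rewrite !mxE.
Qed.

Lemma integral_reflect (R : realType) d (leb : {measure set (Rvec R d) -> \bar R}) :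
  is_lebesgue leb -> forall (v : 'cV[R]_d) (g : Rvec R d -> R),
  measurable_fun setT g -> (forall x, 0 <= g x) ->
  (\int[leb]_y (g (v - y))%:E = \int[leb]_y (g y)%:E)%E.
Proof.
move=> hleb v g mg g0.
pose T (y : Rvec R d) : Rvec R d := v - y.
have mT : measurable_fun setT T := measurable_reflect v.
have := @ge0_integral_pushforward _ _ _ _ R T mT leb setT (fun y => (g y)%:E) measurableT.
rewrite preimage_setT => <-; last 2 first.
- exact/measurable_EFinP.
- by move=> y _; rewrite lee_fin.
by apply: eq_measure_integral => A mA _; exact: (leb_reflect hleb v mA).
Qed.

Lemma integral_reflectD_lt (R : realType) d (leb : {measure set (Rvec R d) -> \bar R}) :
  is_lebesgue leb -> forall (v w : 'cV[R]_d) (g : Rvec R d -> R),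
  measurable_fun setT g -> (forall x, 0 <= g x) -> (\int[leb]_y (g y)%:E < +oo)%E ->
  (\int[leb]_y ((g (v - y))%:E + (g (w - y))%:E) < +oo)%E.
Proof.
move=> hleb v w g mg g0 ig.
have mgr (u : 'cV[R]_d) : measurable_fun setT (fun y : Rvec R d => (g (u - y))%:E).
  by apply/measurable_EFinP; exact: (measurableT_comp mg (measurable_reflect u)).
have gr0 (u : 'cV[R]_d) : forall y : Rvec R d, setT y -> (0 <= (g (u - y))%:E)%E.
  by move=> y _; rewrite lee_fin.
rewrite (ge0_integralD leb measurableT (gr0 v) (mgr v) (gr0 w) (mgr w)).
by rewrite (integral_reflect hleb v mg g0) (integral_reflect hleb w mg g0) lte_add_pinfty.
Qed.

Lemma mxexp_norm_le (R : realType) n (A : 'M[R]_n) t c :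
  0 <= c -> (forall x : 'cV[R]_n, `|mxexp (t *: A) *m x| <= c * `|x|) -> `|mxexp (t *: A)| <= c.
Proof.
move=> c0 h; apply: mx_norm_le => // i l.
have := h (delta_mx l 0); rewrite -colE => /(le_trans (mx_entry_le _ i 0)).
rewrite mxE => /le_trans; apply; rewrite ler_piMr//.
apply: mx_norm_le => // i' l'; rewrite mxE; case: (_ && _); by rewrite ?normr1 ?normr0.
Qed.

Section kernel.
Variables (R : realType) (d n : nat).
Hypotheses (hd : (0 < d)%N) (hn : (0 < n)%N).
Variables (E : 'M[R]_d) (phi : 'cV[R]_d -> R).
Hypothesis hE : forall r, eig_re E r -> 0 < r.
Hypothesis phi_cont : continuous phi.
Hypothesis phi_hom : E_homogeneous E phi.
Hypothesis phi_pos : forall x : 'cV[R]_d, x != 0 -> 0 < phi x.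
Variables (A : 'M[R]_n) (lambda : R).
Hypothesis lambda0 : 0 < lambda.
Variable leb : {measure set (Rvec R d) -> \bar R}.
Hypothesis hleb : is_lebesgue leb.

Definition kernel (y : 'cV[R]_d) : 'M[R]_n := expR (- lambda * phi y) *: mxpow (phi y) A.

Lemma measurable_kernel i l : measurable_fun setT (fun y : Rvec R d => kernel y i l).
Proof.
rewrite (_ : (fun _ => _) = (fun y : Rvec R d => expR (- lambda * phi y) *
   (mxexp (ln (phi y) *: A) i l))); last by apply/funext => y; rewrite !mxE.
have mphi : measurable_fun setT (phi : Rvec R d -> R) by exact: continuous_measurable_rvec.
apply: measurable_funM.
  by apply: measurableT_comp => //; exact: measurable_funM.
apply: (@measurableT_comp _ _ _ _ _ _ (fun t : R => mxexp (t *: A) i l)).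
  apply: continuous_measurable_fun => t; apply: differentiable_continuous.
  by apply/derivable1_diffP; have [] := is_derive_mxexp A t i l.
by apply: measurableT_comp => //; exact: measurable_ln.
Qed.

Lemma measurable_kernel_reflect (v : 'cV[R]_d) i l :
  measurable_fun setT (fun y : Rvec R d => kernel (v - y) i l).
Proof.
apply: (measurableT_comp (measurable_kernel i l)).
exact: measurable_reflect.
Qed.

Variables (p b L al : R).
Hypotheses (p0 : 0 < p) (pb : p <= b) (L0 : 0 <= L).
Hypotheses (hal : al < varpi A) (hb : - (al * b) < \tr E).
Local Notation G := (two_powers p b L).

(** Near the origin [|kernel| <= K1 phi^al]; at infinity [|kernel| <= K2 phi^r2 exp (- lambda phi)].
    Through [G] these become the two power bounds required by [integral_homogeneous_lt]. *)
Lemma lint_kernel c : 0 <= c -> (\int[leb]_y (G (c * entry_sum (kernel y)))%:E < +oo)%E.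
Proof.
move=> c0; have b0 : 0 < b by exact: lt_le_trans p0 pb.
have q0 : 0 < \tr E by exact: trace_gt0.
have [K1 K10 hK1] : exists2 K : R, 0 <= K & forall t, t <= 0 -> `|mxexp (t *: A)| <= K * expR (al * t).
  have [|K K0 hK] := @mxexp_bound_neg R n A al hn.
    by move=> e /varpi_le; exact: lt_le_trans.
  by exists K => // t t0; apply: mxexp_norm_le; [rewrite mulr_ge0// expR_ge0|exact: hK].
have [r2 r20 hr2] := eig_re_ub A.
have [K2 K20 hK2] : exists2 K : R, 0 <= K & forall t, 0 <= t -> `|mxexp (t *: A)| <= K * expR (r2 * t).
  have [K K0 hK] := @mxexp_bound R n A r2 hn hr2.
  by exists K => // t t0; apply: mxexp_norm_le; [rewrite mulr_ge0// expR_ge0|exact: hK].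
pose c' : R := c * (n * n)%:R; have c'0 : 0 <= c' by rewrite mulr_ge0.
pose N := \tr E + 1.
(* By [linear_sub_expR_le], [D e] bounds [(N + e r2) t - e lambda exp t] over [t]. So the power [e]
   of the tempered kernel decays at least like [phi^(-N)], with [t = ln phi]. *)
pose D e : R := (N + e * r2) * (ln ((N + e * r2) / (e * lambda)) - 1).
pose Dm := Num.max (D p) (D b).
(* If [al >= 0] the kernel is bounded near the origin and [kap = 0]. Otherwise the larger power [b]
   gives the stronger singularity, of order [phi^(al b)]. *)
pose kap := Num.max 0 (- (al * b)).
pose C := G (c' * K1) + G (c' * K2) * expR Dm + 1.
have G0 r : 0 <= G r by exact: two_powers_ge0.
have cn (y : 'cV[R]_d) s : `|kernel y| <= s -> G (c * entry_sum (kernel y)) <= G (c' * s).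
  move=> h; apply: two_powers_mono => //; first by rewrite mulr_ge0// entry_sum_ge0.
  rewrite -mulrA ler_wpM2l// (le_trans (entry_sum_le_norm _))//.
  by rewrite ler_wpM2l.
have kn (y : 'cV[R]_d) : `|kernel y| = expR (- lambda * phi y) * `|mxexp (ln (phi y) *: A)|.
  by rewrite normrZ ger0_norm ?expR_ge0.
apply: (@integral_homogeneous_lt R d hd E phi hE phi_cont phi_hom phi_pos leb hleb _ C kap N).
- apply: measurableT_comp; first exact: measurable_two_powers.
  by apply: measurable_funM => //; apply: measurable_entry_sum; exact: measurable_kernel.
- by [].
- by rewrite /C ltr_wpDl// addr_ge0// mulr_ge0// expR_ge0.
- by rewrite le_max lexx.
- by rewrite gt_max q0.
- by rewrite ltrDl.
- move=> y y0 y1; have yp := phi_pos y0; pose t := ln (phi y).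
  have t0 : t <= 0 by rewrite ln_le0.
  rewrite -/t; apply: (@le_trans _ _ (G (c' * K1 * expR (al * t)))).
    rewrite -mulrA; apply: cn; rewrite kn.
    apply: le_trans (hK1 t t0); rewrite ler_piMl// -expR0 ler_expR mulNr oppr_le0.
    by rewrite mulr_ge0// ltW.
  have kt e : 0 < e -> e <= b -> e * (al * t) <= - kap * t.
    move=> e0 eb; rewrite mulNr -mulrN mulrA -[e * al * t]opprK -mulrN -mulNr.
    apply: ler_wpM2r; first by rewrite oppr_ge0.
    have [al0|al0] := leP 0 al.
      by rewrite le_max; apply/orP; left; rewrite oppr_le0 mulr_ge0// ltW.
    by rewrite le_max; apply/orP; right; rewrite lerN2 mulrC; nra.
  apply: (@le_trans _ _ (G (c' * K1) * expR (- kap * t))).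
    by apply: two_powers_expR; rewrite ?mulr_ge0//; apply: kt.
  apply: ler_wpM2r; first exact: expR_ge0.
  by rewrite /C -addrA lerDl addr_ge0// mulr_ge0// expR_ge0.
move=> y y0 y1; have yp := phi_pos y0; pose t := ln (phi y).
have t0 : 0 <= t by rewrite ln_ge0.
have et : phi y = expR t by rewrite lnK.
rewrite -/t; apply: (@le_trans _ _ (G (c' * K2 * expR (r2 * t - lambda * expR t)))).
  rewrite -mulrA; apply: cn; rewrite kn -et -/t expRD mulrA mulNr mulrC.
  by rewrite ler_wpM2r ?expR_ge0// hK2.
have kt e : 0 < e -> D e <= Dm -> e * (r2 * t - lambda * expR t) <= Dm - N * t.
  move=> e0 eb.
  have N0 : 0 < N by rewrite addr_gt0.
  have := @linear_sub_expR_le R (N + e * r2) (e * lambda) t.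
  rewrite -/(D e) => /(_ _ _)/le_trans; move: (expR t) => w.
  have a0 : 0 < N + e * r2 by rewrite addr_gt0// mulr_gt0.
  have l0 : 0 < e * lambda by rewrite mulr_gt0.
  move=> /(_ _ a0 l0 eb); lra.
apply: (@le_trans _ _ (G (c' * K2) * expR (Dm - N * t))).
  by apply: two_powers_expR; rewrite ?mulr_ge0//; apply: kt => //; rewrite le_max lexx ?orbT.
rewrite expRD mulrA mulNr; apply: ler_wpM2r; first exact: expR_ge0.
by rewrite /C addrAC lerDr addr_ge0.
Qed.

(** [two_powersD] separates the two terms; each is a reflected translate of the kernel, and Lebesgue
    measure is invariant under [y -> v - y]. *)
Lemma lint_kernel_increment x c : 0 <= c ->
  (\int[leb]_y (G (c * entry_sum (kernel (x - y) - kernel (- y))))%:E < +oo)%E.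
Proof.
move=> c0; have G0 r : 0 <= G r by exact: two_powers_ge0.
pose g (y : Rvec R d) : R := G (2 * c * entry_sum (kernel y)).
have c20 : 0 <= 2 * c by rewrite mulr_ge0.
have mg : measurable_fun setT g.
  apply: measurableT_comp; first exact: measurable_two_powers.
  by apply: measurable_funM => //; apply: measurable_entry_sum; exact: measurable_kernel.
have mgv (v : 'cV[R]_d) : measurable_fun setT (fun y : Rvec R d => (g (v - y))%:E).
  apply/measurable_EFinP; apply: measurableT_comp; first exact: measurable_two_powers.
  by apply: measurable_funM => //; apply: measurable_entry_sum; exact: measurable_kernel_reflect.
apply: (@le_lt_trans _ _ (\int[leb]_y ((g (x - y))%:E + (g (0 - y))%:E))%E).
  apply: ge0_le_integral => //.
  - by move=> y _; rewrite lee_fin.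
  - apply/measurable_EFinP; apply: measurableT_comp; first exact: measurable_two_powers.
    apply: measurable_funM => //; apply: measurable_entry_sum => i l.
    rewrite (_ : (fun _ => _) = (fun y : Rvec R d => kernel (x - y) i l - kernel (0 - y) i l)).
      by apply: measurable_funB; exact: measurable_kernel_reflect.
    by apply/funext => y; rewrite sub0r [LHS]mxE [X in _ + X]mxE.
  - by apply: emeasurable_funD; exact: mgv.
  - move=> y _; rewrite -EFinD lee_fin sub0r /g.
    set u := entry_sum (kernel (x - y)); set w := entry_sum (kernel (- y)).
    have u0 : 0 <= u := entry_sum_ge0 _; have w0 : 0 <= w := entry_sum_ge0 _.
    rewrite -!mulrA; apply: le_trans (two_powersD p0 pb L0 (mulr_ge0 c0 u0) (mulr_ge0 c0 w0)).
    apply: two_powers_mono => //; first by rewrite mulr_ge0// entry_sum_ge0.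
    rewrite -mulrDr ler_wpM2l// /u /w /entry_sum -big_split; apply: ler_sum => i _ /=.
    by rewrite -big_split; apply: ler_sum => l _ /=; rewrite !mxE ler_normB.
apply: (integral_reflectD_lt hleb) => //; first by move=> y; exact: G0.
exact: lint_kernel.
Qed.

End kernel.

(** With [s = v + q w > 0], decreasing [w] by [m <= s / (2 q)] to [r = w - m] leaves
    [v + q r >= s / 2], and [m <= w / 2] keeps [r] positive. Subtracting half of [v + q r] from [v]
    gives [al] with [al + q r > 0]. *)
Lemma exists_stability_exponents (R : realType) (q v w : R) : 0 < q -> 0 < w -> 0 < v + q * w ->
  exists r al, [/\ 0 < r, r < w, al < v & - (al * r^-1) < q].
Proof.
move=> q0 w0 s0; pose m := Num.min (w / 2) ((v + q * w) / (2 * q)).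
have m0 : 0 < m by rewrite lt_min !divr_gt0// mulr_gt0.
have m1 : m <= w / 2 by rewrite ge_min lexx.
have m2 : 2 * (q * m) <= v + q * w.
  by rewrite mulrA mulrC -ler_pdivlMr ?mulr_gt0// ge_min lexx orbT.
have r0 : 0 < w - m by lra.
have h : 0 < v + q * (w - m) by rewrite mulrBr; lra.
exists (w - m), (v - (v + q * (w - m)) / 2); split=> //; [lra|lra|].
rewrite -mulNr ltr_pdivrMr//; lra.
Qed.

Unset Implicit Arguments.
Set Strict Implicit.
Set Printing Implicit Defensive.

Theorem mainTheorem1
  (R : realType) (d n : nat) (hd : (0 < d)%N) (hn : (0 < n)%N)
  (* E with all eigenvalues of positive real part; q = tr E *)
  (E : 'M[R]_d) (hE : forall r, eig_re E r -> 0 < r)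
  (* phi continuous, E-homogeneous, positive off the origin *)
  (phi : 'cV[R]_d -> R) (phi_cont : continuous phi)
  (phi_hom : E_homogeneous E phi)
  (phi_pos : forall x : 'cV[R]_d, x != 0 -> 0 < phi x)
  (* H with varpi_H > 0 *)
  (H : 'M[R]_n) (hH : 0 < varpi H)
  (* mu full, strictly operator-stable with exponent B *)
  (mu : probability (Rvec R n) R) (B : 'M[R]_n)
  (mu_full : full mu) (mu_os : strictly_operator_stable mu B)
  (* Lebesgue measure on R^d *)
  (leb : {measure set (Rvec R d) -> \bar R}) (hleb : is_lebesgue leb)
  (* the random measure M generated by mu and Lebesgue measure *)
  (dT : measure_display) (T : measurableType dT) (P : probability T R)
  (M : set (Rvec R d) -> T -> 'cV[R]_n)
  (hM : random_measure_gen P leb mu M)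
  (lambda : R) (hlambda : 0 < lambda)
  (hvarpi : 0 < varpi (H - (\tr E) *: B) + (\tr E) * varpi B) :
  forall x : 'cV[R]_d,
    KS_integrable P leb M (fun y : 'cV[R]_d =>
      expR (- lambda * phi (x - y)) *: mxpow (phi (x - y)) (H - (\tr E) *: B)
      - expR (- lambda * phi (- y)) *: mxpow (phi (- y)) (H - (\tr E) *: B)).
Proof.
move=> x; set A := H - \tr E *: B in hvarpi *.
have q0 : 0 < \tr E by exact: trace_gt0.
case: hM => -[a [Q [nu [hmu hcf]]]] hind hadd.
have [hnu _ hQ _] := hmu.
have w0 : 0 < varpi B by apply: varpi_gt => // e; exact: (stable_eig_gt0 hmu mu_os mu_full).
have [r1 [al [r10 r1w alv alb]]] := exists_stability_exponents q0 w0 hvarpi.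
have [p [L [p0 pb L0 hL]]] := lk_size_growth hn hmu mu_os r10 r1w.
apply: (KS_integrable_of_lint hadd hcf hind hnu hQ (G := two_powers p r1^-1 L)) => //.
- by move=> r _; exact: two_powers_ge0.
- by move=> r s; exact: two_powers_mono.
- exact: measurable_two_powers.
- by move=> u; exact: two_powers_cvg0.
- move=> i l.
  (* Writing [- y] as [0 - y] puts both terms in the reflected form [v - y]. *)
  rewrite (_ : (fun _ => _) = (fun y : Rvec R d => kernel phi A lambda (x - y) i l -
      kernel phi A lambda (0 - y) i l)).
    by apply: measurable_funB; exact: measurable_kernel_reflect.
  by apply/funext => y; rewrite sub0r [LHS]mxE [X in _ + X]mxE.
- move=> c c0.
  exact: (lint_kernel_increment hd hn hE phi_cont phi_hom phi_pos hlambda hleb p0 pb L0 alv alb x c0).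
Qed.
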